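(* Let $\mu>0$, $\lambda+\mu>0$, and $\kappa=\frac{\lambda+3\mu}{\lambda+\mu}$. Let $D\subset\mathbb{R}^2\cong\mathbb{C}$ be a bounded, simply connected, planar Lipschitz domain, with exterior conformal mapping $\Phi(w)=w+a_0+a_1w^{-1}+a_2w^{-2}+\cdots$, $|w|>\gamma$. Let $m^{ij}_{kl}$ ($i,j,k,l\in\{1,2\}$) be the first-order elastic moment tensors of the rigid inclusion $D$ associated with the background Lamé constants $(\lambda,\mu)$. For $i=1,2,3$ let $c^{(i)}_m$, $m\in\mathbb{Z}\setminus\{0\}$, be the expansion coefficients of the densities $\varphi^{(i)}$ corresponding to the background solutions $$u^{(1)}(z)=\frac{\kappa-1}{2\mu}(z-a_0),\qquad u^{(2)}(z)=-\frac{1}{2\mu}\overline{(z-a_0)},\qquad u^{(3)}(z)=\frac{\mathrm{i}}{2\mu}\overline{(z-a_0)},$$ and set $$\mathbb{E}^{(1,i)}:=2\pi\Big(\gamma c_{-1}^{(i)}+\sum_{m=1}^{\infty}a_m\frac{c_m^{(i)}}{\gamma^{m}}\Big),\qquad \mathbb{E}^{(2,i)}:=2\pi\Big(\gamma\overline{c_1^{(i)}}+\sum_{m=1}^{\infty}a_m\frac{\overline{c_{-m}^{(i)}}}{\gamma^{m}}\Big),\qquad i=1,2,3.$$ Then $$\begin{aligned} m^{11}_{11}&=\frac{\mu}{2(\kappa-1)}\left[\operatorname{Re}\big(\mathbb{E}^{(1,1)}\big)+\mathbb{E}^{(2,1)}\right]-\frac{\mu}{2}\left[\operatorname{Re}\big(\mathbb{E}^{(1,2)}\big)+\mathbb{E}^{(2,2)}\right],\\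 m^{22}_{22}&=\frac{\mu}{2(\kappa-1)}\left[-\operatorname{Re}\big(\mathbb{E}^{(1,1)}\big)+\mathbb{E}^{(2,1)}\right]+\frac{\mu}{2}\left[-\operatorname{Re}\big(\mathbb{E}^{(1,2)}\big)+\mathbb{E}^{(2,2)}\right],\\ m^{11}_{22}&=\frac{\mu}{2(\kappa-1)}\operatorname{Re}\big(\mathbb{E}^{(2,1)}\big)+\frac{\mu}{2}\operatorname{Re}\big(\mathbb{E}^{(1,2)}\big),\\ m^{12}_{12}&=\frac{\mu}{2}\operatorname{Im}\big(\mathbb{E}^{(1,3)}\big),\\ m^{12}_{11}&=\frac{\mu}{2}\left[\operatorname{Re}\big(\mathbb{E}^{(1,3)}\big)+\mathbb{E}^{(2,3)}\right],\\ m^{21}_{22}&=\frac{\mu}{2}\left[-\operatorname{Re}\big(\mathbb{E}^{(1,3)}\big)+\mathbb{E}^{(2,3)}\right]. \end{aligned}$$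
   Context: Identification: $x=(x_1,x_2)\in\mathbb{R}^2$ is identified with $z=x_1+\mathrm{i}x_2\in\mathbb{C}$, and a vector field $\mathbf{f}=(f_1,f_2)$ with the complex function $f=f_1+\mathrm{i}f_2$. $e_1,e_2$ is the standard basis of $\mathbb{R}^2$. Exterior conformal mapping: for a bounded simply connected domain $D$, there are a unique $\gamma>0$ and a unique conformal map $\Phi:\{|w|>\gamma\}\to\mathbb{C}\setminus\overline{D}$ of the form $\Phi(w)=w+a_0+a_1w^{-1}+a_2w^{-2}+\cdots$, with $a_n\in\mathbb{C}$. The boundary $\partial D$ is parametrized by $\theta\mapsto\Phi(\gamma e^{\mathrm{i}\theta})$ (boundary values of $\Phi$), with scale factor $h(\theta)=\left|\partial_\theta\Phi(\gamma e^{\mathrm{i}\theta})\right|$, so that $d\sigma=h\,d\theta$ on $\partial D$. Lamé system: the Lamé operator is $\mathcal{L}_{\lambda,\mu}\mathbf{u}=\mu\Delta\mathbf{u}+(\lambda+\mu)\nabla\nabla\cdot\mathbf{u}$, with conormal derivative $\frac{\partial\mathbf{u}}{\partial\nu}=\lambda(\nabla\cdot\mathbf{u})N+\mu(\nabla\mathbf{u}+\nabla\mathbf{u}^T)N$ on $\partial D$, $N$ the outward unit normal. Its fundamental solution is the Kelvin matrix $\Gamma=(\Gamma_{ij})$, $\Gamma_{ij}(x)=\frac{\alpha}{2\pi}\delta_{ij}\log|x|-\frac{\beta}{2\pi}\frac{x_ix_j}{|x|^2}$, with $\alpha=\frac12\left(\frac1\mu+\frac1{2\mu+\lambda}\right)$,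 $\beta=\frac12\left(\frac1\mu-\frac1{2\mu+\lambda}\right)$. The single-layer potential is $\mathbf{S}_{\partial D}[\boldsymbol{\varphi}](x)=\int_{\partial D}\Gamma(x-y)\boldsymbol{\varphi}(y)\,d\sigma(y)$. Rigid displacements: $\mathbf{R}_1(x)=(1,0)$, $\mathbf{R}_2(x)=(0,1)$, $\mathbf{R}_3(x)=(x_2,-x_1)$, $\Psi=\operatorname{Span}\{\mathbf{R}_1,\mathbf{R}_2,\mathbf{R}_3\}$, and $L^2_\Psi(\partial D)=\{f\in L^2(\partial D)^2:\int_{\partial D}f\cdot\psi\,d\sigma=0\ \text{for all }\psi\in\Psi\}$. Rigid inclusion problem: given a background solution $\mathbf{H}$ (a solution of $\mathcal{L}_{\lambda,\mu}\mathbf{H}=0$ in $\mathbb{R}^2$), $\mathbf{u}$ solves $$\mathcal{L}_{\lambda,\mu}\mathbf{u}=0\ \text{in }\mathbb{R}^2\setminus\overline{D},\qquad \mathbf{u}|^+=b_1\mathbf{R}_1+b_2\mathbf{R}_2+b_3\mathbf{R}_3\ \text{on }\partial D,\qquad \mathbf{u}(x)-\mathbf{H}(x)=O(|x|^{-1})\ \text{as }|x|\to\infty,$$ where $|^+$ denotes the limit from the exterior of $D$ and the real constants $b_1,b_2,b_3$ are determined by $\int_{\partial D}\frac{\partial\mathbf{u}}{\partial\nu}\big|^+\cdot\mathbf{R}_j\,d\sigma=0$ for $j=1,2,3$. The solution has the form $\mathbf{u}=\mathbf{H}+\mathbf{S}_{\partial D}[\boldsymbol{\varphi}]$ in $\mathbb{R}^2\setminus\overline{D}$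 with $\boldsymbol{\varphi}\in L^2_\Psi(\partial D)$; this $\boldsymbol{\varphi}$ is called the density corresponding to $\mathbf{H}$. Elastic moment tensors: for $i,j\in\{1,2\}$ let $g^j_i\in L^2_\Psi(\partial D)$ be the density corresponding to $\mathbf{H}(x)=x_ie_j$. Then $m^{ij}_{kl}=\int_{\partial D}y_k\,(g^j_i(y))_l\,d\sigma(y)$, where $(\cdot)_l$ is the $l$-th component. Densities $\varphi^{(i)}$: for $i=1,2,3$, $\varphi^{(i)}$ is the (complex form of the) density corresponding to the background solution $\mathbf{H}$ whose complex form is $u^{(i)}$. It is expanded on $\partial D$ as $\varphi^{(i)}=\sum_{m=1}^\infty c^{(i)}_m\frac{e^{\mathrm{i}m\theta}}{h}+\sum_{m=1}^\infty c^{(i)}_{-m}\frac{e^{-\mathrm{i}m\theta}}{h}$; i.e. $c^{(i)}_m$ are the Fourier coefficients in $\theta$ of $h\varphi^{(i)}$ (the zeroth one vanishes because $\varphi^{(i)}\in L^2_\Psi(\partial D)$). *)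

(* Defs.v *)
(* Vectors of R^2 are row vectors ['rV[R]_2]; the coordinates x_1, x_2 are
   [x 0 i1] and [x 0 i2], and the standard basis e_1, e_2 is ['e_i1], ['e_i2].
   The topology of ['rV[R]_2] comes from the sup norm, so the Euclidean norm is
   defined separately.  [R[i]^o] is [R[i]] seen as a normed module over itself;
   complex limits and complex derivatives are taken there. *)
From HB Require Import structures.
From mathcomp Require Import all_boot all_order all_algebra.
From mathcomp Require Import complex.
From mathcomp Require Import all_classical all_reals all_analysis.

Set Implicit Arguments.
Unset Strict Implicit.
Unset Printing Implicit Defensive.

Import Order.TTheory GRing.Theory Num.Theory.
Import numFieldNormedType.Exports.

Local Open Scope classical_set_scope.
Local Open Scope ring_scope.
Local Open Scope complex_scope.

Definition i1 : 'I_2 := ord0.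
Definition i2 : 'I_2 := ord_max.

Definition vec2 {R : realType} (a b : R) : 'rV[R]_2 :=
  \row_k (if k == i1 then a else b).

Definition dot {R : realType} (x y : 'rV[R]_2) : R := \sum_k x 0 k * y 0 k.

Definition enorm {R : realType} (x : 'rV[R]_2) : R := Num.sqrt (dot x x).

Definition toC {R : realType} (x : 'rV[R]_2) : R[i] := x 0 i1 +i* x 0 i2.

Definition ofC {R : realType} (z : R[i]) : 'rV[R]_2 :=
  vec2 (complex.Re z) (complex.Im z).

Definition complex_form {R : realType} (u : R[i] -> R[i]) (x : 'rV[R]_2) :
  'rV[R]_2 := ofC (u (toC x)).

Definition bdry {R : realType} (D : set 'rV[R]_2) : set 'rV[R]_2 :=
  closure D `\` interior D.

Definition path_connected {R : realType} (D : set 'rV[R]_2) : Prop :=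
  forall x y, D x -> D y -> exists p : R -> 'rV[R]_2,
    [/\ {within `[0, 1], continuous p}, p @` `[0, 1] `<=` D,
        p 0 = x & p 1 = y].

Definition simply_connected {R : realType} (D : set 'rV[R]_2) : Prop :=
  path_connected D /\
  forall p : R -> 'rV[R]_2,
    {within `[0, 1], continuous p} -> p @` `[0, 1] `<=` D -> p 0 = p 1 ->
    exists F : R * R -> 'rV[R]_2,
      [/\ {within `[0, 1] `*` `[0, 1], continuous F},
          F @` (`[0, 1] `*` `[0, 1]) `<=` D,
          (forall t, t \in `[0, 1] -> F (0, t) = p t),
          (forall t, t \in `[0, 1] -> F (1, t) = p 0) &
          (forall s, s \in `[0, 1] -> F (s, 0) = p 0 /\ F (s, 1) = p 0)].

(* Near each boundary point, in orthonormal coordinates along the unit vector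
   e and its rotation by a right angle, D is the region above the graph of a
   Lipschitz function. *)
Definition lipschitz_boundary {R : realType} (D : set 'rV[R]_2) : Prop :=
  forall p, bdry D p ->
    exists (r : R) (e : 'rV[R]_2) (psi : R -> R) (k : R),
      [/\ 0 < r, enorm e = 1, k.-lipschitz psi &
          forall x, enorm (x - p) < r ->
            (D x <-> psi (dot x e) < dot x (vec2 (- e 0 i2) (e 0 i1)))].

Definition bounded_simply_connected_lipschitz_domain {R : realType}
    (D : set 'rV[R]_2) : Prop :=
  [/\ open D, D !=set0, bounded_set D, simply_connected D &
      lipschitz_boundary D].

Definition exterior {R : realType} (D : set 'rV[R]_2) : set 'rV[R]_2 :=
  ~` closure D.

Definition cseries_partial {R : realType} (a : nat -> R[i]) (w : R[i]) :
  nat -> R[i]^o := fun N => \sum_(0 <= n < N) a n / w ^+ n.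

(* On the circle |w| = gam, [Phi] stands for its own boundary values, which
   exist as a continuous extension by Caratheodory's theorem. *)
Record exterior_conformal_map {R : realType} (D : set 'rV[R]_2) (gam : R)
    (Phi : R[i] -> R[i]) (a : nat -> R[i]) : Prop := ExteriorConformalMap {
  ecm_gam_gt0 : 0 < gam ;
  ecm_holomorphic : forall w : R[i], gam%:C < `|w| ->
    derivable (Phi : R[i]^o -> R[i]^o) w 1 ;
  ecm_injective : forall w1 w2 : R[i], gam%:C < `|w1| -> gam%:C < `|w2| ->
    Phi w1 = Phi w2 -> w1 = w2 ;
  ecm_image : Phi @` [set w : R[i] | gam%:C < `|w|] = toC @` exterior D ;
  ecm_expansion : forall w : R[i], gam%:C < `|w| ->
    cseries_partial a w @ \oo --> (Phi w - w : R[i]^o) ;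
  ecm_boundary : {within [set w : R[i]^o | gam%:C <= `|w|],
    continuous (Phi : R[i]^o -> R[i]^o)} }.

Definition expi {R : realType} (t : R) : R[i] := cos t +i* sin t.

Definition bdpt {R : realType} (gam : R) (Phi : R[i] -> R[i]) (t : R) :
  'rV[R]_2 := ofC (Phi (gam%:C * expi t)).

Definition tangent {R : realType} (gam : R) (Phi : R[i] -> R[i]) (t : R) :
  'rV[R]_2 := 'D_1 (bdpt gam Phi) t.

Definition scale_factor {R : realType} (gam : R) (Phi : R[i] -> R[i]) (t : R) : R :=
  enorm (tangent gam Phi t).

(* [bdpt] runs counterclockwise, so the outward normal is the unit tangent
   turned clockwise by a right angle. *)
Definition unit_normal {R : realType} (gam : R) (Phi : R[i] -> R[i]) (t : R) :
    'rV[R]_2 :=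
  (scale_factor gam Phi t)^-1 *:
    vec2 (tangent gam Phi t 0 i2) (- tangent gam Phi t 0 i1).

(* Integration over the boundary against d(sigma) = h d(theta). *)
Definition bdintegral {R : realType} (gam : R) (Phi : R[i] -> R[i])
    (f : 'rV[R]_2 -> R) : R :=
  \int[lebesgue_measure]_(t in `[0, 2 * pi])
    (f (bdpt gam Phi t) * scale_factor gam Phi t).

Definition bdintegrable {R : realType} (gam : R) (Phi : R[i] -> R[i])
    (f : 'rV[R]_2 -> R) : Prop :=
  lebesgue_measure.-integrable `[0, 2 * pi]
    (fun t => (f (bdpt gam Phi t) * scale_factor gam Phi t)%:E).

Definition bdL2 {R : realType} (gam : R) (Phi : R[i] -> R[i])
    (f : 'rV[R]_2 -> 'rV[R]_2) : Prop :=
  forall k, measurable_fun `[0, 2 * pi] (fun t => f (bdpt gam Phi t) 0 k) /\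
    bdintegrable gam Phi (fun y => f y 0 k ^+ 2).

Definition partial {R : realType} (j : 'I_2) (f : 'rV[R]_2 -> R)
  (x : 'rV[R]_2) : R := 'D_('e_j) f x.

Definition component {R : realType} (k : 'I_2) (u : 'rV[R]_2 -> 'rV[R]_2)
  (x : 'rV[R]_2) : R := u x 0 k.

Definition divergence {R : realType} (u : 'rV[R]_2 -> 'rV[R]_2)
  (x : 'rV[R]_2) : R := \sum_k partial k (component k u) x.

Definition jacobi {R : realType} (u : 'rV[R]_2 -> 'rV[R]_2)
  (x : 'rV[R]_2) : 'M[R]_2 := \matrix_(k, j) partial j (component k u) x.

Definition lame {R : realType} (lam mu : R) (u : 'rV[R]_2 -> 'rV[R]_2)
    (x : 'rV[R]_2) : 'rV[R]_2 :=
  \row_k (mu * (\sum_j partial j (partial j (component k u)) x)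
          + (lam + mu) * partial k (divergence u) x).

Definition C2_on {R : realType} (U : set 'rV[R]_2)
    (u : 'rV[R]_2 -> 'rV[R]_2) : Prop :=
  forall x, U x -> forall i j k : 'I_2,
    [/\ derivable (component k u : 'rV[R]_2 -> R^o) x 'e_i,
        derivable (partial i (component k u) : 'rV[R]_2 -> R^o) x 'e_j &
        {for x, continuous (partial j (partial i (component k u)))}].

Definition lame_solution {R : realType} (lam mu : R) (U : set 'rV[R]_2)
    (u : 'rV[R]_2 -> 'rV[R]_2) : Prop :=
  C2_on U u /\ forall x, U x -> lame lam mu u x = 0.

(* The matrix acts on the row vector N from the right; it is symmetric. *)
Definition conormal {R : realType} (lam mu : R) (u : 'rV[R]_2 -> 'rV[R]_2)
    (x N : 'rV[R]_2) : 'rV[R]_2 :=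
  (lam * divergence u x) *: N
  + mu *: (N *m (jacobi u x + (jacobi u x)^T)).

Definition kelvin {R : realType} (lam mu : R) (x : 'rV[R]_2) : 'M[R]_2 :=
  let alpha := 2^-1 * (mu^-1 + (2 * mu + lam)^-1) in
  let beta := 2^-1 * (mu^-1 - (2 * mu + lam)^-1) in
  \matrix_(i, j) (alpha / (2 * pi) * (i == j)%:R * ln (enorm x)
                  - beta / (2 * pi) * (x 0 i * x 0 j / enorm x ^+ 2)).

Definition single_layer {R : realType} (lam mu gam : R) (Phi : R[i] -> R[i])
    (phi : 'rV[R]_2 -> 'rV[R]_2) (x : 'rV[R]_2) : 'rV[R]_2 :=
  \row_i bdintegral gam Phi
    (fun y => \sum_j kelvin lam mu (x - y) i j * phi y 0 j).

(* R_1, R_2, R_3 are the values at 0, 1, 2. *)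
Definition rigid {R : realType} (j : 'I_3) (x : 'rV[R]_2) : 'rV[R]_2 :=
  match val j with
  | 0 => vec2 1 0
  | 1 => vec2 0 1
  | _ => vec2 (x 0 i2) (- x 0 i1)
  end.

Definition rigid_comb {R : realType} (b : 'I_3 -> R) (x : 'rV[R]_2) :
  'rV[R]_2 := \sum_j b j *: rigid j x.

Definition L2Psi {R : realType} (gam : R) (Phi : R[i] -> R[i])
    (f : 'rV[R]_2 -> 'rV[R]_2) : Prop :=
  bdL2 gam Phi f /\
  forall b : 'I_3 -> R,
    bdintegral gam Phi (fun y => dot (f y) (rigid_comb b y)) = 0.

Definition nontangential {R : realType} (D : set 'rV[R]_2) (s : R)
    (y : 'rV[R]_2) : set 'rV[R]_2 :=
  [set x | exterior D x /\
    forall z, bdry D z -> enorm (x - y) <= (1 + s) * enorm (x - z)].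

(* T is the exterior trace of the conormal derivative of u: sigma-almost
   everywhere on the boundary (points with h = 0 are sigma-negligible) it is
   the limit through every nontangential approach region. *)
Definition exterior_conormal_trace {R : realType} (lam mu : R)
    (D : set 'rV[R]_2) (gam : R) (Phi : R[i] -> R[i])
    (u T : 'rV[R]_2 -> 'rV[R]_2) : Prop :=
  {ae lebesgue_measure, forall t : R, t \in `[0, 2 * pi] ->
    0 < scale_factor gam Phi t -> forall s : R, 0 < s ->
    conormal lam mu u x (unit_normal gam Phi t)
      @[x --> within (nontangential D s (bdpt gam Phi t))
                     (nbhs (bdpt gam Phi t))]
      --> T (bdpt gam Phi t)}.

(* Only the values of u outside the closure of D matter. *)
Definition rigid_inclusion_solution {R : realType} (lam mu : R)
    (D : set 'rV[R]_2) (gam : R) (Phi : R[i] -> R[i])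
    (H u : 'rV[R]_2 -> 'rV[R]_2) : Prop :=
  [/\ lame_solution lam mu (exterior D) u,
      (exists b : 'I_3 -> R, forall y, bdry D y ->
         u x @[x --> within (exterior D) (nbhs y)] --> rigid_comb b y),
      (exists M C : R, forall x, M <= enorm x ->
         enorm (u x - H x) <= C / enorm x) &
      (exists T : 'rV[R]_2 -> 'rV[R]_2,
         exterior_conormal_trace lam mu D gam Phi u T /\
         forall j, bdintegrable gam Phi (fun y => dot (T y) (rigid j y)) /\
           bdintegral gam Phi (fun y => dot (T y) (rigid j y)) = 0)].

Definition is_density {R : realType} (lam mu : R) (D : set 'rV[R]_2) (gam : R)
    (Phi : R[i] -> R[i]) (H phi : 'rV[R]_2 -> 'rV[R]_2) : Prop :=
  [/\ lame_solution lam mu setT H,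
      L2Psi gam Phi phi &
      exists u : 'rV[R]_2 -> 'rV[R]_2,
        rigid_inclusion_solution lam mu D gam Phi H u /\
        forall x, exterior D x ->
          u x = H x + single_layer lam mu gam Phi phi x].

Definition linear_field {R : realType} (i j : 'I_2) (x : 'rV[R]_2) :
  'rV[R]_2 := x 0 i *: 'e_j.

(* The tensor m^{ij}_{kl}; [g i j] stands for g_i^j, the density for x_i e_j. *)
Definition emt {R : realType} (gam : R) (Phi : R[i] -> R[i])
    (g : 'I_2 -> 'I_2 -> 'rV[R]_2 -> 'rV[R]_2) (i j k l : 'I_2) : R :=
  bdintegral gam Phi (fun y => y 0 k * g i j y 0 l).

Definition cintegral {R : realType} (f : R -> R[i]) : R[i] :=
  (\int[lebesgue_measure]_(t in `[0, 2 * pi]) complex.Re (f t))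
  +i* (\int[lebesgue_measure]_(t in `[0, 2 * pi]) complex.Im (f t)).

Definition coeff {R : realType} (gam : R) (Phi : R[i] -> R[i])
    (phi : 'rV[R]_2 -> 'rV[R]_2) (m : int) : R[i] :=
  ((2 * pi)^-1)%:C *
  cintegral (fun t => (scale_factor gam Phi t)%:C * toC (phi (bdpt gam Phi t))
                      * expi (- (m%:~R * t))).

Definition E1_partial {R : realType} (gam : R) (a : nat -> R[i])
    (c : int -> R[i]) : nat -> R[i]^o :=
  fun N => \sum_(1 <= m < N) a m * (c m%:Z / gam%:C ^+ m).

Definition E2_partial {R : realType} (gam : R) (a : nat -> R[i])
    (c : int -> R[i]) : nat -> R[i]^o :=
  fun N => \sum_(1 <= m < N) a m * (conjc (c (- m%:Z)) / gam%:C ^+ m).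

Definition E1 {R : realType} (gam : R) (a : nat -> R[i]) (c : int -> R[i]) :
    R[i] :=
  (2 * pi)%:C * (gam%:C * c (- 1) + limn (E1_partial gam a c)).

Definition E2 {R : realType} (gam : R) (a : nat -> R[i]) (c : int -> R[i]) :
    R[i] :=
  (2 * pi)%:C * (gam%:C * conjc (c 1) + limn (E2_partial gam a c)).

Definition E_convergent {R : realType} (gam : R) (a : nat -> R[i])
    (c : int -> R[i]) : Prop :=
  cvgn (E1_partial gam a c) /\ cvgn (E2_partial gam a c).

Definition background1 {R : realType} (kappa mu : R) (a0 z : R[i]) : R[i] :=
  ((kappa - 1) / (2 * mu))%:C * (z - a0).

Definition background2 {R : realType} (mu : R) (a0 z : R[i]) : R[i] :=
  - ((2 * mu)^-1)%:C * conjc (z - a0).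

Definition background3 {R : realType} (mu : R) (a0 z : R[i]) : R[i] :=
  ((0 +i* 1) / (2 * mu)%:C) * conjc (z - a0).

(* Main.v *)
Require Import Defs.
From HB Require Import structures.
From mathcomp Require Import all_boot all_order all_algebra.
From mathcomp Require Import complex.
From mathcomp Require Import all_classical all_reals all_analysis.
From mathcomp Require Import measurable_realfun.
From mathcomp Require Import ring lra zify.
Import Order.TTheory GRing.Theory Num.Theory.
Import numFieldNormedType.Exports.
Local Open Scope classical_set_scope.
Local Open Scope ring_scope.
Local Open Scope complex_scope.
Set Implicit Arguments.
Unset Strict Implicit.
Unset Printing Implicit Defensive.


(** The theorem follows from two facts on boundary densities.

    First, the numbers [E1] and [E2] are boundary integrals: since a density [phi] has mean zero, [E1] is the
    integral of [z * phi] and [E2] that of [z * conjc phi], computed from the Fourier series of the density and of the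
    boundary curve [Phi (gam * expi t)]. As a density is only integrable in the angle, the convergence of the series
    needs an argument. The boundary curve has bounded variation, hence [a m / gam ^ m] is of order [1 / m]; the Fourier
    coefficients of the density tend to 0; and the Abel sums, which are integrals over larger circles, converge because
    [Phi] is continuous up to the boundary circle. Tauber's theorem concludes; see [pairing_series], [E1_value] and
    [E2_value].

    Second, the first moments of a density, the integrals of [y_k * phi_l], depend linearly on the background field,
    vanish when it is a rigid displacement, and satisfy a reciprocity relation. The inclusion problem
    enters through a trace: on the boundary the single layer potential of the density is a rigid displacement minus the
    background field ([density_affine]). The Kelvin matrix is, up to a factor, the limit as [tau] tends to 0 of the
    regular kernels made of [kdiag] and [kdir]. The energy of a density for these kernels is nonincreasing in [tau],
    because its derivative is minus a superposition of forms in Gaussian kernels that are positive semidefinite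
    ([kernel_form_nonincreasing]). If the background field is rigid, the energy tends to 0 as [tau] tends to 0, so it
    is nonpositive; but it is asymptotic to [1 / tau] times a positive definite form in the moments as [tau] tends to
    infinity. So the moments vanish ([affine_density_rigid]). The symmetry of the polarized energy gives the
    reciprocity ([affine_density_sym]).

    The limit at [tau = 0] requires that the arc length, weighted by the inverse square root of the distance to an
    exterior point, have a bounded integral up to the boundary ([majorant]). A Lipschitz boundary is locally a graph,
    and the boundary curve runs along it monotonically because it is injective ([monotone_chart]). Injectivity,
    [Phi_circle_inj], is where the geometry of the exterior enters: the exterior is connected near each boundary point,
    so that if two points of the circle had the same image, a whole arc of diameters would have an end with that image,
    which the maximum principle excludes ([no_antipodal_arc]).

    It remains to compare background fields. With [c = (kappa - 1) / (2 mu)] and [d = 1 / (2 mu)], they are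
    [c (x_1 e_1 + x_2 e_2)], [- d (x_1 e_1 - x_2 e_2)] and [d (x_1 e_2 + x_2 e_1)], up to constants, and
    [x_1 e_2 - x_2 e_1] is a rigid displacement. The corresponding relations between moments, the reciprocity relation
    and the vanishing of the torque of each density give the six identities by linear algebra. *)


(** * Complex moduli, exponentials and planar vectors *)

Section basics.
Variable R : realType.
Implicit Types (z w : R[i]) (x y t : R) (v : 'rV[R]_2).

(** A real modulus: the norm of [R[i]] takes its values in [R[i]]. *)
Definition cabs z : R := complex.Re `|z|.

Lemma normC_cabs z : `|z| = (cabs z)%:C.
Proof. by rewrite /cabs normc_def. Qed.

Lemma cabs_def z : cabs z = Num.sqrt (complex.Re z ^+ 2 + complex.Im z ^+ 2).
Proof. by rewrite /cabs normc_def. Qed.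

Lemma ltC_cabs x z : (x%:C < `|z|) = (x < cabs z).
Proof. by rewrite normC_cabs ltcR. Qed.

Lemma leC_cabs x z : (x%:C <= `|z|) = (x <= cabs z).
Proof. by rewrite normC_cabs lecR. Qed.

Lemma cabs_ge0 z : 0 <= cabs z.
Proof. by rewrite cabs_def sqrtr_ge0. Qed.

Lemma cabsM z w : cabs (z * w) = cabs z * cabs w.
Proof.
have : `|z * w| = `|z| * `|w| by rewrite normrM.
by rewrite !normC_cabs -rmorphM => -[].
Qed.

Lemma cabsD z w : cabs (z + w) <= cabs z + cabs w.
Proof. by have := ler_normD z w; rewrite !normC_cabs -rmorphD lecR. Qed.

Lemma cabsN z : cabs (- z) = cabs z.
Proof. by rewrite /cabs normrN. Qed.

Lemma cabsB z w : cabs (z - w) = cabs (w - z).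
Proof. by rewrite /cabs distrC. Qed.

Lemma cabsBD u z w : cabs (z - w) <= cabs (z - u) + cabs (u - w).
Proof. by rewrite (_ : z - w = (z - u) + (u - w)) ?cabsD //; ring. Qed.

Lemma cabs0 : cabs 0 = 0.
Proof. by rewrite /cabs normr0. Qed.

Lemma cabs1 : cabs 1 = 1.
Proof. by rewrite /cabs normr1. Qed.

Lemma cabs_eq0 z : (cabs z == 0) = (z == 0).
Proof. by rewrite -[RHS]normr_eq0 normC_cabs eq_complex /= eqxx andbT. Qed.

Lemma cabs_gt0 z : (0 < cabs z) = (z != 0).
Proof. by rewrite lt0r cabs_eq0 cabs_ge0 andbT. Qed.

Lemma cabs_real x : cabs x%:C = `|x|.
Proof. by rewrite cabs_def /= expr0n addr0 sqrtr_sqr. Qed.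

Lemma cabsV z : cabs z^-1 = (cabs z)^-1.
Proof.
have : `|z^-1| = `|z|^-1 by rewrite normfV.
by rewrite !normC_cabs -fmorphV => -[].
Qed.

Lemma cabsX z n : cabs (z ^+ n) = cabs z ^+ n.
Proof. by elim: n => [|n IH]; rewrite ?expr0 ?cabs1 // !exprS cabsM IH. Qed.

Lemma cabs_lerB z w : cabs z - cabs w <= cabs (z - w).
Proof. by have := cabsD (z - w) w; rewrite subrK; lra. Qed.

Lemma cabs_sum (I : Type) (r : seq I) (P : pred I) (F : I -> R[i]) :
  cabs (\sum_(i <- r | P i) F i) <= \sum_(i <- r | P i) cabs (F i).
Proof.
elim/big_rec2 : _ => [|i y1 y2 _ IH]; first by rewrite cabs0.
by apply: le_trans (cabsD _ _) _; rewrite lerD2l.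
Qed.

Lemma cabs_conj z : cabs (conjc z) = cabs z.
Proof. by case: z => a b; rewrite !cabs_def /= sqrrN. Qed.

Lemma cabs_Re z : `|complex.Re z| <= cabs z.
Proof.
rewrite cabs_def -sqrtr_sqr ler_wsqrtr // lerDl sqr_ge0 //.
Qed.

Lemma cabs_Im z : `|complex.Im z| <= cabs z.
Proof.
rewrite cabs_def -sqrtr_sqr ler_wsqrtr // lerDr sqr_ge0 //.
Qed.

Lemma cabs_le z : cabs z <= `|complex.Re z| + `|complex.Im z|.
Proof.
set a := complex.Re z; set b := complex.Im z.
have h : (a ^+ 2 + b ^+ 2) <= (`|a| + `|b|) ^+ 2.
  rewrite sqrrD !real_normK ?num_real //.
  have := mulr_ge0 (normr_ge0 a) (normr_ge0 b); lra.
by rewrite cabs_def -[leRHS]ger0_norm ?addr_ge0 // -sqrtr_sqr ler_wsqrtr.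
Qed.

Lemma complexE z : z = complex.Re z +i* complex.Im z.
Proof. by case: z. Qed.

Lemma ReM z w : complex.Re (z * w) =
  complex.Re z * complex.Re w - complex.Im z * complex.Im w.
Proof. by case: z w => a b [c d]. Qed.

Lemma ImM z w : complex.Im (z * w) =
  complex.Re z * complex.Im w + complex.Im z * complex.Re w.
Proof. by case: z w => a b [c d]. Qed.

Lemma ReD z w : complex.Re (z + w) = complex.Re z + complex.Re w.
Proof. by case: z w => a b [c d]. Qed.

Lemma ImD z w : complex.Im (z + w) = complex.Im z + complex.Im w.
Proof. by case: z w => a b [c d]. Qed.

Lemma ReN z : complex.Re (- z) = - complex.Re z.
Proof. by case: z. Qed.

Lemma ImN z : complex.Im (- z) = - complex.Im z.
Proof. by case: z. Qed.

Lemma expiD x y : expi (x + y) = expi x * expi y.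
Proof.
apply/eqP; rewrite eq_complex ReM ImM /= cosD sinD eqxx /=.
by rewrite addrC eqxx.
Qed.

Lemma cabs_expi x : cabs (expi x) = 1.
Proof. by rewrite cabs_def /= cos2Dsin2 sqrtr1. Qed.

Lemma expi0 : expi (0 : R) = 1.
Proof. by rewrite /expi cos0 sin0. Qed.

Lemma expi_neq0 x : expi x != 0.
Proof. by rewrite -cabs_gt0 cabs_expi. Qed.

Lemma expiN x : expi (- x) = conjc (expi x).
Proof. by rewrite /expi cosN sinN. Qed.

Lemma expiV x : (expi x)^-1 = expi (- x).
Proof.
apply: (mulfI (expi_neq0 x)); rewrite divff ?expi_neq0 // -expiD.
by rewrite subrr expi0.
Qed.

Lemma expiX x n : expi x ^+ n = expi (n%:R * x).
Proof.
by elim: n => [|n IH]; rewrite ?mul0r ?expi0 // exprS IH -expiD -[n.+1]add1n natrD mulrDl mul1r.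
Qed.

Lemma expi_2pi : expi (2 * pi) = 1 :> R[i].
Proof. by rewrite /expi mulrC -[2]/(2%:R) mulr_natr cos2pi sin2pi. Qed.

Lemma cabs_circle x t : 0 <= x -> cabs (x%:C * expi t) = x.
Proof. by move=> x0; rewrite cabsM cabs_expi mulr1 cabs_real ger0_norm. Qed.

Lemma ord2E (j : 'I_2) : j = i1 \/ j = i2.
Proof. by case: j => [[|[|//]] Hj]; [left|right]; apply/val_inj. Qed.

Lemma toCK : cancel (@toC R) (@ofC R).
Proof.
by move=> v; apply/matrixP=> i j; rewrite !mxE /= ord1; case: (ord2E j) => ->.
Qed.

Lemma ofCK : cancel (@ofC R) (@toC R).
Proof. by case=> a b; rewrite /toC !mxE /=. Qed.

Lemma dotE v v' : dot v v' = v 0 i1 * v' 0 i1 + v 0 i2 * v' 0 i2.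
Proof.
rewrite /dot big_ord_recl big_ord1.
by have -> : lift ord0 ord0 = i2 by apply/val_inj.
Qed.

Lemma enormE v : enorm v = cabs (toC v).
Proof. by rewrite /enorm dotE cabs_def -!expr2. Qed.

Lemma toCB v v' : toC (v - v') = toC v - toC v'.
Proof. by rewrite /toC !mxE. Qed.

Lemma ofCB z w : ofC (z - w) = ofC z - ofC w.
Proof. by rewrite -[LHS]toCK -[RHS]toCK toCB !ofCK. Qed.

Lemma coord_le_norm v (k : 'I_2) : `|v 0 k| <= `|v|.
Proof.
rewrite [leRHS]mx_normrE.
exact: (le_bigmax 0 (fun i : 'I_1 * 'I_2 => `|v i.1 i.2|) (0, k)).
Qed.

Lemma norm_le_coord v x : 0 <= x -> (forall k, `|v 0 k| <= x) -> `|v| <= x.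
Proof.
move=> x0 H; rewrite [leLHS]mx_normrE; apply: bigmax_le => // -[i j] _ /=.
by rewrite ord1.
Qed.

Lemma norm_le_cabs v : `|v| <= cabs (toC v).
Proof.
apply: norm_le_coord => [|k]; first exact: cabs_ge0.
by rewrite -[v]toCK !mxE ofCK; case: ifP => _; [exact: cabs_Re|exact: cabs_Im].
Qed.

Lemma cabs_le_norm v : cabs (toC v) <= 2 * `|v|.
Proof.
apply: le_trans (cabs_le _) _.
by have := coord_le_norm v i1; have := coord_le_norm v i2; rewrite /toC /=; lra.
Qed.


(** Bolzano-Weierstrass, from the compactness of closed balls. A cluster value suffices for the arguments by
    contradiction below, and spares the extraction of subsequences. *)
Lemma complex_cluster (u : nat -> R[i]) (M : R) :
  (forall n, cabs (u n) <= M) ->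
  exists z, forall e, 0 < e -> forall N, exists n, (N <= n)%N /\ cabs (u n - z) < e.
Proof.
move=> uM; pose A := [set v : 'rV[R]_2 | `|v| <= M].
have cA : compact A.
  apply: bounded_closed_compact.
    by exists M; split; [exact: num_real|move=> x Mx v /= Av; exact: le_trans Av (ltW Mx)].
  rewrite (_ : A = (fun v : 'rV[R]_2 => `|v|) @^-1` [set x | x <= M]) //.
  by apply: closed_comp => [v _|]; [exact: norm_continuous|exact: closed_le].
have fA : ((fun n => ofC (u n)) @ \oo) A.
  by exists 0%N => // n _; apply: le_trans (norm_le_cabs _) _; rewrite ofCK.
have [v [Av vc]] := cA _ _ fA.
exists (toC v) => e e0 N.
have e20 : 0 < e / 2 by rewrite divr_gt0.
have [_ [[n Nn <-] vn]] := vc ((fun n => ofC (u n)) @` [set n | (N <= n)%N])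
  (ball v (e / 2)) (ex_intro2 _ _ N I (fun n Nn => imageP _ Nn)) (nbhsx_ballx v _ e20).
exists n; split => //.
move: vn; rewrite -ball_normE /ball_ /= distrC => vn.
rewrite -[u n]ofCK -toCB; apply: le_lt_trans (cabs_le_norm _) _; lra.
Qed.

End basics.


(** * The Laurent expansion of the exterior map *)

Section expansions.
Variable R : realType.
Variables (D : set 'rV[R]_2) (gam : R) (Phi : R[i] -> R[i]) (a : nat -> R[i]).
Hypothesis Phi_ext : exterior_conformal_map D gam Phi a.
Implicit Types (w z : R[i]).

Lemma Phi_continuous w : gam <= cabs w -> forall e, 0 < e -> exists2 d, 0 < d &
  forall w', gam <= cabs w' -> cabs (w' - w) < d -> cabs (Phi w' - Phi w) < e.
Proof.
move=> gw e e0.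
have /subspace_continuousP/(_ w) := ecm_boundary Phi_ext.
rewrite /= leC_cabs => /(_ gw)/cvgrPdist_lt/(_ e%:C).
rewrite ltcR => /(_ e0)/nbhs_ballP[d /= d0 Hd].
have dE : d = (complex.Re d)%:C by rewrite RRe_real // ger0_real // ltW.
have Rd0 : 0 < complex.Re d by rewrite -ltcR -dE.
exists (complex.Re d) => // w' gw' ww'.
rewrite cabsB in ww'.
have := Hd w'; rewrite -ball_normE /ball_ /= leC_cabs => /(_ _ gw').
by rewrite dE !normC_cabs !ltcR => /(_ ww'); rewrite cabsB.
Qed.

Definition lsum n w : R[i] := \sum_(0 <= k < n) a k / w ^+ k.

Lemma Phi_lsum_cvg w : gam < cabs w -> forall e, 0 < e -> exists N, forall n, (N <= n)%N ->
  cabs (lsum n w - (Phi w - w)) < e.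
Proof.
move=> gw e e0.
have := @ecm_expansion _ _ _ _ _ Phi_ext w; rewrite ltC_cabs => /(_ gw).
move=> /cvgrPdist_lt/(_ e%:C); rewrite ltcR => /(_ e0)[N _ HN].
by exists N => n Nn; have := HN n Nn; rewrite normC_cabs ltcR cabsB.
Qed.

(** The terms of the expansion at [w = r] are differences of partial sums that converge, so they are bounded. *)
Lemma coef_bound r : gam < r -> exists2 B, 0 <= B & forall k, cabs (a k) <= B * r ^+ k.
Proof.
move=> gr; have r0 : 0 < r by apply: lt_trans gr; exact: ecm_gam_gt0 Phi_ext.
have cr : cabs r%:C = r by rewrite cabs_real gtr0_norm.
have grC : gam < cabs r%:C by rewrite cr.
have [N HN] := Phi_lsum_cvg grC ltr01.
pose B := \sum_(0 <= k < N) cabs (a k / r%:C ^+ k) + 2.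
exists B => [|k]; first by rewrite addr_ge0 // sumr_ge0 // => i _; exact: cabs_ge0.
have E : cabs (a k) = cabs (a k / r%:C ^+ k) * r ^+ k.
  by rewrite cabsM cabsV cabsX cr mulfVK // expf_neq0 // gt_eqF.
rewrite E ler_wpM2r ?exprn_ge0 ?ltW // /B.
have [kN|Nk] := ltnP k N.
  rewrite (big_rem k) /=; last by rewrite mem_index_iota.
  set T := \sum_(i <- rem _ _) _.
  have : 0 <= T by rewrite sumr_ge0 // => i _; exact: cabs_ge0.
  lra.
have S0 : 0 <= \sum_(0 <= k < N) cabs (a k / r%:C ^+ k).
  by rewrite sumr_ge0 // => i _; exact: cabs_ge0.
have := HN k Nk; have := HN k.+1 (leqW Nk); rewrite /lsum big_nat_recr //=.
set S := \sum_(_ <= _ < _) _; set T := a k / _; set P := Phi _ - _.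
have : cabs T <= cabs (S + T - P) + cabs (S - P).
  rewrite [cabs (S - P)]cabsB; apply: le_trans (cabsD _ _).
  by rewrite (_ : S + T - P + (P - S) = T) //; ring.
lra.
Qed.

(** Comparison with a geometric series: [coef_bound] applies at a radius strictly between [gam] and [r]. *)
Lemma lsum_uniform r : gam < r -> forall e, 0 < e -> exists N, forall n, (N <= n)%N ->
  forall w, r <= cabs w -> cabs (lsum n w - (Phi w - w)) < e.
Proof.
move=> gr e e0; have g0 := ecm_gam_gt0 Phi_ext.
pose s := (gam + r) / 2.
have gs : gam < s by rewrite /s; lra.
have sr : s < r by rewrite /s; lra.
have s0 : 0 < s by lra. have r0 : 0 < r by lra.
have [B B0 HB] := coef_bound gs.
pose q := s / r.
have q0 : 0 < q by rewrite divr_gt0.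
have q1 : q < 1 by rewrite ltr_pdivrMr // mul1r.
have tail n m w : r <= cabs w -> (n <= m)%N ->
    cabs (lsum m w - lsum n w) <= B * q ^+ n / (1 - q).
  move=> rw nm; rewrite /lsum (big_cat_nat (leq0n n) nm) //= addrAC subrr add0r.
  apply: le_trans (cabs_sum _ _ _) _.
  have step k : cabs (a k / w ^+ k) <= B * q ^+ k.
    rewrite cabsM cabsV cabsX ler_pdivrMr ?exprn_gt0 ?(lt_le_trans r0) //.
    apply: le_trans (HB k) _; rewrite -mulrA ler_wpM2l // -exprMn.
    have rw0 := lt_le_trans r0 rw.
    have qw0 := mulr_gt0 q0 rw0.
    apply: lerXn2r; rewrite ?nnegrE; [exact: ltW|exact: ltW|].
    by rewrite /q mulrAC ler_pdivlMr // ler_pM2l.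
  apply: le_trans (ler_sum _ (fun k _ => step k)) _.
  rewrite -mulr_sumr -mulrA ler_wpM2l //.
  rewrite -(subnKC nm); elim: (m - n)%N => [|d IH].
    by rewrite addn0 big_geq // divr_ge0 ?exprn_ge0 ?subr_ge0 ?ltW.
  suff E p : \sum_(n <= k < n + p) q ^+ k = (q ^+ n - q ^+ (n + p)) / (1 - q).
    rewrite E ler_pM2r ?invr_gt0 ?subr_gt0 // gerBl exprn_ge0 // ltW //.
  have q1' : 1 - q != 0 by rewrite subr_eq0 eq_sym lt_eqF.
  elim: p => [|p IHp]; first by rewrite addn0 big_geq // subrr mul0r.
  by rewrite addnS big_nat_recr ?leq_addr //= IHp exprS; field.
have /cvgrPdist_lt/(_ (e / 2 * (1 - q) / (B + 1))) : q ^+ n @[n --> \oo] --> (0 : R).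
  by apply: cvg_expr; rewrite ger0_norm ?ltW.
have e'0 : 0 < e / 2 * (1 - q) / (B + 1) by rewrite divr_gt0 ?mulr_gt0 ?subr_gt0 //; lra.
move=> /(_ e'0)[N _ HN]; exists N => n Nn w rw.
have [M HM] := Phi_lsum_cvg (lt_le_trans gr rw) (divr_gt0 e0 (ltr0Sn _ 1)).
have := HN n Nn; rewrite /= sub0r normrN ger0_norm ?exprn_ge0 ?(ltW q0) // => Hq.
have := tail n (maxn n M) w rw (leq_maxl _ _).
have := HM _ (leq_maxr n M) => H1 H2.
have H3 : B * q ^+ n / (1 - q) < e / 2.
  rewrite ltr_pdivrMr ?subr_gt0 //.
  rewrite ltr_pdivlMr in Hq; last lra.
  have := exprn_ge0 n (ltW q0); nra.
have := cabsBD (lsum (maxn n M) w) (lsum n w) (Phi w - w).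
rewrite [cabs (lsum n w - lsum _ w)]cabsB; lra.
Qed.

End expansions.


(** * Minimum modulus *)

Section minimum_modulus.
Variable R : realType.
Implicit Types (w z : R[i]) (p q : {poly R[i]}).

Lemma poly_bound p (M : R) : exists2 B, 0 <= B & forall z, cabs z <= M -> cabs p.[z] <= B.
Proof.
elim/poly_ind: p => [|p c [B B0 IH]].
  by exists 0 => // z _; rewrite horner0 cabs0.
exists (B * `|M| + cabs c) => [|z zM].
  by rewrite addr_ge0 ?mulr_ge0 ?cabs_ge0.
rewrite hornerMXaddC; apply: le_trans (cabsD _ _) _; rewrite lerD2r cabsM.
by apply: ler_pM; rewrite ?cabs_ge0 ?IH // (le_trans zM) // ler_norm.
Qed.

(** The descent step of d'Alembert's proof, for the Laurent polynomial [q / 'X^n]. Subtracting its value [c] at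
    [w1] leaves a zero of some order [k] at [w1]; a [k]-th root gives a direction in which the leading variation
    points against [c]. *)
Lemma min_modulus q n w1 r : 0 < r -> w1 != 0 -> q.[w1] != 0 ->
  q - (q.[w1] / w1 ^+ n) *: 'X^n != 0 ->
  exists w, [/\ cabs (w - w1) < r, w != 0 &
    cabs (q.[w] / w ^+ n) < cabs (q.[w1] / w1 ^+ n)].
Proof.
move=> r0 w10 q10.
have [c cE] : exists c, c = q.[w1] / w1 ^+ n by eexists.
rewrite -cE => pn0.
have wn0 : w1 ^+ n != 0 by rewrite expf_neq0.
have c0 : c != 0 by rewrite cE mulf_neq0 ?invr_eq0.
have [k [s sw1 Ep]] := multiplicity_XsubC (q - c *: 'X^n) w1.
rewrite pn0 /= in sw1.
have k0 : (0 < k)%N.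
  case: k Ep => // Ep; move: sw1; rewrite /root.
  have := congr1 (horner^~ w1) Ep; rewrite mulr1 !hornerE cE divfK // subrr.
  by move=> <-; rewrite eqxx.
have sn0 : s.[w1] != 0 by [].
(* With this direction, the leading variation at [w1 + rho * et] is [- rho ^ k * c * w1 ^ n]. *)
pose et := k.-root (- (c * w1 ^+ n) / s.[w1]).
have etk : et ^+ k = - (c * w1 ^+ n) / s.[w1] by rewrite /et rootCK.
(* The rest of the variation is [rho ^ k] times [e], which vanishes at [w1]. *)
pose e := c *: 'X^n + et ^+ k *: s.
have /factor_theorem[u Eu] : root e w1.
  by rewrite /root !hornerE etk !divfK // subrr.
have [B B0 HB] := poly_bound u (cabs w1 + 1).
have cw10 : 0 < cabs w1 by rewrite cabs_gt0.
have cc0 : 0 < cabs c by rewrite cabs_gt0.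
have ce0 := cabs_ge0 et.
pose L := cabs c * (cabs w1 / 2) ^+ n.
have L0 : 0 < L by rewrite mulr_gt0 // exprn_gt0 // divr_gt0.
pose T := cabs et + 1.
have T0 : 0 < T by rewrite /T; lra.
(* A step short enough to stay in the disc, away from 0, and where [e] is dominated by [c * w ^ n]. *)
pose rho := Num.min (Num.min (1 / 2) (r / 2 / T))
                    (Num.min (cabs w1 / 2 / T) (Num.min (1 / T) (L / (2 * T * (B + 1))))).
have B10 : 0 < B + 1 by lra.
have rho0 : 0 < rho.
  rewrite !lt_min; do ![apply/andP; split];
    try by do ?apply: divr_gt0.
  by apply: divr_gt0 => //; do ?apply: mulr_gt0.
have rho1 : rho <= 1 / 2 by rewrite !ge_min lexx.
have rho2 : rho * T <= r / 2 by rewrite -ler_pdivlMr // !ge_min lexx !orbT.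
have rho3 : rho * T <= cabs w1 / 2 by rewrite -ler_pdivlMr // !ge_min lexx !orbT.
have rho4 : rho * T <= 1 by rewrite -ler_pdivlMr // !ge_min lexx !orbT.
have rho5 : rho * (2 * T * (B + 1)) <= L.
  by rewrite -ler_pdivlMr ?mulr_gt0 // !ge_min lexx !orbT.
pose w := w1 + rho%:C * et.
have hw : w - w1 = rho%:C * et by rewrite /w addrC addKr.
have dw : cabs (w - w1) = rho * cabs et.
  by rewrite hw cabsM cabs_real gtr0_norm.
have dwT : cabs (w - w1) <= rho * T by rewrite dw ler_wpM2l ?ltW // /T; lra.
have wge : cabs w1 / 2 <= cabs w.
  have := cabs_lerB w1 w; rewrite cabsB; lra.
have w0 : w != 0 by rewrite -cabs_gt0; lra.
exists w; split => //; first lra.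
rewrite cabsM cabsV cabsX ltr_pdivrMr ?exprn_gt0 ?cabs_gt0 //.
have Eq : q.[w] = (1 - rho ^+ k)%:C * (c * w ^+ n) + (rho ^+ k)%:C * e.[w].
  have := congr1 (horner^~ w) Ep; rewrite /e !hornerE => /eqP.
  rewrite subr_eq => /eqP ->.
  rewrite hw rmorphB rmorph1 !rmorphXn /= exprMn; ring.
have ee : cabs e.[w] < cabs c * cabs w ^+ n.
  rewrite Eu hornerM hornerXsubC cabsM.
  have /HB uB : cabs w <= cabs w1 + 1.
    have := cabs_lerB w w1; lra.
  have H1 : L <= cabs c * cabs w ^+ n.
    apply: ler_wpM2l; first exact: ltW.
    by apply: lerXn2r; rewrite ?nnegrE ?cabs_ge0 // divr_ge0 ?cabs_ge0.
  apply: lt_le_trans H1; apply: le_lt_trans (_ : B * (rho * T) < L).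
    by apply: ler_pM; rewrite ?cabs_ge0.
  have : 0 < rho * T by rewrite mulr_gt0.
  nra.
rewrite Eq; apply: le_lt_trans (cabsD _ _) _.
rewrite !cabsM !cabs_real cabsX.
have rk0 : 0 < rho ^+ k by rewrite exprn_gt0.
have rk1 : rho ^+ k <= 1 by rewrite exprn_ile1 // ?ltW //; lra.
rewrite !ger0_norm ?subr_ge0 ?(ltW rk0) //.
nra.
Qed.

End minimum_modulus.

Section compact_min.
Variable R : realType.

(** A minimizing sequence has a cluster value. Closedness and continuity are stated with moduli, the form in which
    they are available for [Phi]. *)
Lemma compact_min (K : set R[i]) (F : R[i] -> R) (M : R) :
  K !=set0 -> (forall w, K w -> cabs w <= M) ->
  (forall z, (forall e, 0 < e -> exists2 w, K w & cabs (w - z) < e) -> K z) ->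
  (forall w, K w -> 0 <= F w) ->
  (forall w, K w -> forall e, 0 < e -> exists2 d, 0 < d &
     forall w', K w' -> cabs (w' - w) < d -> `|F w' - F w| < e) ->
  exists2 w, K w & forall w', K w' -> F w <= F w'.
Proof.
move=> [w0 Kw0] KM Kc F0 Fc.
pose I := inf (F @` K).
have hI : has_inf (F @` K).
  by split; [exists (F w0), w0 | exists 0 => _ [w Kw <-]; exact: F0].
have /choice[u Hu] : forall n : nat, exists w, K w /\ F w < I + n.+1%:R^-1.
  move=> n; have n0 : 0 < n.+1%:R^-1 :> R by rewrite invr_gt0.
  have [_ [w Kw <-] wI] := inf_adherent n0 hI.
  by exists w.
have [z zc] := complex_cluster (fun n => KM _ (Hu n).1).
have Kz : K z by apply: Kc => e e0; have [n [_ nz]] := zc e e0 0%N; exists (u n) => //; exact: (Hu n).1.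
exists z => // w' Kw'.
have Iw' : I <= F w' by apply: ge_inf; [exact: hI.2|exists w'].
apply: le_trans Iw'; apply/ler_addgt0Pr => e e0.
have [d d0 Hd] := Fc z Kz (e / 2) (divr_gt0 e0 (ltr0Sn _ 1)).
have [N HN] : exists N : nat, forall n, (N <= n)%N -> n.+1%:R^-1 < e / 2 :> R.
  have /cvgrPdist_lt/(_ (e / 2)) := @cvg_harmonic R.
  rewrite divr_gt0 // => /(_ isT)[N _ HN]; exists N => n /HN.
  by rewrite /= sub0r normrN ger0_norm.
have [n [Nn nz]] := zc d d0 N.
have := Hd _ (Hu n).1 nz; have := (Hu n).2; have := HN n Nn.
rewrite ltr_norml => H1 H2 /andP[H3 H4].
move: H1 H2; move: (_^-1) => v H1 H2; lra.
Qed.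

End compact_min.


(** * The exterior map is open *)

Section open_mapping.
Variable R : realType.
Variables (D : set 'rV[R]_2) (gam : R) (Phi : R[i] -> R[i]) (a : nat -> R[i]).
Hypothesis Phi_ext : exterior_conformal_map D gam Phi a.
Implicit Types (w z : R[i]).

Lemma lsum_continuous n z : z != 0 -> forall e, 0 < e -> exists2 d, 0 < d &
  forall w, cabs (w - z) < d -> cabs (lsum a n w - lsum a n z) < e.
Proof.
move=> z0 e e0.
have C : {for (z : R[i]^o), continuous (fun w : R[i]^o => lsum a n w : R[i]^o)}.
  rewrite /lsum; elim: n => [|n IH].
    rewrite (_ : (fun w => _) = (fun=> (0 : R[i]^o))); last first.
      by apply/funext => w; rewrite big_geq.
    exact: cst_continuous.
  rewrite (_ : (fun w => _) = (fun w : R[i]^o =>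
      (\sum_(0 <= k < n) a k / w ^+ k : R[i]^o) + (a n : R[i]^o) * (w ^+ n)^-1)); last first.
    by apply/funext => w; rewrite big_nat_recr.
  apply: continuousD; first exact: IH.
  apply: continuousM; first exact: cst_continuous.
  apply: continuousV; first by rewrite expf_neq0.
  elim: n {IH} => [|n IH]; first exact: cst_continuous.
  rewrite (_ : (fun w => _) = (fun w : R[i]^o => (w : R[i]^o) * (w ^+ n : R[i]^o))); last first.
    by apply/funext => w; rewrite exprS.
  apply: continuousM; last exact: IH.
  by move=> B; apply.
move/cvgrPdist_lt/(_ e%:C): C; rewrite ltcR => /(_ e0)/nbhs_ballP[d /= d0 Hd].
have dE : d = (complex.Re d)%:C by rewrite RRe_real // ger0_real // ltW.
have Rd0 : 0 < complex.Re d by rewrite -ltcR -dE.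
exists (complex.Re d) => // w ww; rewrite cabsB in ww.
have := Hd w; rewrite -ball_normE /ball_ /= dE !normC_cabs !ltcR => /(_ ww).
by rewrite cabsB.
Qed.

Lemma closed_ball_closed c r z :
  (forall e, 0 < e -> exists2 w, cabs (w - c) <= r & cabs (w - z) < e) -> cabs (z - c) <= r.
Proof.
move=> H; apply/ler_addgt0Pr => e e0; have [w wc wz] := H e e0.
have := cabsBD w z c; rewrite [cabs (z - w)]cabsB; lra.
Qed.

(** The polynomial [w ^ n * (w + lsum a n w - y)]: an approximation of [Phi - y] cleared of denominators. *)
Definition lpoly (n : nat) (y : R[i]) : {poly R[i]} :=
  'X^(n.+1) + (\sum_(0 <= k < n) a k *: 'X^(n - k)) - y *: 'X^n.

Lemma lpolyE n y w : w != 0 -> (lpoly n y).[w] / w ^+ n = w + lsum a n w - y.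
Proof.
move=> w0; have wn0 m : w ^+ m != 0 by rewrite expf_neq0.
rewrite /lpoly !hornerE horner_sum; apply: (mulIf (wn0 n)).
rewrite divfK // mulrBl mulrDl -exprS /lsum mulr_suml; congr (_ + _ - _).
apply: eq_big_nat => k /andP[_ kn]; rewrite !hornerE -mulrA; congr (_ * _).
by rewrite mulrC expfB.
Qed.

Lemma lpoly_neq n y c : lpoly n y - c *: 'X^n != 0.
Proof.
apply/eqP => /(congr1 (fun p : {poly R[i]} => p`_n.+1)).
rewrite /lpoly !coefB coefD !coefZ !coefXn coef0 coef_sum eqxx !(gtn_eqF (ltnSn n)).
rewrite !mulr0 !subr0 big1_seq ?addr0; first by move/eqP; rewrite oner_eq0.
move=> k _; rewrite coefZ coefXn; have [E|] := eqVneq n.+1 (n - k)%N; last by rewrite mulr0.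
by have := leq_subr k n; rewrite -E ltnn.
Qed.

(** The open mapping theorem. By injectivity, [Phi - Phi w0] stays away from 0 on a small circle around [w0]. If
    [Phi] missed a value [y] close to [Phi w0], then a partial sum of the expansion of [Phi - y] would have no
    zero on the disc and a smaller modulus at [w0] than on the circle; the minimum of its modulus would be
    interior, against [min_modulus]. *)
Lemma Phi_open w0 r : gam < cabs w0 -> 0 < r -> exists2 d, 0 < d &
  forall y, cabs (y - Phi w0) < d -> exists w, [/\ cabs (w - w0) <= r, gam < cabs w & Phi w = y].
Proof.
move=> gw r0; have g0 := ecm_gam_gt0 Phi_ext.
pose s := Num.min r ((cabs w0 - gam) / 2).
have s0 : 0 < s by rewrite lt_min r0 /=; lra.
have sr : s <= r by rewrite ge_min lexx.
have sg : s <= (cabs w0 - gam) / 2 by rewrite ge_min lexx orbT.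
pose rho := (cabs w0 + gam) / 2.
have grho : gam < rho by rewrite /rho; lra.
have inE w : cabs (w - w0) <= s -> rho <= cabs w.
  by move=> ws; have := cabs_lerB w0 w; rewrite cabsB /rho; lra.
pose M := cabs w0 + s.
have KM w : cabs (w - w0) <= s -> cabs w <= M.
  by move=> ws; have := cabs_lerB w w0; rewrite /M; lra.
have Fc y w : gam <= cabs w -> forall e, 0 < e -> exists2 d, 0 < d &
    forall w', gam <= cabs w' -> cabs (w' - w) < d ->
      `|cabs (Phi w' - y) - cabs (Phi w - y)| < e.
  move=> gw' e e0; have [d d0 Hd] := Phi_continuous Phi_ext gw' e0.
  exists d => // w' gww' dw; have := Hd _ gww' dw.
  have := cabsBD (Phi w) (Phi w') y; have := cabsBD (Phi w') (Phi w) y.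
  rewrite [cabs (Phi w - Phi w')]cabsB ltr_norml => *; apply/andP; split; lra.
have [wm wmS wmin] : exists2 w, cabs (w - w0) = s &
    forall w', cabs (w' - w0) = s -> cabs (Phi w - Phi w0) <= cabs (Phi w' - Phi w0).
  apply: (@compact_min _ [set w | cabs (w - w0) = s] (fun w => cabs (Phi w - Phi w0)) M).
  - by exists (w0 + s%:C); rewrite /= addrC addKr cabs_real gtr0_norm.
  - by move=> w /= ws; apply: KM; rewrite ws.
  - move=> z H /=; apply/eqP; rewrite eq_le; apply/andP; split.
      apply: closed_ball_closed => e e0; have [w /= ws wz] := H e e0.
      by exists w => //; rewrite ws.
    apply/ler_addgt0Pr => e e0; have [w /= ws wz] := H e e0.
    by have := cabsBD z w w0; rewrite ws; lra.
  - by move=> *; exact: cabs_ge0.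
  move=> w /= ws e e0; have gww : gam <= cabs w.
    by apply: le_trans (ltW grho) _; apply: inE; rewrite ws.
  have [d d0 Hd] := Fc (Phi w0) w gww e e0; exists d => // w' /= ws' dw.
  by apply: Hd => //; apply: le_trans (ltW grho) _; apply: inE; rewrite ws'.
pose m := cabs (Phi wm - Phi w0).
have m0 : 0 < m.
  rewrite cabs_gt0 subr_eq0; apply/eqP => E.
  have gwm : gam < cabs wm by apply: lt_le_trans grho _; apply: inE; rewrite wmS.
  have := @ecm_injective _ _ _ _ _ Phi_ext wm w0; rewrite !ltC_cabs => /(_ gwm gw E) W.
  by move: wmS; rewrite W subrr cabs0 => ?; lra.
exists (m / 3) => [|y dy]; first by rewrite divr_gt0.
apply: contrapT => noy.
have ney w : cabs (w - w0) <= s -> Phi w != y.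
  move=> ws; apply/eqP => E; apply: noy; exists w; split => //; first exact: le_trans sr.
  exact: lt_le_trans (inE _ ws).
have [wc wcS wcmin] : exists2 w, cabs (w - w0) <= s &
    forall w', cabs (w' - w0) <= s -> cabs (Phi w - y) <= cabs (Phi w' - y).
  apply: (@compact_min _ [set w | cabs (w - w0) <= s] (fun w => cabs (Phi w - y)) M) => //.
  - by exists w0; rewrite /= subrr cabs0 ltW.
  - by move=> z H; apply: closed_ball_closed.
  - by move=> *; exact: cabs_ge0.
  move=> w /= ws e e0; have gww : gam <= cabs w by apply: le_trans (ltW grho) (inE _ ws).
  have [d d0 Hd] := Fc y w gww e e0; exists d => // w' /= ws' dw.
  by apply: Hd => //; apply: le_trans (ltW grho) (inE _ ws').
pose c := cabs (Phi wc - y).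
have c0 : 0 < c by rewrite cabs_gt0 subr_eq0 ney.
(* Within [c / 2] of [Phi - y] the partial sum has no zero; within [m / 9] its minimum is not on the
   circle. *)
have [N HN] := lsum_uniform Phi_ext grho (e := Num.min (c / 2) (m / 9)) (ltac:(by rewrite lt_min !divr_gt0)).
pose f w := w + lsum a N w - y.
have fP w : cabs (w - w0) <= s -> cabs (f w - (Phi w - y)) < Num.min (c / 2) (m / 9).
  move=> ws; have := HN N (leqnn N) w (inE _ ws).
  by rewrite (_ : _ - (Phi w - w) = f w - (Phi w - y)) // /f; ring.
have [w1 w1S w1min] : exists2 w, cabs (w - w0) <= s &
    forall w', cabs (w' - w0) <= s -> cabs (f w) <= cabs (f w').
  apply: (@compact_min _ [set w | cabs (w - w0) <= s] (fun w => cabs (f w)) M) => //.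
  - by exists w0; rewrite /= subrr cabs0 ltW.
  - by move=> z H; apply: closed_ball_closed.
  - by move=> *; exact: cabs_ge0.
  move=> w /= ws e e0.
  have wn0 : w != 0 by rewrite -cabs_gt0; have := inE w ws; lra.
  have [d d0 Hd] := lsum_continuous N wn0 (divr_gt0 e0 (ltr0Sn _ 1)).
  exists (Num.min d (e / 2)) => [|w' /= ws']; first by rewrite lt_min d0 divr_gt0.
  rewrite lt_min => /andP[/Hd H1 H2].
  have : cabs (f w' - f w) < e.
    rewrite (_ : f w' - f w = (w' - w) + (lsum a N w' - lsum a N w)); last by rewrite /f; ring.
    by apply: le_lt_trans (cabsD _ _) _; lra.
  have := cabs_lerB (f w) (f w'); have := cabs_lerB (f w') (f w).
  rewrite [cabs (f w - f w')]cabsB ltr_norml => *; apply/andP; split; lra.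
have w1n0 : w1 != 0 by rewrite -cabs_gt0; have := inE w1 w1S; lra.
have fw1 : f w1 != 0.
  have := fP _ w1S; rewrite lt_min => /andP[H _].
  have := wcmin _ w1S; rewrite -/c => H2; rewrite -cabs_gt0.
  have := cabs_lerB (Phi w1 - y) (f w1); rewrite [cabs (_ - f w1)]cabsB; lra.
have w1in : cabs (w1 - w0) < s.
  rewrite lt_neqAle w1S andbT; apply/eqP => w1s.
  have w0S : cabs (w0 - w0) <= s by rewrite subrr cabs0 ltW.
  have := fP _ w1S; have := fP _ w0S; rewrite !lt_min => /andP[_ H1] /andP[_ H2].
  have := wmin _ w1s; rewrite -/m => H3.
  have := w1min _ w0S.
  have := cabs_lerB (f w0) (Phi w0 - y); have := cabs_lerB (Phi w1 - y) (f w1).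
  rewrite [cabs (Phi w1 - y - f w1)]cabsB.
  have := cabsBD y (Phi w1) (Phi w0); rewrite [cabs (Phi w0 - y)]cabsB.
  lra.
have fE w : w != 0 -> f w = (lpoly N y).[w] / w ^+ N by move=> wn0; rewrite lpolyE.
have q0 : (lpoly N y).[w1] != 0.
  by apply: contraNneq fw1 => E; rewrite fE // E mul0r.
have [|w [ww wn0]] := @min_modulus R (lpoly N y) N w1 (s - cabs (w1 - w0)) _ w1n0 q0 (lpoly_neq _ _ _).
  by rewrite subr_gt0.
rewrite -!fE // ltNge; apply/negP; rewrite negbK; apply: w1min.
have := cabsBD w1 w w0; lra.
Qed.

(** If a point [w] of the circle had the image of an outer point [w0], then the images of outer points close to
    [w] would, by openness, also be attained close to [w0], against injectivity. *)
Lemma Phi_boundary_neq w w0 : gam <= cabs w -> gam < cabs w0 -> Phi w = Phi w0 -> gam < cabs w.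
Proof.
move=> gw gw0 E; rewrite lt_neqAle gw andbT; apply/eqP => Eg.
have g0 := ecm_gam_gt0 Phi_ext.
pose r := (cabs w0 - gam) / 2.
have r0 : 0 < r by rewrite /r; lra.
have [d d0 Hd] := Phi_open gw0 r0.
have [d' d'0 Hd'] := Phi_continuous Phi_ext gw d0.
pose t := Num.min (1 / 2) (Num.min (d' / 2 / gam) (r / 2 / gam)).
have t0 : 0 < t by rewrite !lt_min; do ![apply/andP; split]; do ?apply: divr_gt0 => //.
have t1 : t * gam <= d' / 2 by rewrite -ler_pdivlMr // !ge_min lexx !orbT.
have t2 : t * gam <= r / 2 by rewrite -ler_pdivlMr // !ge_min lexx !orbT.
pose w' := (1 + t)%:C * w.
have cw' : cabs w' = gam + t * gam.
  by rewrite cabsM -Eg cabs_real ger0_norm; [ring|lra].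
have tg : 0 < t * gam by rewrite mulr_gt0.
have gw' : gam < cabs w' by lra.
have dw' : cabs (w' - w) < d'.
  rewrite (_ : w' - w = t%:C * w); last by rewrite /w' rmorphD rmorph1; ring.
  rewrite cabsM cabs_real gtr0_norm // -Eg; lra.
have := Hd' _ (ltW gw') dw'; rewrite E => /Hd[w'' [w''w0 gw'' Ew]].
have := @ecm_injective _ _ _ _ _ Phi_ext w'' w'; rewrite !ltC_cabs => /(_ gw'' gw' Ew) W.
have := cabs_lerB w0 w''; rewrite cabsB W cw'; rewrite W in w''w0; move: w''w0; rewrite /r; rewrite /r in t2; lra.
Qed.

End open_mapping.


(** * Graph coordinates and boundary values *)

Section planar_sets.
Variable R : realType.
Variables (D : set 'rV[R]_2).
Implicit Types (w z : R[i]).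

Lemma nbhs_ofC z (B : set 'rV[R]_2) : nbhs (ofC z) B <->
  exists2 e, 0 < e & forall z', cabs (z' - z) < e -> B (ofC z').
Proof.
split=> [/nbhs_ballP[e /= e0 He]|[e e0 He]].
  exists e => // z' zz'; apply: He; rewrite -ball_normE /ball_ /= distrC -ofCB.
  by apply: le_lt_trans (norm_le_cabs _) _; rewrite ofCK.
apply/nbhs_ballP; exists (e / 2); first by rewrite /= divr_gt0.
move=> x; rewrite -ball_normE /ball_ /= distrC => xz; rewrite -[x]toCK; apply: He.
rewrite -[z]ofCK -toCB; apply: le_lt_trans (cabs_le_norm _) _; lra.
Qed.

Lemma closure_ofC z : closure D (ofC z) <->
  forall e, 0 < e -> exists z', D (ofC z') /\ cabs (z' - z) < e.
Proof.
split=> [H e e0|H B /nbhs_ofC[e e0 He]].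
  have [|x [Dx /= xz]] := H [set x | cabs (toC x - z) < e].
    by apply/nbhs_ofC; exists e => // z' /=; rewrite ofCK.
  by exists (toC x); rewrite toCK.
by have [z' [Dz' /He Bz']] := H e e0; exists (ofC z').
Qed.

Lemma interior_ofC z : interior D (ofC z) <->
  exists2 e, 0 < e & forall z', cabs (z' - z) < e -> D (ofC z').
Proof. exact: nbhs_ofC. Qed.

(** Multiplication by [conjc e] puts the axis of the graph in standard position. Below the graph a whole
    neighbourhood misses [D], because [psi] is Lipschitz; points on the graph are limits of points of [D] above
    it, so they are not exterior. *)
Lemma lipschitz_boundary_chart p : open D -> lipschitz_boundary D -> bdry D (ofC p) ->
  exists (r : R) (e : R[i]) (psi : R -> R) (k : R),
    [/\ 0 < r, cabs e = 1, 0 <= k, forall x y, `|psi x - psi y| <= k * `|x - y| &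
     forall z, cabs (z - p) < r ->
       let u := z * conjc e in
       (exterior D (ofC z) <-> complex.Im u < psi (complex.Re u)) /\
       (bdry D (ofC z) -> complex.Im u = psi (complex.Re u))].
Proof.
move=> oD lipD Dp; have [r [e [psi [k [r0 e1 lk HD]]]]] := lipD _ Dp.
have lk' x y : `|psi x - psi y| <= `|k| * `|x - y|.
  have /(_ (x, y)) := lk; rewrite /= => /(_ (conj I I)) => H.
  by apply: le_trans H _; rewrite ler_wpM2r // ler_norm.
have ce1 : cabs (toC e) = 1 by rewrite -enormE.
have ee : toC e * conjc (toC e) = 1.
  by rewrite -sqr_normc normC_cabs ce1 expr1n.
exists r, (toC e), psi, `|k|; split => // z zp u.
have HD' z' : cabs (z' - p) < r ->
    (D (ofC z') <-> psi (complex.Re (z' * conjc (toC e))) < complex.Im (z' * conjc (toC e))).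
  move=> zp'; have := HD (ofC z'); rewrite enormE toCB !ofCK => /(_ zp').
  rewrite !dotE ReM ImM /= !mxE /=.
  by rewrite !mulrN opprK.
have near z' e' : cabs (z' - z) < e' -> e' <= r - cabs (z - p) -> cabs (z' - p) < r.
  by move=> H1 H2; have := cabsBD z z' p; lra.
have r'0 : 0 < r - cabs (z - p) by rewrite subr_gt0.
have below : complex.Im u < psi (complex.Re u) -> exterior D (ofC z).
  move=> lt; apply/closure_ofC => H.
  pose d := (psi (complex.Re u) - complex.Im u) / (`|k| + 1).
  have d0 : 0 < d by rewrite divr_gt0 ?subr_gt0 // ltr_wpDl.
  have [|z' [Dz' zz']] := H (Num.min d (r - cabs (z - p))).
    by rewrite lt_min d0 r'0.
  rewrite lt_min in zz'; case/andP: zz' => zd zr.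
  have zp' := near z' _ zr (lexx _).
  have /HD'-/(_ zp') := Dz'; set v := z' * _ => lt'.
  have duv : cabs (v - u) < d by rewrite /v /u -mulrBl cabsM cabs_conj ce1 mulr1.
  have k0 := normr_ge0 k.
  have dE : d * (`|k| + 1) = psi (complex.Re u) - complex.Im u.
    by rewrite /d divfK // gt_eqF // ltr_wpDl.
  have H1 : `|psi (complex.Re v) - psi (complex.Re u)| <= `|k| * d.
    apply: le_trans (lk' _ _) _; rewrite ler_wpM2l //.
    by apply: le_trans (ltW duv); rewrite -ReN -ReD cabs_Re.
  have H2 : `|complex.Im v - complex.Im u| < d.
    by apply: le_lt_trans duv; rewrite -ImN -ImD cabs_Im.
  move: H1 H2; rewrite ler_norml ltr_norml => /andP[? _] /andP[_ ?]; lra.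
have shift t : 0 < t -> cabs (z + t%:C * ('i * toC e) - z) = t.
  move=> t0; rewrite addrC addKr !cabsM cabs_real gtr0_norm // ce1 mulr1.
  by rewrite cabs_def /= expr0n add0r expr1n sqrtr1 mulr1.
have above t : (z + t%:C * ('i * toC e)) * conjc (toC e) = u + t%:C * 'i.
  by rewrite mulrDl -/u -!mulrA ee mulr1.
split; last first.
  move=> [cz iz]; have [lt|gt|//] := ltgtP (complex.Im u) (psi (complex.Re u)).
    by have := below lt.
  by case: iz; apply: open_nbhs_nbhs; split => //; apply/HD'.
split=> // ez; have nDz : ~ D (ofC z) by move=> Dz; apply: ez; exact: subset_closure.
rewrite ltNge; apply/negP; rewrite le_eqVlt => /orP[/eqP ueq|]; last first.
  by move=> ?; apply: nDz; apply/HD'.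
apply: ez; apply/closure_ofC => e' e'0.
pose t := Num.min (e' / 2) ((r - cabs (z - p)) / 2).
have t0 : 0 < t by rewrite lt_min !divr_gt0.
have te : t <= e' / 2 by rewrite ge_min lexx.
have tr : t <= (r - cabs (z - p)) / 2 by rewrite ge_min lexx orbT.
exists (z + t%:C * ('i * toC e)); rewrite shift //; split; last lra.
apply/HD'; first by apply: (near _ (r - cabs (z - p))); rewrite ?shift //; lra.
rewrite above (_ : t%:C * 'i = 0 +i* t); last first.
  by apply/eqP; rewrite eq_complex /= mulr0 mul0r subrr mulr1 mul0r addr0 !eqxx.
rewrite ReD ImD /= addr0 -ueq; lra.
Qed.

End planar_sets.

Section boundary_values.
Variable R : realType.
Variables (D : set 'rV[R]_2) (gam : R) (Phi : R[i] -> R[i]) (a : nat -> R[i]).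
Hypothesis Phi_ext : exterior_conformal_map D gam Phi a.
Implicit Types (w z : R[i]).

Lemma Phi_exterior w : gam < cabs w -> exterior D (ofC (Phi w)).
Proof.
move=> gw; have : (Phi @` [set w : R[i] | gam%:C < `|w|]) (Phi w) by exists w; rewrite //= ltC_cabs.
by rewrite (ecm_image Phi_ext) => -[x ex <-]; rewrite toCK.
Qed.

Lemma exterior_Phi z : exterior D (ofC z) -> exists2 w, gam < cabs w & Phi w = z.
Proof.
move=> ez; have : (toC @` exterior D) z by exists (ofC z); rewrite ?ofCK.
by rewrite -(ecm_image Phi_ext) => -[w /= gw <-]; exists w; rewrite // -ltC_cabs.
Qed.

Lemma Phi_inj w w' : gam < cabs w -> gam <= cabs w' -> Phi w = Phi w' -> w = w'.
Proof.
move=> gw gw' E; have gw2 : gam < cabs w' by apply: (Phi_boundary_neq Phi_ext gw' gw).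
by apply: (ecm_injective Phi_ext); rewrite ?ltC_cabs.
Qed.

(** The outer points [(1 + t) * w] give the approach to a boundary point from the exterior. *)
Lemma Phi_radial w e : cabs w = gam -> 0 < e ->
  exists w', [/\ gam < cabs w', cabs (w' - w) < e & cabs (Phi w' - Phi w) < e].
Proof.
move=> gw e0; have g0 := ecm_gam_gt0 Phi_ext.
have [|d d0 Hd] := @Phi_continuous _ _ _ _ _ Phi_ext w _ e e0; first by rewrite gw.
pose t := Num.min (d / 2 / gam) (e / 2 / gam).
have t0 : 0 < t by rewrite !lt_min; do ![apply/andP; split]; do ?apply: divr_gt0 => //.
have t1 : t * gam <= d / 2 by rewrite -ler_pdivlMr // !ge_min lexx.
have t2 : t * gam <= e / 2 by rewrite -ler_pdivlMr // !ge_min lexx !orbT.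
have tg : 0 < t * gam by rewrite mulr_gt0.
have cw' : cabs ((1 + t)%:C * w) = gam + t * gam.
  by rewrite cabsM gw cabs_real ger0_norm; [ring|lra].
have dw : cabs ((1 + t)%:C * w - w) = t * gam.
  rewrite (_ : _ - w = t%:C * w); last by rewrite rmorphD rmorph1; ring.
  by rewrite cabsM cabs_real gtr0_norm // gw.
exists ((1 + t)%:C * w); rewrite cw' dw; split; [lra|lra|apply: Hd; rewrite ?cw' ?dw; lra].
Qed.

(** The image of a point of the circle is a limit of exterior points but is not exterior: it would then be
    attained at an outer point too, against [Phi_boundary_neq]. *)
Lemma Phi_bdry w : cabs w = gam -> bdry D (ofC (Phi w)).
Proof.
move=> gw; split.
  apply: contrapT => /exterior_Phi[w' gw' E].
  have := @Phi_inj w' w gw'; rewrite gw lexx => /(_ isT E) W.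
  by move: gw'; rewrite W gw ltxx.
move=> /interior_ofC[e e0 He].
have [w' [gw' _ dw']] := Phi_radial gw e0.
by have := Phi_exterior gw'; apply; apply: subset_closure; exact: He.
Qed.

End boundary_values.


(** * Uniform continuity and the maximum principle *)

Section polynomial_mean.
Variable R : realType.
Implicit Types (w z : R[i]) (p : {poly R[i]}).

Lemma expi_neq1 (x : R) : 0 < x < 2 * pi -> expi x != 1.
Proof.
move=> /andP[x0 x2]; apply/eqP => /(congr1 (@complex.Re R)) /= c1.
have s0 : 0 < sin (x / 2) by apply: sin_gt0_pi; apply/andP; split; lra.
have : cos (x / 2 + x / 2) = cos x by congr cos; lra.
rewrite cosD c1; have := cos2Dsin2 (x / 2); nra.
Qed.

(** Sums of nontrivial powers of roots of unity vanish, so averaging leaves the constant term. *)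
Lemma poly_mean p (M : nat) c : (size p <= M.+1)%N ->
  \sum_(l < M.+1) p.[c * expi (2 * pi * l%:R / M.+1%:R)] = M.+1%:R * p.[0].
Proof.
move=> sp; under eq_bigr do rewrite (horner_coef_wide _ sp).
rewrite exchange_big /= big_ord_recl /= [X in _ + X]big1 ?addr0 => [|i _].
  under eq_bigr do rewrite expr0 mulr1.
  by rewrite sumr_const card_ord horner_coef0 mulr_natl.
set j := lift ord0 i; have jM : (j < M.+1)%N by [].
pose om := expi (2 * pi * j%:R / M.+1%:R) : R[i].
have omM : om ^+ M.+1 = 1.
  rewrite expiX (_ : _ * _ = j%:R * (2 * pi)); last by field; rewrite addrC natr1 pnatr_eq0.
  by rewrite -expiX expi_2pi expr1n.
have om1 : om != 1.
  apply: expi_neq1; apply/andP; split.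
    by rewrite divr_gt0 ?mulr_gt0 ?pi_gt0 // ltr0n.
  by rewrite ltr_pdivrMr // ltr_pM2l ?mulr_gt0 ?pi_gt0 // ltr_nat.
under eq_bigr => l _.
  rewrite exprMn expiX (_ : j%:R * _ = l%:R * (2 * pi * j%:R / M.+1%:R)); last by ring.
  rewrite -expiX -/om mulrA; over.
rewrite -mulr_sumr; suff -> : \sum_(l < M.+1) om ^+ l = 0 by rewrite mulr0.
apply: (mulfI (_ : om - 1 != 0)); first by rewrite subr_eq0.
by rewrite -subrX1 omM subrr mulr0.
Qed.

(** The maximum principle at the centre of a disc, with the average of [poly_mean] in place of an integral. *)
Lemma poly_max_modulus p r b : (forall t, cabs p.[r%:C * expi t] <= b) -> cabs p.[0] <= b.
Proof.
move=> H; pose M := size p.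
have := @poly_mean p M r%:C (leqW (leqnn M)) => /(congr1 (@cabs R)).
rewrite cabsM => E.
have M0 : 0 < M.+1%:R :> R by [].
rewrite -(ler_pM2l M0); move: E; rewrite -[_%:R : R[i]](rmorph_nat (real_complex R)) cabs_real ger0_norm // => <-.
apply: le_trans (cabs_sum _ _ _) _.
apply: le_trans (ler_sum _ (fun l _ => H _)) _.
by rewrite sumr_const card_ord mulr_natl.
Qed.

End polynomial_mean.

Section injectivity.
Variable R : realType.
Variables (D : set 'rV[R]_2) (gam : R) (Phi : R[i] -> R[i]) (a : nat -> R[i]).
Hypothesis Phi_ext : exterior_conformal_map D gam Phi a.
Implicit Types (w z p : R[i]).
Let g0 : 0 < gam.
Proof. exact: ecm_gam_gt0 Phi_ext. Qed.

Lemma harmonic_small e : 0 < e -> exists N : nat, forall n, (N <= n)%N -> n.+1%:R^-1 < e :> R.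
Proof.
move=> e0; have /cvgrPdist_lt/(_ e e0)[N _ HN] := @cvg_harmonic R.
by exists N => n /HN; rewrite /= sub0r normrN ger0_norm.
Qed.

Lemma closed_annulus M z :
  (forall e, 0 < e -> exists2 w, gam <= cabs w <= M & cabs (w - z) < e) -> gam <= cabs z <= M.
Proof.
move=> H; apply/andP; split; apply/ler_addgt0Pr => e e0.
  have [w /andP[gw _] wz] := H e e0; have := cabs_lerB w z; lra.
have [w /andP[_ wM] wz] := H e e0; have := cabs_lerB z w; rewrite cabsB; lra.
Qed.

(** Heine's theorem on a closed annulus, by contradiction. *)
Lemma Phi_uniform M e : 0 < e -> exists2 d, 0 < d & forall w w', gam <= cabs w <= M ->
  gam <= cabs w' <= M -> cabs (w - w') < d -> cabs (Phi w - Phi w') < e.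
Proof.
move=> e0; apply: contrapT => H.
have /choice[u Hu] : forall n : nat, exists ww : R[i] * R[i], [/\ gam <= cabs ww.1 <= M,
    gam <= cabs ww.2 <= M, cabs (ww.1 - ww.2) < n.+1%:R^-1 & e <= cabs (Phi ww.1 - Phi ww.2)].
  move=> n; apply: contrapT => Hn; apply: H; exists n.+1%:R^-1; first by rewrite invr_gt0.
  move=> w w' gw gw' d; rewrite ltNge; apply/negP => ee; apply: Hn; by exists (w, w').
have [|z zc] := @complex_cluster _ (fun n => (u n).1) M.
  by move=> n; have [/andP[]] := Hu n.
have gz : gam <= cabs z <= M.
  apply: closed_annulus => d d0; have [n [_ ?]] := zc d d0 0%N.
  by exists (u n).1 => //; have [] := Hu n.
have e20 : 0 < e / 2 by rewrite divr_gt0.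
have [d d0 Hd] := Phi_continuous Phi_ext (proj1 (andP gz)) e20.
have d20 : 0 < d / 2 by rewrite divr_gt0.
have [N HN] := harmonic_small d20.
have [n [Nn un]] := zc _ d20 N.
have [/andP[g1 _] /andP[g2 _] u12 ee] := Hu n.
have {}u12 := lt_trans u12 (HN n Nn).
have u2 : cabs ((u n).2 - z) < d.
  have := cabsBD (u n).1 (u n).2 z; rewrite [cabs ((u n).2 - (u n).1)]cabsB; lra.
have u1 : cabs ((u n).1 - z) < d by lra.
have := Hd _ g1 u1; have := Hd _ g2 u2.
have := cabsBD (Phi z) (Phi (u n).1) (Phi (u n).2).
rewrite [cabs (Phi z - _)]cabsB; lra.
Qed.

Lemma Phi_bounded M : exists2 K, 0 <= K & forall w, gam <= cabs w <= M -> cabs (Phi w) <= K.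
Proof.
apply: contrapT => H.
have /choice[u Hu] : forall n : nat, exists w : R[i], gam <= cabs w <= M /\ n%:R < cabs (Phi w).
  move=> n; apply: contrapT => Hn; apply: H; exists n%:R => // w gw.
  by rewrite leNgt; apply/negP => ?; apply: Hn; exists w.
have [|z zc] := @complex_cluster _ u M; first by move=> n; have [/andP[]] := Hu n.
have gz : gam <= cabs z <= M.
  apply: closed_annulus => d d0; have [n [_ ?]] := zc d d0 0%N.
  by exists (u n) => //; have [] := Hu n.
have [d d0 Hd] := Phi_continuous Phi_ext (proj1 (andP gz)) ltr01.
pose N := Num.truncn (cabs (Phi z) + 1).
have [n [Nn un]] := zc _ d0 N.+1.
have [/andP[g1 _] big] := Hu n.
have := Hd _ g1 un; have := cabs_lerB (Phi (u n)) (Phi z).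
have : cabs (Phi z) + 1 < N.+1%:R by apply: truncnS_gt.
have : N.+1%:R <= n%:R :> R by rewrite ler_nat.
lra.
Qed.

(** Far away this is the expansion, and near the circle compactness. *)
Lemma Phi_near_id : exists2 K, 0 <= K & forall w, gam <= cabs w -> cabs (Phi w - w) <= K.
Proof.
have [K K0 HK] := Phi_bounded (gam + 1).
have [|N HN] := @lsum_uniform _ _ _ _ _ Phi_ext (gam + 1) _ 1 ltr01; first by lra.
have [S S0 SE] : exists2 S : R, 0 <= S & S = \sum_(0 <= k < N) cabs (a k).
  by eexists; last reflexivity; rewrite sumr_ge0 // => k _; exact: cabs_ge0.
exists (K + (gam + 1) + (1 + S)) => [|w gw].
  by do ?apply: addr_ge0 => //; apply: ltW.
have [wle|wgt] := leP (cabs w) (gam + 1).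
  have := HK w; rewrite gw wle => /(_ isT) H.
  by apply: le_trans (cabsD _ _) _; rewrite cabsN; lra.
have := HN N (leqnn N) w (ltW wgt).
have : cabs (lsum a N w) <= S.
  rewrite SE; apply: le_trans (cabs_sum _ _ _) _; apply: ler_sum => k _.
  have w1 : 1 <= cabs w by have := g0; lra.
  rewrite cabsM cabsV cabsX ler_pdivrMr ?exprn_gt0 ?(lt_le_trans ltr01) //.
  by rewrite ler_peMr ?cabs_ge0 // exprn_ege1.
have := g0.
have := cabs_lerB (Phi w - w) (lsum a N w); rewrite [cabs (Phi w - w - _)]cabsB; lra.
Qed.

(** An injective open map has a continuous inverse. *)
Lemma Phi_inv_continuous w0 e : gam < cabs w0 -> 0 < e -> exists2 d, 0 < d &
  forall w, gam < cabs w -> cabs (Phi w - Phi w0) < d -> cabs (w - w0) < e.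
Proof.
move=> gw e0; have e20 : 0 < e / 2 by rewrite divr_gt0.
have [d d0 Hd] := Phi_open Phi_ext gw e20.
exists d => // w gw' /Hd[w' [ww gw2 E]].
have <- : w' = w by apply: (Phi_inj Phi_ext gw2 (ltW gw') E).
lra.
Qed.

End injectivity.


(** * Injectivity of the boundary parametrization *)

Section circle_injectivity.
Variable R : realType.
Variables (D : set 'rV[R]_2) (gam : R) (Phi : R[i] -> R[i]) (a : nat -> R[i]).
Hypothesis Phi_ext : exterior_conformal_map D gam Phi a.
Implicit Types (w z p : R[i]).
Let g0 : 0 < gam.
Proof. exact: ecm_gam_gt0 Phi_ext. Qed.

Lemma expi_periodic (x : R) (n : int) : expi (x + n%:~R * (2 * pi)) = expi x.
Proof.
rewrite expiD; suff -> : expi (n%:~R * (2 * pi)) = 1 :> R[i] by rewrite mulr1.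
case: n => n; first by rewrite -[_%:~R]/(n%:R) -expiX expi_2pi expr1n.
by rewrite NegzE mulrNz mulNr -expiV -[_%:~R]/(n.+1%:R) -expiX expi_2pi expr1n invr1.
Qed.

Lemma expi_pi : expi pi = -1 :> R[i].
Proof. by rewrite /expi cospi sinpi; apply/eqP; rewrite eq_complex /= oppr0 !eqxx. Qed.

Lemma expi_half_periodic (x : R) (n : int) :
  expi (x + n%:~R * pi) = expi x \/ expi (x + n%:~R * pi) = - expi x.
Proof.
have nE := divz_eq n 2; set m := (n %/ 2)%Z in nE.
have r0 : 0 <= (n %% 2)%Z by apply: modz_ge0.
have r2 : (n %% 2)%Z < 2 by apply: ltz_pmod.
have [r|r] : (n %% 2)%Z = 0 \/ (n %% 2)%Z = 1 by lia.
  left; rewrite nE r addr0 intrM (_ : _ * pi = m%:~R * (2 * pi)) ?expi_periodic //.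
  by rewrite -mulrA.
right; rewrite nE r intrD intrM /= mulrDl mul1r addrA expiD expi_pi mulrN1.
rewrite (_ : _ * pi = m%:~R * (2 * pi)) ?expi_periodic //.
by rewrite -mulrA.
Qed.

(** Rotations by multiples of [pi / N.+1] have steps shorter than the arc; they cover half a turn, and the sign
    accounts for the other half. *)
Lemma rotate_into (al eta t : R) (N : nat) : 0 < eta -> pi < eta * N.+1%:R ->
  exists k : 'I_N.+1, exists s, [/\ al - eta < s, s <= al &
    expi (t + pi * k%:R / N.+1%:R) = expi s \/ expi (t + pi * k%:R / N.+1%:R) = - expi s :> R[i]].
Proof.
move=> eta0 HN.
have N0 : 0 < N.+1%:R :> R by [].
have pi0 : 0 < pi :> R := pi_gt0 R.
pose j := Num.floor ((al - t) * N.+1%:R / pi).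
have /andP[j1 j2] := floor_itv ((al - t) * N.+1%:R / pi).
rewrite -/j in j1 j2.
pose q := (j %/ N.+1%:Z)%Z; pose k := (j %% N.+1%:Z)%Z.
have jE : j = q * N.+1%:Z + k by exact: divz_eq.
have k0 : 0 <= k by apply: modz_ge0.
have kN : k < N.+1%:Z by apply: ltz_pmod.
have kE : k = `|k|%N%:Z by rewrite gez0_abs.
have kN' : (`|k| < N.+1)%N by rewrite -ltz_nat -kE.
exists (Ordinal kN') => /=.
pose s := t + pi * j%:~R / N.+1%:R.
have sE : s = t + pi * `|k|%N%:R / N.+1%:R + q%:~R * pi.
  rewrite /s {1}jE intrD intrM {1}kE /= -!pmulrn.
  by field; rewrite addrC natr1 pnatr_eq0.
exists s; split.
- have : (al - t) * N.+1%:R < (j%:~R + 1) * pi.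
    by rewrite -ltr_pdivrMr //; move: j2; rewrite intrD.
  have : (s - t) * N.+1%:R = pi * j%:~R by rewrite /s addrC addKr divfK // gt_eqF.
  nra.
- have : j%:~R * pi <= (al - t) * N.+1%:R by rewrite -ler_pdivlMr.
  have : (s - t) * N.+1%:R = pi * j%:~R by rewrite /s addrC addKr divfK // gt_eqF.
  nra.
have := expi_half_periodic (t + pi * `|k|%N%:R / N.+1%:R) q; rewrite -sE.
by case=> ->; [left|right; rewrite opprK].
Qed.

(** The function [f w = (Phi w - p) / w] is 1 at infinity. Take the product of [f] over finitely many rotations of
    [w] and of [- w]: under the condition on the arc, some factor would vanish at each point of the circle, so the
    product would vanish on the circle, and also at infinity by the maximum principle in [w^-1], where it is 1. To
    deal with polynomials in [w^-1] only, the proof replaces [Phi] by a partial sum on a slightly larger circle. *)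
Lemma no_antipodal_arc p al eta : 0 < eta ->
  ~ (forall s, al - eta < s -> s <= al ->
      Phi (gam%:C * expi s) = p \/ Phi (- (gam%:C * expi s)) = p).
Proof.
move=> eta0 H; have gam0 := g0.
have pi0 : 0 < pi :> R := pi_gt0 R.
pose N := Num.truncn (pi / eta).
have HN : pi < eta * N.+1%:R by rewrite mulrC -ltr_pdivrMr //; apply: truncnS_gt.
have [K K0 HK] := Phi_bounded Phi_ext (gam + 1).
(* [B] bounds each factor on the circle; [e] is so small that a single small factor beats all the
   others. *)
pose B := (K + cabs p + 1) / gam.
have cp0 := cabs_ge0 p.
have B0 : 0 < B by rewrite divr_gt0 //; lra.
pose e := Num.min 1 (gam / (4 * (1 + B) ^+ (2 * N.+1))).
have B1 : 0 < (1 + B) ^+ (2 * N.+1) by rewrite exprn_gt0 //; lra.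
have e0 : 0 < e by rewrite lt_min ltr01 divr_gt0 // mulr_gt0.
have e1 : e <= 1 by rewrite ge_min lexx.
have e2 : e * (4 * (1 + B) ^+ (2 * N.+1)) <= gam.
  by rewrite -ler_pdivlMr ?mulr_gt0 // ge_min lexx orbT.
have [d d0 Hd] := Phi_uniform Phi_ext (gam + 1) e0.
pose rho := gam + Num.min 1 (d / 2).
have m0 : 0 < Num.min 1 (d / 2) by rewrite lt_min ltr01 divr_gt0.
have rho1 : rho <= gam + 1 by rewrite /rho lerD2l ge_min lexx.
have rho2 : rho - gam <= d / 2 by rewrite /rho addrC addKr ge_min lexx orbT.
have grho : gam < rho by rewrite /rho ltrDl.
have rho0 : 0 < rho := lt_trans gam0 grho.
have [n Hn] := lsum_uniform Phi_ext grho e0.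
have {}Hn := Hn n (leqnn n).
pose f w := (w + lsum a n w - p) / w.
have fB w : cabs w = rho -> cabs (f w) <= B.
  move=> wr; rewrite cabsM cabsV wr /B.
  apply: (@le_trans _ _ ((K + cabs p + 1) / rho)); last first.
    by rewrite ler_wpM2l ?lef_pV2 ?posrE //; lra.
  rewrite ler_pM2r ?invr_gt0 //.
  have := Hn w; rewrite wr lexx => /(_ isT).
  have := HK w; rewrite wr (ltW grho) rho1 => /(_ isT).
  have := cabsD (w + lsum a n w - Phi w) (Phi w - p).
  rewrite (_ : w + lsum a n w - Phi w + (Phi w - p) = w + lsum a n w - p); last by ring.
  rewrite (_ : w + lsum a n w - Phi w = lsum a n w - (Phi w - w)); last by ring.
  have := cabsD (Phi w) (- p); rewrite cabsN; lra.
have fsmall u w : cabs u = gam -> Phi u = p -> w = (rho / gam)%:C * u -> cabs (f w) <= 2 * e / gam.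
  move=> ug up wE; have wr : cabs w = rho.
    by rewrite wE cabsM cabs_real ug ger0_norm ?divr_ge0 ?divfK ?gt_eqF // ltW.
  rewrite cabsM cabsV wr.
  apply: (@le_trans _ _ (2 * e / rho)); last first.
    by rewrite ler_wpM2l ?lef_pV2 ?posrE //; lra.
  rewrite ler_pM2r ?invr_gt0 //.
  have := Hn w; rewrite wr lexx => /(_ isT).
  have du : cabs (w - u) < d.
    have -> : w - u = ((rho - gam) / gam)%:C * u.
      rewrite wE -{2}[u]mul1r -mulrBl -[1]/(1%:C : R[i]) -rmorphB; congr (_%:C * _).
      by rewrite mulrBl divff // gt_eqF.
    by rewrite cabsM cabs_real ug ger0_norm ?divr_ge0 ?divfK ?gt_eqF ?subr_ge0 //; lra.
  have := Hd w u; rewrite wr ug lexx (ltW grho) rho1 /= lerDl ler01 => /(_ isT isT du).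
  have := cabsD (w + lsum a n w - Phi w) (Phi w - p).
  rewrite (_ : w + lsum a n w - Phi w + (Phi w - p) = w + lsum a n w - p); last by ring.
  rewrite (_ : w + lsum a n w - Phi w = lsum a n w - (Phi w - w)); last by ring.
  rewrite -up; lra.
pose rot (k : 'I_N.+1) := expi (pi * k%:R / N.+1%:R) : R[i].
pose F w := \prod_k (f (w * rot k) * f (- (w * rot k))).
(* [f] and the product as polynomials in [w^-1]. *)
pose Q : {poly R[i]} := 1 + \sum_(0 <= k < n) a k *: 'X^(k.+1) - p *: 'X.
have QE w : w != 0 -> Q.[w^-1] = f w.
  move=> w0; rewrite /Q !hornerE horner_sum /f mulrBl mulrDl divff //.
  rewrite /lsum mulr_suml; congr (1 + _ - _); apply: eq_bigr => k _.
  by rewrite !hornerE exprVn exprSr invfM mulrA.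
have Q0 : Q.[0] = 1.
  rewrite /Q !hornerE horner_sum big1 ?addr0 ?subr0 // => k _.
  by rewrite !hornerE expr0n mulr0.
pose G := \prod_k ((Q \Po ((rot k)^-1 *: 'X)) * (Q \Po (- (rot k)^-1 *: 'X))).
have GE w : w != 0 -> G.[w^-1] = F w.
  move=> w0; rewrite /G horner_prod; apply: eq_bigr => k _.
  have r0 : rot k != 0 by exact: expi_neq0.
  rewrite hornerM !horner_comp !hornerZ !hornerX mulNr -!invfM -invrN (mulrC (rot k)).
  by rewrite !QE // ?oppr_eq0 mulf_neq0.
have G0 : G.[0] = 1.
  by rewrite /G horner_prod big1 // => k _; rewrite hornerM !horner_comp !hornerZ !hornerX !mulr0 Q0 mulr1.
have : cabs G.[0] <= 1 / 2.
  apply: (@poly_max_modulus _ _ rho^-1) => t.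
  have -> : rho^-1%:C * expi t = (rho%:C * expi (- t))^-1.
    by rewrite invfM expiV opprK fmorphV.
  set w := rho%:C * expi (- t).
  have wr : cabs w = rho by rewrite cabs_circle // ltW.
  have w0 : w != 0 by rewrite -cabs_gt0 wr.
  rewrite GE // /F.
  have [k [s [s1 s2 ks]]] := rotate_into al (- t) eta0 HN.
  have crot j : cabs (w * rot j) = rho by rewrite cabsM wr cabs_expi mulr1.
  have fj j : cabs (f (w * rot j) * f (- (w * rot j))) <= B ^+ 2.
    by rewrite cabsM expr2; apply: ler_pM; rewrite ?cabs_ge0 ?fB // ?cabsN crot.
  rewrite (bigD1 k) //= cabsM.
  have wk : w * rot k = (rho / gam)%:C * (gam%:C * expi s) \/
            w * rot k = (rho / gam)%:C * - (gam%:C * expi s).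
    rewrite mulrN mulrA -rmorphM /= divfK ?gt_eqF // /w /rot -mulrA -expiD.
    by case: ks => ->; [left|right; rewrite mulrN].
  have cg : cabs (gam%:C * expi s) = gam by rewrite cabs_circle // ltW.
  have one : cabs (f (w * rot k)) <= 2 * e / gam \/ cabs (f (- (w * rot k))) <= 2 * e / gam.
    case: (H s s1 s2) => Hp; case: wk => wkE.
    - by left; apply: (fsmall (gam%:C * expi s)).
    - right; apply: (fsmall (gam%:C * expi s)) => //; rewrite wkE; ring.
    - right; apply: (fsmall (- (gam%:C * expi s))); rewrite ?cabsN // wkE; ring.
    - by left; apply: (fsmall (- (gam%:C * expi s))); rewrite ?cabsN.
  have two : cabs (f (w * rot k) * f (- (w * rot k))) <= 2 * e / gam * (1 + B).
    rewrite cabsM; have f1 := fB (w * rot k) (crot k).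
    have f2 := fB (- (w * rot k)) (etrans (cabsN _) (crot k)).
    have c1 := cabs_ge0 (f (w * rot k)); have c2 := cabs_ge0 (f (- (w * rot k))).
    case: one => one; last rewrite mulrC.
      by apply: ler_pM => //; lra.
    by apply: ler_pM => //; lra.
  apply: (@le_trans _ _ (2 * e / gam * (1 + B) * (1 + B) ^+ (2 * N).+1)); last first.
    have -> : 2 * e / gam * (1 + B) * (1 + B) ^+ (2 * N).+1 =
        2 * e / gam * (1 + B) ^+ (2 * N.+1).
      by rewrite -mulrA -exprS; congr (_ * _ ^+ _); rewrite mulnS.
    move: e2; set BN := _ ^+ _ => e2.
    by rewrite mulrAC ler_pdivrMr //; lra.
  apply: ler_pM => //; rewrite ?cabs_ge0 //.
  apply: (@le_trans _ _ (\prod_(j < N.+1 | j != k) (1 + B) ^+ 2)).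
    elim/big_rec2: _ => [|j y1 y2 _ IH]; first by rewrite cabs1.
    rewrite cabsM; apply: ler_pM; rewrite ?cabs_ge0 //.
    by apply: le_trans (fj j) _; apply: lerXn2r; rewrite ?nnegrE; lra.
  rewrite prodr_const cardC1 card_ord /= -exprM.
  by apply: ler_weXn2l; [lra|].
rewrite G0 cabs1; lra.
Qed.

End circle_injectivity.

Lemma clamp_lipschitz (R : realType) (s s' : R) :
  `|Num.max 0 (Num.min s 1) - Num.max 0 (Num.min s' 1)| <= `|s - s'|.
Proof.
have clP (x : R) : [\/ x <= 0 /\ Num.max 0 (Num.min x 1) = 0, 0 <= x <= 1 /\ Num.max 0 (Num.min x 1) = x |
    1 <= x /\ Num.max 0 (Num.min x 1) = 1].
  have [x0|x0] := leP x 0.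
    by apply: Or31; rewrite min_l ?max_l // (le_trans x0).
  have [x1|x1] := leP x 1; first by apply: Or32; rewrite max_r // ltW.
  by apply: Or33; rewrite max_r // ltW.
have := ler_norm (s - s'); have := ler_norm (- (s - s')); rewrite normrN => ? ?.
case: (clP s) => -[? ->]; case: (clP s') => -[? ->]; rewrite ler_norml; apply/andP; split;
  repeat match goal with H : is_true (_ <= _ <= _) |- _ => case/andP: H => ? ? end; lra.
Qed.

Section boundary_injectivity.
Variable R : realType.
Variables (D : set 'rV[R]_2) (gam : R) (Phi : R[i] -> R[i]) (a : nat -> R[i]).
Hypothesis Phi_ext : exterior_conformal_map D gam Phi a.
Hypothesis oD : open D.
Hypothesis lipD : lipschitz_boundary D.
Implicit Types (w z p : R[i]).
Let g0 : 0 < gam.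
Proof. exact: ecm_gam_gt0 Phi_ext. Qed.

(** Exterior points close to a boundary point [p] are joined by an exterior arc close to [p], obtained by
    interpolating the abscissa and the depth below the graph linearly. The preimage of the arc is a path, and it
    crosses each line through 0 that separates its ends. *)
Lemma cross_near p e : bdry D (ofC p) -> 0 < e -> exists2 d, 0 < d &
  forall w0 w1 al, gam < cabs w0 -> gam < cabs w1 -> cabs (Phi w0 - p) < d -> cabs (Phi w1 - p) < d ->
  complex.Im (expi (- al) * w0) < 0 -> 0 < complex.Im (expi (- al) * w1) ->
  exists w, [/\ gam < cabs w, complex.Im (expi (- al) * w) = 0 & cabs (Phi w - p) < e].
Proof.
move=> bp e0.
have [r [u [psi [k [r0 u1 k0 lk ch]]]]] := lipschitz_boundary_chart oD lipD bp.
have uu : u * conjc u = 1 by rewrite -sqr_normc normC_cabs u1 expr1n.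
pose m := Num.min r e.
have m0 : 0 < m by rewrite lt_min r0.
(* The arc stays within [2 * k + 2] times the distance of its ends to [p]. *)
pose c := 2 * k + 3.
have c0 : 0 < c by rewrite /c; lra.
exists (m / c) => [|w0 w1 al gw0 gw1 d0 d1 Im0 Im1]; first by rewrite divr_gt0.
set d := m / c in d0 d1.
have dc : d * c = m by rewrite /d divfK // gt_eqF.
have dpos : 0 < d by rewrite divr_gt0.
pose X z := complex.Re (z * conjc u); pose Y z := complex.Im (z * conjc u).
have XB z z' : `|X z - X z'| <= cabs (z - z').
  rewrite -ReN -ReD -mulNr -mulrDl; apply: le_trans (cabs_Re _) _.
  by rewrite cabsM cabs_conj u1 mulr1.
have YB z z' : `|Y z - Y z'| <= cabs (z - z').
  rewrite -ImN -ImD -mulNr -mulrDl; apply: le_trans (cabs_Im _) _.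
  by rewrite cabsM cabs_conj u1 mulr1.
have dm : d <= m by rewrite -dc ler_peMr ?ltW // /c; lra.
have mr : m <= r by rewrite ge_min lexx.
have me : m <= e by rewrite ge_min lexx orbT.
have inB z : cabs (z - p) < d -> cabs (z - p) < r by lra.
have Yp : Y p = psi (X p) by apply: (ch p _).2 => //; rewrite subrr cabs0.
have lt0 : Y (Phi w0) < psi (X (Phi w0)) by apply/(ch _ (inB _ d0)).1/(Phi_exterior Phi_ext gw0).
have lt1 : Y (Phi w1) < psi (X (Phi w1)) by apply/(ch _ (inB _ d1)).1/(Phi_exterior Phi_ext gw1).
pose h0 := psi (X (Phi w0)) - Y (Phi w0); pose h1 := psi (X (Phi w1)) - Y (Phi w1).
have hB z : cabs (z - p) < d -> `|X z - X p| < d /\ psi (X z) - Y z <= (k + 1) * d.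
  move=> zd; have xd := le_lt_trans (XB z p) zd; have yd := le_lt_trans (YB z p) zd; split => //.
  have := lk (X z) (X p).
  have : k * `|X z - X p| <= k * d by apply: ler_wpM2l => //; exact: ltW.
  move: yd; rewrite Yp ltr_norml ler_norml => /andP[? ?] ? /andP[? ?]; lra.
have [xd0 h0d] := hB _ d0; have [xd1 h1d] := hB _ d1.
have h0pos : 0 < h0 by rewrite subr_gt0.
have h1pos : 0 < h1 by rewrite subr_gt0.
(* The abscissa and the depth below the graph along the arc. *)
pose Xs (s : R) := X (Phi w0) + s * (X (Phi w1) - X (Phi w0)).
pose hs (s : R) := h0 + s * (h1 - h0).
pose zs (s : R) := (Xs s +i* (psi (Xs s) - hs s)) * u.
have zsu s : zs s * conjc u = Xs s +i* (psi (Xs s) - hs s) by rewrite -mulrA uu mulr1.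
have Xp s : 0 <= s <= 1 -> `|Xs s - X p| <= d.
  move=> /andP[s0 s1]; rewrite /Xs.
  have -> : X (Phi w0) + s * (X (Phi w1) - X (Phi w0)) - X p =
     (1 - s) * (X (Phi w0) - X p) + s * (X (Phi w1) - X p) by ring.
  have s1' : 0 <= 1 - s by rewrite subr_ge0.
  apply: le_trans (ler_normD _ _) _.
  rewrite !normrM [`|1 - s|]ger0_norm // [`|s|]ger0_norm //.
  have H1 := ler_wpM2l s0 (ltW xd1); have H0 := ler_wpM2l s1' (ltW xd0).
  apply: le_trans (lerD H0 H1) _; lra.
have hsB s : 0 <= s <= 1 -> 0 < hs s <= (k + 1) * d.
  move=> /andP[s0 s1]; rewrite /hs.
  have -> : h0 + s * (h1 - h0) = (1 - s) * h0 + s * h1 by ring.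
  move: h0d h1d; rewrite -/h0 -/h1 => h0d h1d.
  have s1' : 0 <= 1 - s by rewrite subr_ge0.
  have := ler_wpM2l s0 h1d; have := ler_wpM2l s1' h0d.
  set hm := Num.min h0 h1; have hm0 : 0 < hm by rewrite lt_min h0pos.
  have hm1 : hm <= h0 by rewrite ge_min lexx.
  have hm2 : hm <= h1 by rewrite ge_min lexx orbT.
  have := ler_wpM2l s0 hm2; have := ler_wpM2l s1' hm1.
  by move=> *; apply/andP; split; lra.
have zsp s : 0 <= s <= 1 -> cabs (zs s - p) < m.
  move=> s01; have -> : cabs (zs s - p) = cabs (zs s * conjc u - p * conjc u).
    by rewrite -[in RHS]mulrBl [RHS]cabsM cabs_conj u1 mulr1.
  apply: le_lt_trans (cabs_le _) _.
  rewrite zsu !ReD !ImD !ReN !ImN /= -/(X p) -/(Y p) Yp -dc /c.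
  have := Xp s s01; have := lk (Xs s) (X p).
  have : k * `|Xs s - X p| <= k * d by apply: ler_wpM2l => //; exact: Xp.
  have /andP[? ?] := hsB s s01.
  have : `|psi (Xs s) - hs s - psi (X p)| <= `|psi (Xs s) - psi (X p)| + `|- hs s|.
    by rewrite addrAC; exact: ler_normD.
  rewrite normrN [`|hs s|]gtr0_norm //; lra.
have zse s : 0 <= s <= 1 -> exterior D (ofC (zs s)).
  move=> s01; apply/(ch (zs s) _).1; first exact: lt_le_trans (zsp s s01) mr.
  rewrite zsu /= gtrBl; by have /andP[] := hsB s s01.
pose L := `|X (Phi w1) - X (Phi w0)| * (1 + k) + `|h1 - h0| + 1.
have L0 : 0 < L by rewrite ltr_wpDl // addr_ge0 // mulr_ge0 // addr_ge0.
have zsL s s' : cabs (zs s - zs s') <= L * `|s - s'|.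
  have -> : cabs (zs s - zs s') = cabs (zs s * conjc u - zs s' * conjc u).
    by rewrite -[in RHS]mulrBl [RHS]cabsM cabs_conj u1 mulr1.
  apply: le_trans (cabs_le _) _; rewrite !zsu !ReD !ImD !ReN !ImN /=.
  have E1 : Xs s - Xs s' = (X (Phi w1) - X (Phi w0)) * (s - s') by rewrite /Xs; ring.
  have E2 : hs s' - hs s = (h1 - h0) * - (s - s') by rewrite /hs; ring.
  have := lk (Xs s) (Xs s'); rewrite E1 normrM => H1.
  have -> : psi (Xs s) - hs s - (psi (Xs s') - hs s') = psi (Xs s) - psi (Xs s') + (hs s' - hs s) by ring.
  have := ler_normD (psi (Xs s) - psi (Xs s')) (hs s' - hs s); rewrite E2 normrM normrN.
  rewrite /L; have := normr_ge0 (s - s'); lra.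
pose Psi z := xget (0 : R[i]) [set w | gam < cabs w /\ Phi w = z].
have PsiP z : exterior D (ofC z) -> gam < cabs (Psi z) /\ Phi (Psi z) = z.
  move=> /(exterior_Phi Phi_ext)[w gw E]; rewrite /Psi.
  by case: xgetP => [y _ [] //|]; move=> /(_ w) []; split.
(* Clamping the parameter gives a path defined and continuous on the whole line. *)
pose cl (s : R) := Num.max 0 (Num.min s 1).
have cl01 s : 0 <= cl s <= 1 by rewrite /cl le_max lexx /= ge_max ler01 ge_min lexx orbT.
have clL s s' : `|cl s - cl s'| <= `|s - s'| by exact: clamp_lipschitz.
pose G s := complex.Im (expi (- al) * Psi (zs (cl s))).
have Gc : continuous (G : R -> R).
  move=> s; apply/cvgrPdist_lt => eps eps0.
  have [gws Es] := PsiP _ (zse _ (cl01 s)).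
  have [dd dd0 Hd] := Phi_inv_continuous Phi_ext gws eps0.
  apply/nbhs_ballP; exists (dd / L); first by rewrite /= divr_gt0.
  move=> s'; rewrite /ball /= => ss'.
  have [gws' Es'] := PsiP _ (zse _ (cl01 s')).
  rewrite distrC /G -ImN -ImD -mulrN -mulrDr; apply: le_lt_trans (cabs_Im _) _.
  rewrite cabsM cabs_expi mul1r; apply: Hd => //; rewrite Es Es'.
  apply: le_lt_trans (zsL _ _) _; rewrite -ltr_pdivlMl // mulrC.
  by apply: le_lt_trans (clL _ _) _; rewrite distrC.
have Psiw w : gam < cabs w -> Psi (Phi w) = w.
  move=> gw; have [gp E] := PsiP _ (Phi_exterior Phi_ext gw).
  exact: (Phi_inj Phi_ext gp (ltW gw) E).
have zs0 : zs 0 = Phi w0.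
  rewrite /zs /Xs /hs !mul0r !addr0 /h0 opprB addrC subrK -complexE -mulrA (mulrC _ u) uu mulr1 //.
have zs1 : zs 1 = Phi w1.
  have X1 : Xs 1 = X (Phi w1) by rewrite /Xs; ring.
  have h11 : hs 1 = h1 by rewrite /hs; ring.
  rewrite /zs X1 h11 /h1 opprB addrC subrK.
  by rewrite -complexE -mulrA (mulrC _ u) uu mulr1.
have cl0 : cl 0 = 0 by rewrite /cl min_l // max_l.
have cl1 : cl 1 = 1 by rewrite /cl min_l // max_r.
have G0 : G 0 < 0 by rewrite /G cl0 zs0 Psiw.
have G1 : 0 < G 1 by rewrite /G cl1 zs1 Psiw.
have [s _ Gs] : exists2 s, s \in `[0, 1] & G s = 0.
  apply: IVT => //; first exact: continuous_subspaceT.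
  by rewrite ge_min le_max (ltW G0) (ltW G1) orbT.
have [gws Es] := PsiP _ (zse _ (cl01 s)).
exists (Psi (zs (cl s))); split => //.
by rewrite Es; apply: lt_le_trans me; exact: zsp.
Qed.

(** Suppose that two points of the circle have the same image [p]. The lines through 0 that separate them fill an
    open sector. By [cross_near] each one carries outer points whose images tend to [p]; a cluster value of these
    lies on the circle, so one of the two ends of the diameter is mapped to [p]. This contradicts
    [no_antipodal_arc]. *)
Lemma Phi_circle_inj t1 t2 : t1 < t2 < t1 + 2 * pi ->
  Phi (gam%:C * expi t1) != Phi (gam%:C * expi t2).
Proof.
move=> /andP[t12 t21]; apply/eqP => E; have gam0 := g0.
set p := Phi _ in E; pose c := (t1 + t2) / 2.
pose eta := Num.min ((t2 - t1) / 2) (pi - (t2 - t1) / 2).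
have eta0 : 0 < eta by rewrite lt_min; apply/andP; split; lra.
have eta1 : eta <= (t2 - t1) / 2 by rewrite ge_min lexx.
have eta2 : eta <= pi - (t2 - t1) / 2 by rewrite ge_min lexx orbT.
have cg t : cabs (gam%:C * expi t) = gam by rewrite cabs_circle // ltW.
apply: (@no_antipodal_arc _ _ _ _ _ Phi_ext p c eta eta0) => s s1 s2.
have bp : bdry D (ofC p) by apply: (Phi_bdry Phi_ext).
have ImE t : complex.Im (expi (- s) * (gam%:C * expi t)) = gam * sin (t - s).
  by rewrite mulrCA -expiD ImM /= mul0r addr0 (addrC (- s)).
have sin1 : sin (t1 - s) < 0.
  rewrite -opprB sinN oppr_lt0; apply: sin_gt0_pi; rewrite /c in s1 s2; apply/andP; split; lra.
have sin2 : 0 < sin (t2 - s).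
  apply: sin_gt0_pi; rewrite /c in s1 s2; apply/andP; split; lra.
(* Outer points on the line of direction [s] whose images tend to [p]. *)
have /choice[w Hw] : forall n : nat, exists w, [/\ gam < cabs w,
    complex.Im (expi (- s) * w) = 0 & cabs (Phi w - p) < n.+1%:R^-1].
  move=> n; have n0 : 0 < n.+1%:R^-1 :> R by rewrite invr_gt0.
  have [d d0 Hd] := cross_near bp n0.
  pose e1 := Num.min d (- (gam * sin (t1 - s))); pose e2 := Num.min d (gam * sin (t2 - s)).
  have e10 : 0 < e1 by rewrite lt_min d0 -mulrN mulr_gt0 ?oppr_gt0.
  have e20 : 0 < e2 by rewrite lt_min d0 mulr_gt0.
  have [w0 [gw0 ww0 P0]] := Phi_radial Phi_ext (cg t1) e10.
  have [w1 [gw1 ww1 P1]] := Phi_radial Phi_ext (cg t2) e20.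
  rewrite !lt_min -/p in ww0 P0; rewrite !lt_min -E in ww1 P1.
  have Imd x y : `|complex.Im (expi (- s) * x) - complex.Im (expi (- s) * y)| <= cabs (x - y).
    rewrite -ImN -ImD -mulrN -mulrDr; apply: le_trans (cabs_Im _) _.
    by rewrite cabsM cabs_expi mul1r.
  apply: (Hd w0 w1) => //; [by case/andP: P0|by case/andP: P1| |].
    have := Imd w0 (gam%:C * expi t1); rewrite ImE ler_norml.
    case/andP: ww0 => _ ? /andP[_ ?]; lra.
  have := Imd w1 (gam%:C * expi t2); rewrite ImE ler_norml.
  case/andP: ww1 => _ ? /andP[? _]; lra.
have [K K0 HK] := Phi_near_id Phi_ext.
have wM n : cabs (w n) <= cabs p + 1 + K.
  have [gw _ wp] := Hw n; have := HK _ (ltW gw).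
  have n1 : n.+1%:R^-1 <= 1 :> R by rewrite invf_le1 // ler1n.
  have {}wp := lt_le_trans wp n1.
  have := cabs_lerB (w n) (Phi (w n)); have := cabs_lerB (Phi (w n)) p.
  rewrite [cabs (w n - _)]cabsB; lra.
have [z zc] := complex_cluster wM.
have /andP[gz _] : gam <= cabs z <= cabs p + 1 + K.
  apply: closed_annulus => e e0; have [n [_ ?]] := zc e e0 0%N.
  by exists (w n) => //; rewrite wM andbT ltW //; have [] := Hw n.
have zp : Phi z = p.
  apply/eqP; rewrite -subr_eq0 -cabs_eq0 eq_le cabs_ge0 andbT.
  apply/ler_addgt0Pr => e e0; rewrite add0r; have e20 : 0 < e / 2 by rewrite divr_gt0.
  have [d d0 Hd] := Phi_continuous Phi_ext gz e20.
  have [N HN] := harmonic_small e20.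
  have [n [Nn nz]] := zc d d0 N; have [gw _ wp] := Hw n.
  have := Hd _ (ltW gw) nz; have {}wp := lt_trans wp (HN n Nn).
  have := cabsBD (Phi (w n)) (Phi z) p; rewrite [cabs (Phi z - Phi _)]cabsB; lra.
have Imz : complex.Im (expi (- s) * z) = 0.
  apply/eqP; rewrite -normr_eq0 eq_le normr_ge0 andbT.
  apply/ler_addgt0Pr => e e0; rewrite add0r.
  have [n [_ nz]] := zc e e0 0%N; have [_ wI _] := Hw n.
  apply: ltW; apply: le_lt_trans nz; rewrite -normrN -[- _]add0r -wI -ImN -ImD -mulrN -mulrDr.
  by apply: le_trans (cabs_Im _) _; rewrite cabsM cabs_expi mul1r.
have zg : cabs z = gam.
  apply/eqP; rewrite eq_le gz andbT leNgt; apply/negP => gz'.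
  have := @Phi_inj _ _ _ _ _ Phi_ext z (gam%:C * expi t1) gz'.
  rewrite cg lexx -/p => /(_ isT zp) zE.
  by move: gz'; rewrite zE cg ltxx.
pose x := complex.Re (expi (- s) * z).
have xE : expi (- s) * z = x%:C by rewrite [LHS]complexE Imz.
have zE : z = x%:C * expi s.
  by rewrite -xE mulrAC -expiD addNr expi0 mul1r.
have : `|x| = gam by rewrite -zg zE cabsM cabs_expi mulr1 cabs_real.
move=> /eqP; rewrite eqr_norml ltW // andbT => /orP[/eqP xg|/eqP xg].
  by left; rewrite -xg -zE.
by right; rewrite -mulNr -rmorphN -xg -zE.
Qed.

End boundary_injectivity.


(** * Integrals of difference quotients *)

Section difference_quotients.
Variable R : realType.
Local Notation mu := (@lebesgue_measure R).

Lemma continuous_primitive (W : R -> R) (a u : R) : continuous W ->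
  exists A : R -> R, forall x, a < x < u -> is_derive x 1 A (W x).
Proof.
move=> cW; exists (fun x => \int[lebesgue_measure]_(t in `[a, x]) W t) => x /andP[ax xu].
have iW : lebesgue_measure.-integrable `[a, u] (EFin \o W).
  by apply: continuous_compact_integrable; [exact: segment_compact|exact: continuous_subspaceT].
have [d1 d2] := continuous_FTC1_closed xu iW ax (cW x).
by apply: DeriveDef; [exact: d1|rewrite -derive1E].
Qed.

(** The integral of the difference quotient is the mean of [W] on [[d, d + del]], which is [W d], minus its mean
    on [[c, c + del]], which is at least [W c]. *)
Lemma integral_difference_quotient (W : R -> R) (c d del : R) :
  c < d -> 0 < del <= 1 -> continuous W -> {homo W : x y / x <= y} ->
  (forall t, d <= t -> W t = W d) ->
  (\int[mu]_(t in `[c, d]) ((W (t + del) - W t) / del)%:E <= (W d - W c)%:E)%E.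
Proof.
move=> cd /andP[del0 del1] cW ndW Wd.
have [A HA] := continuous_primitive (c - 1) (d + 2) cW.
pose F t := (A (t + del) - A t) / del.
have dF t : c - 1 < t < d + 1 -> is_derive t 1 F ((W (t + del) - W t) / del).
  move=> /andP[t1 t2].
  have H0 : is_derive t 1 A (W t) by apply: HA; apply/andP; split; lra.
  have H1 : is_derive (t + del) 1 A (W (t + del)) by apply: HA; apply/andP; split; lra.
  have H2 : is_derive t 1 (A \o (fun t => t + del)) (W (t + del)).
    rewrite -[W _]mulr1; apply: is_derive1_comp.
    have -> : (fun t : R => t + del) = (id : R -> R) + cst del by [].
    by apply: is_derive_eq; rewrite addr0.
  have -> : F = del^-1 *: ((A \o (fun t => t + del)) - A).
    by apply/funext => s; rewrite /F /= mulrC.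
  by apply: is_derive_eq; rewrite /GRing.scale /= mulrC.
have cF t : c - 1 < t < d + 1 -> {for t, continuous F}.
  move=> /dF[dFt _]; apply: differentiable_continuous; exact/derivable1_diffP.
have shiftC : continuous (fun t => (W (t + del) - W t) / del).
  move=> t; apply: cvgM; last exact: cvg_cst.
  apply: cvgB; last exact: cW.
  apply: continuous_comp; last exact: cW.
  by apply: cvgD; [exact: cvg_id|exact: cvg_cst].
rewrite (continuous_FTC2 (F := F) cd) //; first last.
- move=> t; rewrite in_itv /= => /andP[t1 t2].
  have [|_ E] := dF t; first by apply/andP; split; lra.
  by rewrite derive1E E.
- split=> [t||].
  + rewrite in_itv /= => /andP[t1 t2]; have [|//] := dF t; apply/andP; split; lra.
  + by apply: cvg_at_right_filter; apply: cF; apply/andP; split; lra.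
  + by apply: cvg_at_left_filter; apply: cF; apply/andP; split; lra.
- exact: continuous_subspaceT.
rewrite -EFinB lee_fin /F -mulrBl ler_pdivrMr //.
have mvt x : c <= x <= d -> exists2 y, x < y < x + del & A (x + del) - A x = W y * del.
  move=> /andP[cx xd]; have xx : x < x + del by rewrite ltrDl.
  have [||y] := @MVT _ A W x (x + del) xx.
  - move=> y; rewrite in_itv /= => /andP[y1 y2]; apply: HA; apply/andP; split; lra.
  - apply: derivable_within_continuous => y; rewrite in_itv /= => /andP[y1 y2].
    by have [] : is_derive y 1 A (W y) by apply: HA; apply/andP; split; lra.
  by rewrite in_itv /= => yx E; exists y => //; rewrite E addrC addKr.
have [|y1 /andP[y11 y12] E1] := mvt c; first by rewrite lexx ltW.
have [|y2 /andP[y21 y22] E2] := mvt d; first by rewrite lexx ltW.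
rewrite E1 E2 -mulrBl ler_wpM2r ?(ltW del0) //.
rewrite (Wd y2) ?(ltW y21) // lerD2l lerN2; apply: ndW; exact: ltW.
Qed.

(** The derivative of a nondecreasing function integrates to at most its increment. With [G] the lower limit of the
    quotients with increments [1 / n.+1], this is Fatou's lemma. *)
Lemma fatou_difference_quotient (W : R -> R) (c d : R) :
  c < d -> continuous W -> {homo W : x y / x <= y} -> (forall t, d <= t -> W t = W d) ->
  exists G : R -> \bar R, [/\ measurable_fun `[c, d] G,
    forall t, (0 <= G t)%E, (\int[mu]_(t in `[c, d]) G t <= (W d - W c)%:E)%E &
    forall t l, ((W (t + n.+1%:R^-1) - W t) / n.+1%:R^-1) @[n --> \oo] --> l -> G t = l%:E].
Proof.
move=> cd cW ndW Wd.
pose f (n : nat) t := ((W (t + n.+1%:R^-1) - W t) / n.+1%:R^-1)%:E.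
have f0 n t : (0 <= f n t)%E.
  rewrite lee_fin divr_ge0 // subr_ge0; apply: ndW; by rewrite lerDl.
have cf n : continuous (fun t : R => (W (t + n.+1%:R^-1) - W t) / n.+1%:R^-1).
  move=> t; apply: cvgM; last exact: cvg_cst.
  apply: cvgB; last exact: cW.
  apply: continuous_comp; last exact: cW.
  by apply: cvgD; [exact: cvg_id|exact: cvg_cst].
have mf n : measurable_fun `[c, d] (f n).
  apply/measurable_EFinP; apply: measurable_funTS.
  exact: continuous_measurable_fun.
exists (fun t => limn_einf (f^~ t)); split.
- have -> : (fun t => limn_einf (f^~ t)) = (fun t => - limn_esup (fun n => - f n t))%E.
    apply/funext => t; rewrite -limn_einfN; congr limn_einf; apply/funext => n.
    by change (f n t = - - f n t)%E; rewrite oppeK.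
  apply: measurableT_comp => //.
  apply: measurable_fun_limn_esup => n.
  exact: measurableT_comp.
- move=> t; rewrite limn_einf_lim; apply: lime_ge; first exact: is_cvg_einfs.
  by apply: nearW => n; apply: le_ereal_inf_tmp => _ [m _ <-].
- apply: le_trans (fatou _ _ _ _) _ => //.
  rewrite limn_einf_lim; apply: lime_le; first exact: is_cvg_einfs.
  apply: nearW => n; apply: (@le_trans _ _ (\int[mu]_(t in `[c, d]) f n t)%E).
    by apply: ereal_inf_lbound; exists n => /=.
  apply: integral_difference_quotient => //.
  by rewrite invr_gt0 ltr0n invf_le1 ?ler1n.
- move=> t l ql.
  have : (f n t @[n --> \oo] --> l%:E)%E by apply: cvg_EFin => //; exact: nearW.
  by move=> /cvg_limn_einf_sup[].
Qed.

End difference_quotients.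

Section signed_root.
Variable R : realType.
Implicit Types (s p q x : R).

(** An antiderivative of [|s|^(-1/2)]. *)
Definition sroot s : R := 2 * (Num.sqrt s - Num.sqrt (- s)).

Lemma sroot_continuous : continuous sroot.
Proof.
move=> s; apply: cvgM; first exact: cvg_cst.
apply: cvgB; first exact: sqrt_continuous.
by apply: continuous_comp; [exact: opp_continuous|exact: sqrt_continuous].
Qed.

Lemma sroot_ge0 s : 0 <= s -> sroot s = 2 * Num.sqrt s.
Proof. by move=> s0; rewrite /sroot [Num.sqrt (- s)]ler0_sqrtr ?subr0 // oppr_le0. Qed.

Lemma sroot_le0 s : s <= 0 -> sroot s = - (2 * Num.sqrt (- s)).
Proof. by move=> s0; rewrite /sroot ler0_sqrtr // sub0r mulrN. Qed.

Lemma sroot_nondecreasing : {homo sroot : p q / p <= q}.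
Proof.
move=> p q pq; rewrite ler_pM2l //; have := @ler_wsqrtr R p q pq.
have : Num.sqrt (- q) <= Num.sqrt (- p) by apply: ler_wsqrtr; rewrite lerN2.
lra.
Qed.

Lemma sqrtB p q : 0 <= q -> q <= p -> Num.sqrt p - Num.sqrt q <= Num.sqrt (p - q).
Proof.
move=> q0 qp; have := sqr_sqrtr q0; have := sqr_sqrtr (le_trans q0 qp).
have pq : 0 <= p - q by rewrite subr_ge0.
have := sqr_sqrtr pq; have := sqrtr_ge0 p; have := sqrtr_ge0 q; have := sqrtr_ge0 (p - q).
rewrite !expr2; nra.
Qed.

Lemma sroot_increment p q : q <= p -> sroot p - sroot q <= 4 * Num.sqrt (p - q).
Proof.
move=> qp; have s0 := sqrtr_ge0 (p - q).
have [p0|p0] := leP 0 p; have [q0|q0] := leP 0 q.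
- rewrite !sroot_ge0 //; have := sqrtB q0 qp; lra.
- rewrite sroot_ge0 // sroot_le0 ?(ltW q0) //.
  have : Num.sqrt p <= Num.sqrt (p - q) by apply: ler_wsqrtr; lra.
  have : Num.sqrt (- q) <= Num.sqrt (p - q) by apply: ler_wsqrtr; lra.
  lra.
- lra.
- rewrite (sroot_le0 (ltW p0)) (sroot_le0 (ltW q0)).
  have p'0 : 0 <= - p by lra. have p'q : - p <= - q by lra.
  have := sqrtB p'0 p'q; rewrite (_ : - q - - p = p - q); last by ring.
  lra.
Qed.

Lemma is_derive_sroot x : x != 0 -> is_derive x 1 sroot (Num.sqrt `|x|)^-1.
Proof.
move=> x0; have [xp|xn] : 0 < x \/ x < 0 by case: ltgtP x0 => //; auto.
  have H : is_derive x 1 (fun s : R => 2 * Num.sqrt s) (Num.sqrt `|x|)^-1.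
    have := is_derive1_sqrt xp => ?.
    apply: is_derive_eq; rewrite gtr0_norm // /GRing.scale /= invfM mulrA divff // mul1r //.
  apply: near_eq_is_derive H.
  near=> s; rewrite sroot_ge0 //; apply: ltW; near: s; exact: lt_nbhsr.
have H : is_derive x 1 (fun s : R => - (2 * Num.sqrt (- s))) (Num.sqrt `|x|)^-1.
  have xp : 0 < - x by rewrite oppr_gt0.
  have := is_derive1_sqrt xp => ?.
  have ? : is_derive x 1 (fun s : R => Num.sqrt (- s)) ((2 * Num.sqrt (- x))^-1 * -1).
    exact: (is_derive1_comp (f := Num.sqrt) (g := -%R)).
  apply: is_derive_eq; rewrite ltr0_norm // /GRing.scale /= mulrN1 mulrN opprK invfM mulrA divff // mul1r //.
apply: near_eq_is_derive H.
by near=> s; rewrite sroot_le0 //; apply: ltW; near: s; exact: lt_nbhsl.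
Unshelve. all: by end_near. Qed.

End signed_root.


(** * Arc length near the boundary *)

Section boundary_curve.
Variable R : realType.
Variables (D : set 'rV[R]_2) (gam : R) (Phi : R[i] -> R[i]) (a : nat -> R[i]).
Hypothesis Phi_ext : exterior_conformal_map D gam Phi a.
Hypothesis oD : open D.
Hypothesis lipD : lipschitz_boundary D.
Implicit Types (w z p u : R[i]) (s t : R).
Local Notation mu := (@lebesgue_measure R).
Let g0 : 0 < gam.
Proof. exact: ecm_gam_gt0 Phi_ext. Qed.

Definition bcurve (g : R) (P : R[i] -> R[i]) t : R[i] := P (g%:C * expi t).
Local Notation b := (bcurve gam Phi).

Lemma bdptE t : bdpt gam Phi t = ofC (b t). Proof. by []. Qed.

Lemma expi_continuous t e : 0 < e -> exists2 d, 0 < d &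
  forall s, `|s - t| < d -> cabs (expi s - expi t) < e.
Proof.
move=> e0; have e20 : 0 < e / 2 by rewrite divr_gt0.
have /cvgrPdist_lt/(_ _ e20)/nbhs_ballP[d1 /= d10 H1] := @continuous_cos R t.
have /cvgrPdist_lt/(_ _ e20)/nbhs_ballP[d2 /= d20 H2] := @continuous_sin R t.
exists (Num.min d1 d2) => [|s]; first by rewrite lt_min d10.
rewrite lt_min distrC => /andP[/H1 c1 /H2 c2]; rewrite distrC in c1; rewrite distrC in c2.
by apply: le_lt_trans (cabs_le _) _; rewrite ReD ImD ReN ImN /=; lra.
Qed.

Lemma bcurve_continuous t e : 0 < e -> exists2 d, 0 < d &
  forall s, `|s - t| < d -> cabs (b s - b t) < e.
Proof.
move=> e0; have cg s : cabs (gam%:C * expi s) = gam by rewrite cabs_circle // ltW.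
have [|d d0 Hd] := @Phi_continuous _ _ _ _ _ Phi_ext (gam%:C * expi t) _ e e0; first by rewrite cg.
have dg0 : 0 < d / gam by rewrite divr_gt0.
have [d' d'0 Hd'] := expi_continuous t dg0.
exists d' => // s /Hd' st; apply: Hd; first by rewrite cg.
by rewrite -mulrBr cabsM cabs_real gtr0_norm // mulrC -ltr_pdivlMr.
Qed.

(** The abscissa along the axis of direction [conjc u]. *)
Definition proj u t : R := complex.Re (b t * u).

Lemma proj_continuous u : cabs u = 1 -> continuous (proj u : R -> R).
Proof.
move=> u1 t; apply/cvgrPdist_lt => e e0; have [d d0 Hd] := bcurve_continuous t e0.
apply/nbhs_ballP; exists d => // s; rewrite /ball /= distrC => /Hd H.
rewrite distrC /proj -ReN -ReD -mulNr -mulrDl.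
by apply: le_lt_trans (cabs_Re _) _; rewrite cabsM u1 mulr1.
Qed.

(** A boundary arc in a chart is controlled by its abscissa, which is therefore injective along the curve, hence
    monotone on short intervals. *)
Lemma monotone_chart t0 : exists2 eta, 0 < eta & forall c d, t0 - eta < c -> c < d -> d < t0 + eta ->
  exists u k, [/\ cabs u = 1, 0 <= k,
    forall s t, c <= s -> s < t -> t <= d -> proj u s < proj u t &
    forall s t, c <= s <= d -> c <= t <= d -> cabs (b t - b s) <= (1 + k) * `|proj u t - proj u s|].
Proof.
have bb t : bdry D (ofC (b t)) by apply: (Phi_bdry Phi_ext); rewrite cabs_circle // ltW.
have [r [u [psi [k [r0 u1 k0 lk ch]]]]] := lipschitz_boundary_chart oD lipD (bb t0).
have [d d0 Hd] := bcurve_continuous t0 r0.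
have pi0 : 0 < pi :> R := pi_gt0 R.
exists (Num.min d pi) => [|c e]; first by rewrite lt_min d0.
have m1 : Num.min d pi <= d by rewrite ge_min lexx.
have m2 : Num.min d pi <= pi by rewrite ge_min lexx orbT.
move=> cl ce el.
have yE t : c <= t <= e -> b t * conjc u = proj (conjc u) t +i* psi (proj (conjc u) t).
  move=> /andP[ct te]; have [|_ H] := ch (b t).
    by apply: Hd; rewrite ltr_norml; apply/andP; split; lra.
  by rewrite [LHS]complexE (H (bb t)).
have lip s t : c <= s <= e -> c <= t <= e ->
    cabs (b t - b s) <= (1 + k) * `|proj (conjc u) t - proj (conjc u) s|.
  move=> sI tI; have -> : cabs (b t - b s) = cabs (b t * conjc u - b s * conjc u).
    by rewrite -mulrBl cabsM cabs_conj u1 mulr1.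
  apply: le_trans (cabs_le _) _; rewrite !yE // !ReD !ImD !ReN !ImN /=.
  have := lk (proj (conjc u) t) (proj (conjc u) s); lra.
have cu1 : cabs (conjc u) = 1 by rewrite cabs_conj.
have inj : {in `[c, e] &, injective (proj (conjc u))}.
  move=> s t; rewrite !in_itv /= => sI tI E; apply/eqP.
  have b0 : cabs (b t - b s) = 0.
    by apply/eqP; rewrite eq_le cabs_ge0 andbT; apply: le_trans (lip s t sI tI) _; rewrite E subrr normr0 mulr0.
  have {}b0 : b t = b s by apply/eqP; rewrite -subr_eq0 -cabs_eq0 b0.
  case/andP: sI => ? ?; case/andP: tI => ? ?.
  case: (ltgtP s t) => // st.
    have := @Phi_circle_inj _ _ _ _ _ Phi_ext oD lipD s t.
    rewrite -/(b s) -/(b t) b0 eqxx => H; suff : false by []; apply: H.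
    by apply/andP; split; lra.
  have := @Phi_circle_inj _ _ _ _ _ Phi_ext oD lipD t s.
  rewrite -/(b s) -/(b t) b0 eqxx => H; suff : false by []; apply: H.
  by apply/andP; split; lra.
have [mono|mono] := itv_continuous_inj_mono (continuous_subspaceT (proj_continuous cu1)) inj.
  exists (conjc u), k; split => // s t cs st te.
  by apply: mono => //; rewrite in_itv /=; apply/andP; split; lra.
have pN t : proj (- conjc u) t = - proj (conjc u) t by rewrite /proj mulrN ReN.
exists (- conjc u), k; split => //; first by rewrite cabsN.
  move=> s t cs st te; rewrite !pN ltrN2.
  by apply: mono => //; rewrite in_itv /=; apply/andP; split; lra.
by move=> s t sI tI; rewrite !pN -opprD normrN; exact: lip.
Qed.

(** Compactness of a segment, for properties of intervals: the supremum of the right ends [t] for which [P x t]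
    holds can only be [y]. *)
Lemma interval_induction (P : R -> R -> Prop) (x y : R) : x < y ->
  (forall c d e, x <= c -> c < d -> d < e -> e <= y -> P c d -> P d e -> P c e) ->
  (forall t0, exists2 eta, 0 < eta & forall c d, t0 - eta < c -> c < d -> d < t0 + eta -> P c d) ->
  P x y.
Proof.
move=> xy glue loc; pose A := [set t | x < t <= y /\ P x t].
have [eta0 eta00 H0] := loc x.
pose t1 := Num.min y (x + eta0 / 2).
have t1x : x < t1 by rewrite lt_min xy; lra.
have t1y : t1 <= y by rewrite ge_min lexx.
have t1e : t1 <= x + eta0 / 2 by rewrite ge_min lexx orbT.
have At1 : A t1 by split; [rewrite t1x|apply: H0; lra].
have hA : has_sup A by split; [exists t1|exists y => t [/andP[]]].
pose S := sup A.
have xS : t1 <= S by apply: ub_le_sup => //; exact: hA.2.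
have Sy : S <= y by apply: ge_sup; [exists t1|move=> t [/andP[]]].
have [eta eta_0 H] := loc S.
have [t [/andP[xt ty] Pt] St] : exists2 t, A t & S - eta < t.
  by apply: sup_adherent.
have tS : t <= S by apply: ub_le_sup => //; [exact: hA.2|split => //; rewrite xt].
pose v := Num.min y (S + eta / 2).
have vy : v <= y by rewrite ge_min lexx.
have ve : v <= S + eta / 2 by rewrite ge_min lexx orbT.
have Sv : S <= v by rewrite le_min Sy lerDl; lra.
have Pv : P x v.
  have [tv|vt] := ltP t v.
    by apply: (glue x t v) => //; apply: H; lra.
  by have -> : v = t by apply/le_anti; rewrite vt (le_trans tS).
have : v <= S by apply: ub_le_sup => //; [exact: hA.2|split => //; rewrite vy andbT; lra].
rewrite /v; have [yS|yS] := leP y (S + eta / 2); last lra.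
by move=> _; move: Pv; rewrite /v min_l.
Qed.

End boundary_curve.

Section majorants.
Variable R : realType.
Variables (D : set 'rV[R]_2) (gam : R) (Phi : R[i] -> R[i]) (a : nat -> R[i]).
Hypothesis Phi_ext : exterior_conformal_map D gam Phi a.
Hypothesis oD : open D.
Hypothesis lipD : lipschitz_boundary D.
Implicit Types (w z p u : R[i]) (s t : R).
Local Notation mu := (@lebesgue_measure R).
Local Notation b := (bcurve gam Phi).
Local Notation Proj := (proj gam Phi).
Local Notation h := (scale_factor gam Phi).

(** In a chart the increments of the curve are bounded by those of a monotone function, a multiple of the
    abscissa. *)
Lemma bcurve_bounded_variation : exists V : R -> R, forall s t, 0 <= s -> s <= t -> t <= 2 * pi ->
  cabs (b t - b s) <= V t - V s.
Proof.
apply: (@interval_induction R (fun c d => exists V : R -> R, forall s t, c <= s -> s <= t -> t <= d ->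
  cabs (b t - b s) <= V t - V s)).
- by rewrite mulr_gt0 // pi_gt0.
- move=> c d e _ cd de _ [V1 H1] [V2 H2].
  exists (fun t => if t <= d then V1 t else V1 d + (V2 t - V2 d)) => s t cs st te.
  have [td|td] := leP t d; first by rewrite (le_trans st td) H1.
  have [sd|sd] := leP s d; last by have := H2 s t (ltW sd) st te; lra.
  have := H1 s d cs sd (lexx _); have := H2 d t (lexx _) (ltW td) te.
  have := cabsBD (b d) (b t) (b s); lra.
move=> t0; have [eta eta0 H] := monotone_chart Phi_ext oD lipD t0.
exists eta => // c d tc cd dt; have [u [k [u1 k0 mono lip]]] := H c d tc cd dt.
exists (fun t => (1 + k) * Proj u t) => s t cs st td.
rewrite -mulrBr; apply: le_trans (lip s t _ _) _; [by apply/andP; split; lra..|].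
rewrite ger0_norm // subr_ge0; move: st; rewrite le_eqVlt => /orP[/eqP->//|st].
exact/ltW/mono.
Qed.

Lemma is_derive_seq (f : R -> R) t (l : R) : is_derive t 1 f l ->
  ((f (t + n.+1%:R^-1) - f t) / n.+1%:R^-1) @[n --> \oo] --> l.
Proof.
move=> [H <-].
have n0 (n : nat) : n.+1%:R^-1 != 0 :> R by rewrite invr_eq0 pnatr_eq0.
have := (cvgr_dnbhsP (fun h : R => h^-1 *: (f (h *: 1 + t) - f t)) 0 ('D_1 f t)).1 H
  (fun n => n.+1%:R^-1) (conj n0 (@cvg_harmonic R)).
apply: cvg_trans; apply: near_eq_cvg; apply: nearW => n /=.
by rewrite /GRing.scale /= mulr1 (addrC t) mulrC.
Qed.

(** Where the curve has no derivative, the derivative is by convention the default vector, which is 0. *)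
Lemma derivable_scale t : h t != 0 -> derivable (bdpt gam Phi) t 1.
Proof.
move=> h0; apply: contrapT => nd; move/eqP: h0; apply.
rewrite /scale_factor /tangent /derive (dvgP nd).
have -> : (point : 'rV[R]_2) = 0 by apply/matrixP => i j; rewrite !mxE.
by rewrite enormE /toC !mxE cabs_def /= expr0n addr0 sqrtr0.
Qed.

Lemma is_derive_bdpt t k : derivable (bdpt gam Phi) t 1 ->
  is_derive t 1 (fun s => bdpt gam Phi s 0 k) (tangent gam Phi t 0 k).
Proof.
move=> dt; have dk : derivable (fun s => bdpt gam Phi s 0 k) t 1 by have /derivable_mxP := dt; apply.
by apply: DeriveDef => //; rewrite /tangent derive_mx // mxE.
Qed.

Lemma is_derive_proj u t : derivable (bdpt gam Phi) t 1 ->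
  is_derive t 1 (Proj u) (complex.Re (toC (tangent gam Phi t) * u)).
Proof.
move=> dt; have d1 := is_derive_bdpt i1 dt; have d2 := is_derive_bdpt i2 dt.
have -> : Proj u = (fun s => complex.Re u * bdpt gam Phi s 0 i1 - complex.Im u * bdpt gam Phi s 0 i2).
  by apply/funext => s; rewrite /proj ReM !mxE /= mulrC [X in _ - X]mulrC.
apply: is_derive_eq; rewrite ReM /toC /= /GRing.scale /=; ring.
Qed.

Lemma harmonic_gt0 n : 0 < n.+1%:R^-1 :> R. Proof. by rewrite invr_gt0. Qed.

(** The inequality of the chart, divided by the increment. *)
Lemma scale_le_proj u k t d : t < d -> 0 <= k ->
  (forall s, t <= s <= d -> cabs (b s - b t) <= (1 + k) * `|Proj u s - Proj u t|) ->
  derivable (bdpt gam Phi) t 1 ->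
  h t <= (1 + k) * `|complex.Re (toC (tangent gam Phi t) * u)|.
Proof.
move=> td k0 lip dt; set v := tangent gam Phi t.
have c1 := is_derive_seq (is_derive_bdpt i1 dt); have c2 := is_derive_seq (is_derive_bdpt i2 dt).
have cq := is_derive_seq (is_derive_proj u dt).
rewrite -/v in c1 c2 cq.
have L : (cabs (b (t + n.+1%:R^-1) - b t) / n.+1%:R^-1) @[n --> \oo] --> h t.
  have -> : h t = Num.sqrt (v 0 i1 ^+ 2 + v 0 i2 ^+ 2).
    by rewrite /scale_factor enormE cabs_def.
  have S : (Num.sqrt (((bdpt gam Phi (t + n.+1%:R^-1) 0 i1 - bdpt gam Phi t 0 i1) / n.+1%:R^-1) ^+ 2 +
     ((bdpt gam Phi (t + n.+1%:R^-1) 0 i2 - bdpt gam Phi t 0 i2) / n.+1%:R^-1) ^+ 2)) @[n --> \oo] -->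
     Num.sqrt (v 0 i1 ^+ 2 + v 0 i2 ^+ 2).
    apply: continuous_cvg; first exact: sqrt_continuous.
    by apply: cvgD; rewrite !expr2; apply: cvgM.
  apply: cvg_trans S; apply: near_eq_cvg; apply: nearW => n /=.
  rewrite cabs_def ReD ImD ReN ImN !mxE /= !exprMn -mulrDl sqrtrM ?addr_ge0 ?sqr_ge0 //.
  by rewrite sqrtr_sqr ger0_norm // invr_ge0 ltW // harmonic_gt0.
have Q : ((1 + k) * `|(Proj u (t + n.+1%:R^-1) - Proj u t) / n.+1%:R^-1|) @[n --> \oo] -->
    (1 + k) * `|complex.Re (toC v * u)|.
  by apply: cvgM; [exact: cvg_cst|exact: cvg_norm].
apply: (ler_cvg_to L Q).
have dt0 : 0 < d - t by rewrite subr_gt0.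
have [N HN] := harmonic_small dt0.
exists N => // n /= Nn; have := HN n Nn; have := harmonic_gt0 n; move: (n.+1%:R^-1 : R) => e n0 nd.
rewrite normrM mulrA [`|e^-1|]ger0_norm ?invr_ge0 ?(ltW n0) // ler_pM2r ?invr_gt0 //.
by apply: lip; apply/andP; split; lra.
Qed.

(** In a chart the weighted arc length is dominated by the derivative of [(1 + k) * (x + sroot (x - xz))], where
    [x] and [xz] are the abscissae of the moving point and of [z]. This function is monotone along the curve and
    its increment is bounded independently of [z]. The exceptional set consists of the end of the interval and of
    the parameter where [x = xz]. *)
Lemma majorant_local t0 : exists2 eta, 0 < eta & forall c d, t0 - eta < c -> c < d -> d < t0 + eta ->
  exists2 C, 0 <= C & forall z, exterior D (ofC z) -> exists G : R -> \bar R, exists S : seq R,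
    [/\ measurable_fun setT G, forall t, (0 <= G t)%E, (\int[mu]_t G t <= C%:E)%E &
     forall t, c <= t <= d -> t \notin S -> (((1 + (Num.sqrt (cabs (b t - z)))^-1) * h t)%:E <= G t)%E].
Proof.
have [eta eta0 H] := monotone_chart Phi_ext oD lipD t0.
exists eta => // c d tc cd dt; have [u [k [u1 k0 mono lip]]] := H c d tc cd dt.
have monow s t : c <= s -> s <= t -> t <= d -> Proj u s <= Proj u t.
  by move=> cs; rewrite le_eqVlt => /orP[/eqP->//|st] td; apply/ltW/mono.
pose L := Proj u d - Proj u c.
have L0 : 0 <= L by rewrite subr_ge0; apply: monow => //; exact: ltW.
have k10 : 0 <= 1 + k by lra.
exists ((1 + k) * (L + 4 * Num.sqrt L)) => [|z ez].
  by rewrite mulr_ge0 // addr_ge0 // mulr_ge0 // sqrtr_ge0.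
pose xz := complex.Re (z * u).
pose Wo s := (1 + k) * (Proj u s + sroot (Proj u s - xz)).
pose cl s := Num.max c (Num.min s d).
have clI s : c <= cl s <= d by rewrite /cl le_max lexx /= ge_max (ltW cd) ge_min lexx orbT.
have clid s : c <= s <= d -> cl s = s by move=> /andP[cs sd]; rewrite /cl min_l // max_r.
have clmono s t : s <= t -> cl s <= cl t.
  move=> st; rewrite /cl ge_max le_max lexx /= le_max.
  by apply/orP; right; rewrite le_min !ge_min st lexx orbT.
have Womono s t : c <= s -> s <= t -> t <= d -> Wo s <= Wo t.
  move=> cs st td; have := monow s t cs st td => H1.
  rewrite ler_wpM2l // lerD //; apply: sroot_nondecreasing; by rewrite lerD2r.
pose W s := Wo (cl s).
have cWo : continuous Wo.
  have cp := proj_continuous Phi_ext u1.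
  move=> s; apply: cvgM; first exact: cvg_cst.
  apply: cvgD; first exact: cp.
  apply: continuous_cvg; first exact: sroot_continuous.
  by apply: cvgB; [exact: cp|exact: cvg_cst].
have ccl : continuous cl.
  move=> s; apply: (@continuous_max _ _ (fun _ => c) (fun s => Num.min s d)); first exact: cvg_cst.
  by apply: (@continuous_min _ _ (fun s => s) (fun _ => d)); [exact: cvg_id|exact: cvg_cst].
have cW : continuous W by move=> s; exact: (continuous_comp (ccl s) (cWo (cl s))).
have nW : {homo W : x y / x <= y}.
  move=> s t st; have /andP[? ?] := clI s; have /andP[? ?] := clI t.
  by apply: Womono => //; exact: clmono.
have Wd t : d <= t -> W t = W d.
  by move=> dt'; rewrite /W /cl !min_r.
have [G [mG G0 iG GE]] := fatou_difference_quotient cd cW nW Wd.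
pose tz := xget 0 [set t | c <= t <= d /\ Proj u t = xz].
exists (G \_ `[c, d]), [:: d; tz]; split.
- exact/(measurable_restrictT _ _).1.
- by move=> t; rewrite patchE; case: ifP.
- rewrite -integral_mkcond; apply: le_trans iG _; rewrite lee_fin.
  have := Womono c d (lexx _) (ltW cd) (lexx _).
  rewrite /W !clid ?lexx ?(ltW cd) //.
  rewrite /Wo -mulrBr => _; rewrite ler_wpM2l //.
  have Hs : sroot (Proj u d - xz) - sroot (Proj u c - xz) <= 4 * Num.sqrt L.
    have -> : L = (Proj u d - xz) - (Proj u c - xz) by rewrite /L; ring.
    apply: sroot_increment; rewrite lerD2r; exact: monow (ltW cd) _.
  rewrite /L; lra.
move=> t tI; rewrite !inE negb_or => /andP[td tz'].
have {}td : t < d by rewrite lt_neqAle td; case/andP: tI.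
have ct : c <= t by case/andP: tI.
rewrite patchE mem_set; last by rewrite /= in_itv.
have [h0|h0] := eqVneq (h t) 0; first by rewrite h0 mulr0.
have dt' := derivable_scale h0.
have pne : Proj u t - xz != 0.
  apply: contra tz'; rewrite subr_eq0 => /eqP E; rewrite /tz.
  case: xgetP => [y _ [/andP[cy yd] Ey]|/(_ t)]; last by case; split.
  apply/eqP; have [yt|ty|//] := ltgtP t y.
    by have := mono t y ct yt yd; rewrite E Ey ltxx.
  by have := mono y t cy ty (ltW td); rewrite E Ey ltxx.
set q := complex.Re (toC (tangent gam Phi t) * u).
have dq : is_derive t 1 (Proj u) q := is_derive_proj u dt'.
have hq : h t <= (1 + k) * `|q|.
  apply: (@scale_le_proj u k t d) => // s /andP[ts sd].
  by apply: lip; apply/andP; split; lra.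
have dt0 : 0 < d - t by rewrite subr_gt0.
have [N HN] := harmonic_small dt0.
have q0 : 0 <= q.
  apply: (ler_cvg_to (cvg_cst 0) (is_derive_seq dq)).
  exists N => // n /= Nn; have := HN n Nn; have := harmonic_gt0 n; move: (n.+1%:R^-1 : R) => e n0 nd.
  rewrite divr_ge0 ?(ltW n0) // subr_ge0; apply: monow; lra.
set sr := (Num.sqrt `|Proj u t - xz|)^-1.
have dWo : is_derive t 1 Wo ((1 + k) * (q + sr * q)).
  have ds : is_derive t 1 (fun s => Proj u s - xz) q by apply: is_derive_eq; rewrite subr0.
  have dss : is_derive t 1 (@sroot R \o (fun s => Proj u s - xz)) (sr * q).
    by apply: is_derive1_comp; exact: is_derive_sroot.
  have -> : Wo = (1 + k) *: (Proj u + (@sroot R \o (fun s => Proj u s - xz))) by apply/funext.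
  by apply: is_derive_eq.
have -> : G t = ((1 + k) * (q + sr * q))%:E.
  apply: GE; apply: cvg_trans (is_derive_seq dWo); apply: near_eq_cvg.
  exists N => // n /= Nn; have := HN n Nn; have := harmonic_gt0 n; move: (n.+1%:R^-1 : R) => e n0 nd.
  by rewrite /W !clid //; apply/andP; split; lra.
rewrite lee_fin; rewrite ger0_norm // in hq.
have r1 : `|Proj u t - xz| <= cabs (b t - z).
  rewrite /proj /xz -ReN -ReD -mulNr -mulrDl; apply: le_trans (cabs_Re _) _.
  by rewrite cabsM u1 mulr1.
have sr1 : (Num.sqrt (cabs (b t - z)))^-1 <= sr.
  rewrite lef_pV2 ?posrE ?sqrtr_gt0 ?normr_gt0 //; first exact: ler_wsqrtr.
  by apply: lt_le_trans r1; rewrite normr_gt0.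
have s0 : 0 <= (Num.sqrt (cabs (b t - z)))^-1 by rewrite invr_ge0 sqrtr_ge0.
have hge0 : 0 <= h t by rewrite sqrtr_ge0.
have -> : (1 + k) * (q + sr * q) = (1 + sr) * ((1 + k) * q) by ring.
by apply: ler_pM => //; rewrite ?lerD2l ?addr_ge0.
Qed.

(** The local bounds add up along the curve. The weight [r^(-1/2)] dominates the logarithmic singularity of the
    Kelvin matrix, with a bound that persists as [z] approaches the boundary. *)
Lemma majorant : exists2 C, 0 <= C & forall z, exterior D (ofC z) -> exists G : R -> \bar R, exists S : seq R,
    [/\ measurable_fun setT G, forall t, (0 <= G t)%E, (\int[mu]_t G t <= C%:E)%E &
     forall t, 0 <= t <= 2 * pi -> t \notin S -> (((1 + (Num.sqrt (cabs (b t - z)))^-1) * h t)%:E <= G t)%E].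
Proof.
apply: (@interval_induction R (fun c d => exists2 C, 0 <= C & forall z, exterior D (ofC z) ->
  exists G : R -> \bar R, exists S : seq R,
    [/\ measurable_fun setT G, forall t, (0 <= G t)%E, (\int[mu]_t G t <= C%:E)%E &
     forall t, c <= t <= d -> t \notin S -> (((1 + (Num.sqrt (cabs (b t - z)))^-1) * h t)%:E <= G t)%E])).
- by rewrite mulr_gt0 // pi_gt0.
- move=> c d e _ cd de _ [C1 C10 H1] [C2 C20 H2].
  exists (C1 + C2) => [|z ez]; first by rewrite addr_ge0.
  have [G1 [S1 [m1 p1 i1 b1]]] := H1 z ez; have [G2 [S2 [m2 p2 i2 b2]]] := H2 z ez.
  exists (fun t => G1 t + G2 t)%E, (S1 ++ S2); split.
  + exact: emeasurable_funD.
  + by move=> t; rewrite adde_ge0.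
  + by rewrite ge0_integralD // EFinD; apply: leeD.
  move=> t /andP[ct te]; rewrite mem_cat negb_or => /andP[n1 n2].
  have [td|dt] := leP t d.
    by apply: le_trans (b1 t _ n1) _; [rewrite ct|rewrite leeDl].
  by apply: le_trans (b2 t _ n2) _; [rewrite (ltW dt)|rewrite leeDr].
exact: majorant_local.
Qed.

End majorants.


(** * Positive semidefinite kernels *)

Lemma cvg_bigsum (R : realType) (J : Type) (r : seq J) (T : Type) (F : set_system T) (FF : Filter F)
    (f : J -> T -> R) (l : J -> R) :
  (forall j, f j x @[x --> F] --> l j) -> (\sum_(j <- r) f j x) @[x --> F] --> \sum_(j <- r) l j.
Proof.
move=> H; elim: r => [|j r IH].
  rewrite big_nil (_ : (fun x => _) = fun=> 0); first exact: cvg_cst.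
  by apply/funext => x; rewrite big_nil.
rewrite big_cons (_ : (fun x => _) = (fun x => f j x + \sum_(j <- r) f j x)); first exact: cvgD.
by apply/funext => x; rewrite big_cons.
Qed.

Section psd_kernels.
Variables (R : realType) (I : finType).
Implicit Types (X Y c u w : I -> R) (s : R).

(** One factor of the inner product is absorbed in the coefficients, separately for each coordinate. *)
Lemma dot_power_psd k X Y c : 0 <= \sum_i \sum_j c i * c j * (X i * X j + Y i * Y j) ^+ k.
Proof.
elim: k c => [|k IH] c.
  have -> : \sum_i \sum_j c i * c j * (X i * X j + Y i * Y j) ^+ 0 = (\sum_i c i) ^+ 2.
    rewrite expr2 big_distrl /=; apply: eq_bigr => i _; rewrite big_distrr /=.
    by apply: eq_bigr => j _; rewrite expr0 mulr1.
  exact: sqr_ge0.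
have -> : \sum_i \sum_j c i * c j * (X i * X j + Y i * Y j) ^+ k.+1 =
    \sum_i \sum_j (c i * X i) * (c j * X j) * (X i * X j + Y i * Y j) ^+ k +
    \sum_i \sum_j (c i * Y i) * (c j * Y j) * (X i * X j + Y i * Y j) ^+ k.
  rewrite -big_split; apply: eq_bigr => i _; rewrite -big_split; apply: eq_bigr => j _ /=.
  by rewrite exprS; ring.
by apply: addr_ge0; exact: IH.
Qed.

(** A power series in the inner product with nonnegative coefficients. *)
Lemma exp_dot_psd s X Y c : 0 <= s ->
  0 <= \sum_i \sum_j c i * c j * expR (s * (X i * X j + Y i * Y j)).
Proof.
move=> s0.
have L : (fun n => \sum_i \sum_j c i * c j * series (exp_coeff (s * (X i * X j + Y i * Y j))) n) @ \oo -->
   \sum_i \sum_j c i * c j * expR (s * (X i * X j + Y i * Y j)).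
  apply: cvg_bigsum => i; apply: cvg_bigsum => j; apply: cvgM; first exact: cvg_cst.
  exact: is_cvg_series_exp_coeff.
rewrite -(cvg_lim (@Rhausdorff R) L); apply: limr_ge; first by apply/cvg_ex; eexists; exact: L.
apply: nearW => n.
have -> : \sum_i \sum_j c i * c j * series (exp_coeff (s * (X i * X j + Y i * Y j))) n =
    \sum_(0 <= k < n) s ^+ k / k`!%:R * \sum_i \sum_j c i * c j * (X i * X j + Y i * Y j) ^+ k.
  under [RHS]eq_bigr do rewrite mulr_sumr.
  rewrite [RHS]exchange_big /=; apply: eq_bigr => i _.
  under [RHS]eq_bigr do rewrite mulr_sumr.
  rewrite [RHS]exchange_big /=; apply: eq_bigr => j _.
  rewrite /series /= mulr_sumr; apply: eq_bigr => k _.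
  by rewrite /exp_coeff /= exprMn; ring.
apply: sumr_ge0 => k _; apply: mulr_ge0; last exact: dot_power_psd.
by rewrite divr_ge0 ?exprn_ge0.
Qed.

(** Expanding the square reduces the Gaussian to [exp_dot_psd], with new coefficients. *)
Lemma gauss_psd s X Y c : 0 <= s ->
  0 <= \sum_i \sum_j c i * c j * expR (- s * ((X i - X j) ^+ 2 + (Y i - Y j) ^+ 2)).
Proof.
move=> s0; have s20 : 0 <= 2 * s by rewrite mulr_ge0.
have := exp_dot_psd X Y (fun i => c i * expR (- s * (X i ^+ 2 + Y i ^+ 2))) s20.
congr (_ <= _); apply: eq_bigr => i _; apply: eq_bigr => j _.
rewrite (_ : - s * ((X i - X j) ^+ 2 + (Y i - Y j) ^+ 2) = - s * (X i ^+ 2 + Y i ^+ 2) +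
  - s * (X j ^+ 2 + Y j ^+ 2) + 2 * s * (X i * X j + Y i * Y j)); last by ring.
rewrite !expRD; ring.
Qed.

Lemma expR_taylor2 (y : R) : `|y| <= 1 / 2 -> `|expR y - 1 - y - y ^+ 2 / 2| <= 2 * `|y| ^+ 3.
Proof.
have first (x : R) : `|x| <= 1 / 2 -> `|expR x - 1 - x| <= 2 * x ^+ 2.
  rewrite ler_norml => /andP[x1 x2].
  have lo := expR_ge1Dx x.
  have := expR_ge1Dx (- x); rewrite expRN => hi.
  have e0 := expR_gt0 x.
  have {}hi : expR x * (1 - x) <= 1 by rewrite -ler_pdivlMl // mulr1.
  rewrite ger0_norm; last lra.
  nra.
move=> y12.
pose f x : R := expR x - 1 - x - x ^+ 2 / 2.
have df (x : R) : is_derive x 1 f (expR x - 1 - x).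
  apply: is_derive_eq; rewrite /GRing.scale /= ?expr1 ?scale0r; by field.
have cf (x z : R) : {within `[x, z], continuous f}.
  by apply: derivable_within_continuous => t _; have [] := df t.
have cube (q t x : R) : 0 <= t -> t <= x -> q <= 2 * t ^+ 2 -> q * x <= 2 * x ^+ 3.
  move=> t0 tx qt; rewrite exprSr mulrA; apply: ler_wpM2r; first lra.
  by apply: le_trans qt _; rewrite ler_pM2l // lerXn2r // nnegrE //; lra.
have f0 : f 0 = 0 by rewrite /f expR0; ring.
rewrite -/(f y); have [y0|y0|->] := ltgtP y 0; last by rewrite f0 normr0 mulr_ge0.
- have [t] := MVT y0 (fun t _ => df t) (cf y 0).
  rewrite in_itv /= f0 !sub0r => /andP[yt t0] E.
  have -> : f y = (expR t - 1 - t) * y by move: E; lra.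
  rewrite normrM; move: y12; rewrite [`|y|]ltr0_norm // => y12.
  apply: (cube _ (- t)); [lra|lra|]; rewrite sqrrN; apply: first.
  by rewrite ler_norml; apply/andP; split; lra.
have [t] := MVT y0 (fun t _ => df t) (cf 0 y).
rewrite in_itv /= f0 !subr0 => /andP[t0 ty] E.
rewrite E normrM; move: y12; rewrite [`|y|]gtr0_norm // => y12.
apply: (cube _ t); [lra|lra|]; apply: first.
by rewrite ler_norml; apply/andP; split; lra.
Qed.

End psd_kernels.

Section vector_psd.
Variables (R : realType).
Implicit Types (s tau : R).

Let eps (n : nat) : R := n.+1%:R^-1.

Lemma expR_second_order (a b : R) :
  ((expR (a * eps n + b * eps n ^+ 2) - 1 - a * eps n) / eps n ^+ 2) @[n --> \oo] --> b + a ^+ 2 / 2.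
Proof.
have e0 n : 0 < eps n by rewrite invr_gt0.
have ec : eps @ \oo --> (0 : R) by exact: cvg_harmonic.
pose y n := a * eps n + b * eps n ^+ 2.
pose rem n := (expR (y n) - 1 - y n - y n ^+ 2 / 2) / eps n ^+ 2.
have -> : (fun n => (expR (a * eps n + b * eps n ^+ 2) - 1 - a * eps n) / eps n ^+ 2) =
    (fun n => b + (a + b * eps n) ^+ 2 / 2 + rem n).
  by apply/funext => n; rewrite /rem /y; field; rewrite gt_eqF.
have lin : (a + b * eps n) @[n --> \oo] --> a.
  rewrite -[X in _ --> X]addr0 -(mulr0 b); apply: cvgD; first exact: cvg_cst.
  by apply: cvgM; [exact: cvg_cst|exact: ec].
rewrite -[X in _ --> X]addr0; apply: cvgD.
  apply: cvgD; first exact: cvg_cst.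
  by apply: cvgM; [rewrite !expr2; exact: cvgM|exact: cvg_cst].
have big : (2 * `|a + b * eps n| ^+ 3 * eps n) @[n --> \oo] --> 0.
  rewrite -[X in _ --> X](mulr0 (2 * `|a| ^+ 3)); apply: cvgM; last exact: ec.
  apply: cvgM; first exact: cvg_cst.
  apply: (@continuous_cvg _ _ _ _ _ _ (fun x : R => x ^+ 3)); first exact: exprn_continuous.
  exact: cvg_norm.
have yc : `|y n| @[n --> \oo] --> (0 : R).
  rewrite -(normr0 R); apply: cvg_norm; rewrite -[X in _ --> X](mulr0 a).
  have -> : y = (fun n => (a + b * eps n) * eps n) by apply/funext => n; rewrite /y; ring.
  by apply: cvgM; [exact: lin|exact: ec].
have small : \forall n \near \oo, `|rem n| <= 2 * `|a + b * eps n| ^+ 3 * eps n.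
  have h0 : (0 : R) < 1 / 2 by [].
  have /cvgrPdist_lt/(_ _ h0) := yc; apply: filterS => n; rewrite sub0r normrN normr_id => yn.
  rewrite /rem normrM [`|_^-1|]gtr0_norm ?invr_gt0 ?exprn_gt0 // ler_pdivrMr ?exprn_gt0 //.
  apply: le_trans (expR_taylor2 (ltW yn)) _.
  have -> : y n = (a + b * eps n) * eps n by rewrite /y; ring.
  rewrite normrM [`|eps n|]gtr0_norm // exprMn -!mulrA -exprS //.
have lo : (- (2 * `|a + b * eps n| ^+ 3 * eps n)) @[n --> \oo] --> 0.
  by rewrite -[X in _ --> X]oppr0; exact: cvgN.
apply: (squeeze_cvgr _ lo big); apply: filterS small => n.
by rewrite ler_norml.
Qed.

Variable I : finType.
Implicit Types (X Y u w : I -> R).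

(** This is [gauss_psd] for dipoles: opposite masses at [x_i + eps * (u_i, w_i)] and at [x_i], divided by [eps],
    as [eps] tends to 0. The kernel becomes a second derivative of the Gaussian. *)
Lemma gauss_div_psd s X Y u w : 0 <= s ->
  0 <= \sum_i \sum_j (2 * s * (u i * u j + w i * w j)
     - 4 * s ^+ 2 * (u i * (X i - X j) + w i * (Y i - Y j)) * (u j * (X i - X j) + w j * (Y i - Y j)))
     * expR (- s * ((X i - X j) ^+ 2 + (Y i - Y j) ^+ 2)).
Proof.
move=> s0; have e0 n : 0 < eps n by rewrite invr_gt0.
pose dv i j := u i * (X i - X j) + w i * (Y i - Y j).
pose S (a b : R) n := (expR (a * eps n + b * eps n ^+ 2) - 1 - a * eps n) / eps n ^+ 2.
pose G i j := expR (- s * ((X i - X j) ^+ 2 + (Y i - Y j) ^+ 2)).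
pose a1 i j := - 2 * s * (u i * (X i - X j) + w i * (Y i - Y j)).
pose a2 i j := 2 * s * (u j * (X i - X j) + w j * (Y i - Y j)).
pose b1 i := - s * (u i ^+ 2 + w i ^+ 2).
pose b12 i j := - s * ((u i - u j) ^+ 2 + (w i - w j) ^+ 2).
pose T n := \sum_i \sum_j (S (a1 i j + a2 i j) (b12 i j) n - S (a1 i j) (b1 i) n - S (a2 i j) (b1 j) n) * G i j.
have TL : T n @[n --> \oo] --> \sum_i \sum_j ((b12 i j + (a1 i j + a2 i j) ^+ 2 / 2) -
    (b1 i + a1 i j ^+ 2 / 2) - (b1 j + a2 i j ^+ 2 / 2)) * G i j.
  apply: cvg_bigsum => i; apply: cvg_bigsum => j; apply: cvgM; last exact: cvg_cst.
  by apply: cvgB; [apply: cvgB|]; exact: expR_second_order.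
have T0 n : 0 <= T n.
  pose c (p : I * bool) : R := if p.2 then 1 else -1.
  pose X' (p : I * bool) := X p.1 + (if p.2 then eps n * u p.1 else 0).
  pose Y' (p : I * bool) := Y p.1 + (if p.2 then eps n * w p.1 else 0).
  have := gauss_psd X' Y' c s0.
  rewrite -(ler_pM2r (_ : 0 < (eps n ^+ 2)^-1)) ?invr_gt0 ?exprn_gt0 // mul0r.
  congr (_ <= _); rewrite mulr_suml -(pair_bigA _ (fun i (bi : bool) => (\sum_(q : I * bool) c (i, bi) * c q *
     expR (- s * ((X' (i, bi) - X' q) ^+ 2 + (Y' (i, bi) - Y' q) ^+ 2))) / eps n ^+ 2)) /=.
  apply: eq_bigr => i _; rewrite big_bool /= -mulrDl.
  rewrite -!(pair_bigA _ (fun j (bj : bool) => c (i, _) * c (j, bj) *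
     expR (- s * ((X' (i, _) - X' (j, bj)) ^+ 2 + (Y' (i, _) - Y' (j, bj)) ^+ 2)))) /=.
  rewrite -big_split mulr_suml /=; apply: eq_bigr => j _; rewrite !big_bool /c /X' /Y' /= !addr0.
  rewrite /S /G.
  set g := expR (- s * ((X i - X j) ^+ 2 + (Y i - Y j) ^+ 2)).
  have gE p q : expR (- s * ((X i - X j + p) ^+ 2 + (Y i - Y j + q) ^+ 2)) =
      g * expR (- 2 * s * (p * (X i - X j) + q * (Y i - Y j)) - s * (p ^+ 2 + q ^+ 2)).
    by rewrite /g -expRD; congr expR; ring.
  have -> : X i + eps n * u i - (X j + eps n * u j) = X i - X j + eps n * (u i - u j) by ring.
  have -> : Y i + eps n * w i - (Y j + eps n * w j) = Y i - Y j + eps n * (w i - w j) by ring.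
  have -> : X i + eps n * u i - X j = X i - X j + eps n * u i by ring.
  have -> : Y i + eps n * w i - Y j = Y i - Y j + eps n * w i by ring.
  have -> : X i - (X j + eps n * u j) = X i - X j + - eps n * u j by ring.
  have -> : Y i - (Y j + eps n * w j) = Y i - Y j + - eps n * w j by ring.
  rewrite !gE.
  have -> : - 2 * s * (eps n * (u i - u j) * (X i - X j) + eps n * (w i - w j) * (Y i - Y j)) -
     s * ((eps n * (u i - u j)) ^+ 2 + (eps n * (w i - w j)) ^+ 2) =
     (a1 i j + a2 i j) * eps n + b12 i j * eps n ^+ 2 by rewrite /a1 /a2 /b12; ring.
  have -> : - 2 * s * (eps n * u i * (X i - X j) + eps n * w i * (Y i - Y j)) -
     s * ((eps n * u i) ^+ 2 + (eps n * w i) ^+ 2) =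
     a1 i j * eps n + b1 i * eps n ^+ 2 by rewrite /a1 /b1; ring.
  have -> : - 2 * s * (- eps n * u j * (X i - X j) + - eps n * w j * (Y i - Y j)) -
     s * ((- eps n * u j) ^+ 2 + (- eps n * w j) ^+ 2) =
     a2 i j * eps n + b1 j * eps n ^+ 2 by rewrite /a2 /b1; ring.
  by field; rewrite gt_eqF.
have : 0 <= limn T.
  by apply: limr_ge; [apply/cvg_ex; eexists; exact: TL|exact: nearW].
rewrite (cvg_lim (@Rhausdorff R) TL); congr (_ <= _).
apply: eq_bigr => i _; apply: eq_bigr => j _; congr (_ * _).
by rewrite /a1 /a2 /b1 /b12; field.
Qed.

(** The combination of [gauss_div_psd] for the density, with weight [al - be], and for the density turned by a
    right angle, with weight [al + be]. *)
Lemma gauss_lame_psd (al be : R) s X Y u w : 0 < s -> 0 <= al + be -> 0 <= al - be ->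
  0 <= \sum_i \sum_j (4 * al * (u i * u j + w i * w j) + s *
     (8 * be * ((u i * (X i - X j) + w i * (Y i - Y j)) * (u j * (X i - X j) + w j * (Y i - Y j)))
      - 4 * (al + be) * ((X i - X j) ^+ 2 + (Y i - Y j) ^+ 2) * (u i * u j + w i * w j)))
     * expR (- s * ((X i - X j) ^+ 2 + (Y i - Y j) ^+ 2)).
Proof.
move=> s0 A0 B0; rewrite -(pmulr_rge0 _ s0).
have h1 := gauss_div_psd X Y u w (ltW s0).
have h2 := gauss_div_psd X Y (fun i => - w i) u (ltW s0).
have := addr_ge0 (mulr_ge0 B0 h1) (mulr_ge0 A0 h2); congr (_ <= _).
rewrite !mulr_sumr -big_split; apply: eq_bigr => i _.
rewrite !mulr_sumr -big_split; apply: eq_bigr => j _ /=.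
by ring.
Qed.

End vector_psd.


(** * The regularized Kelvin matrix *)

Section kernel_monotone.
Variables (R : realType).
Implicit Types (s tau : R).

Lemma is_derive_bigsum (J : Type) (r : seq J) (f : J -> R -> R) (df : J -> R) (x : R) :
  (forall j, is_derive x 1 (f j) (df j)) ->
  is_derive x 1 (fun t => \sum_(j <- r) f j t) (\sum_(j <- r) df j).
Proof.
move=> H; elim: r => [|j r IH].
  rewrite big_nil (_ : (fun x => _) = cst 0); first exact: is_derive_cst.
  by apply/funext => t; rewrite big_nil.
rewrite big_cons (_ : (fun t => _) = f j + (fun t => \sum_(j <- r) f j t)).
  by have := H j => ?; exact: is_deriveD.
by apply/funext => t; rewrite big_cons.
Qed.

Lemma expRN_le (x : R) : 0 < x -> expR (- x) <= x^-1 /\ x * expR (- x) <= 4 / x.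
Proof.
move=> x0; rewrite expRN.
have e1 : x <= expR x by have := expR_ge1Dx x; lra.
have h0 : 0 < x / 2 by rewrite divr_gt0.
have e2 : x / 2 <= expR (x / 2) by have := expR_ge1Dx (x / 2); lra.
have eE : expR x = expR (x / 2) ^+ 2 by rewrite expr2 -expRD; congr expR; lra.
split; first by rewrite lef_pV2 ?posrE ?expR_gt0.
rewrite ler_pdivrMr ?expR_gt0 // mulrAC ler_pdivlMr // eE expr2.
have := expR_gt0 (x / 2); nra.
Qed.

(** The fraction [c0 / r + c1 / r ^ 2] is the integral of [(c0 + s * c1) * expR (- s * r)] over [s > 0]. The proof
    uses the antiderivative that vanishes at infinity, which is nondecreasing. *)
Lemma laplace_ge0 (J : finType) (c0 c1 r : J -> R) : (forall j, 0 < r j) ->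
  (forall s, 0 < s -> 0 <= \sum_j (c0 j + s * c1 j) * expR (- s * r j)) ->
  0 <= \sum_j (c0 j / r j + c1 j / r j ^+ 2).
Proof.
move=> r0 H.
(* An antiderivative of [(c0 j + s * c1 j) * expR (- s * r j)]. *)
pose f j (s : R) := - (c0 j / r j + c1 j / r j ^+ 2 + s * (c1 j / r j)) * expR (- s * r j).
have rn0 j : r j != 0 by rewrite gt_eqF.
have df s j : is_derive s 1 (f j) ((c0 j + s * c1 j) * expR (- s * r j)).
  have de : is_derive s 1 (fun s : R => expR (- s * r j)) (expR (- s * r j) * - r j).
    apply: is_derive1_comp; apply: is_derive_eq; rewrite /GRing.scale /= ?scaler0 ?mulr0 ?add0r ?addr0.
    by rewrite mulrN1 ?mulNr ?mul1r ?mulr1.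
  rewrite /f; apply: is_derive_eq; rewrite /GRing.scale /=.
  by field.
have dF s : is_derive s 1 (fun s => \sum_j f j s) (\sum_j (c0 j + s * c1 j) * expR (- s * r j)).
  by apply: is_derive_bigsum => j; exact: df.
have incr n : \sum_j f j 0 <= \sum_j f j n.+1%:R.
  have n0 : 0 < n.+1%:R :> R by [].
  have [|t] := MVT n0 (fun t _ => dF t).
    by apply: derivable_within_continuous => t _; have [] := dF t.
  rewrite in_itv /= subr0 => /andP[t0 _] E.
  by rewrite -subr_ge0 E mulr_ge0 // H.
have L : \sum_j f j n.+1%:R @[n --> \oo] --> \sum_(j : J) (0 : R).
  apply: cvg_bigsum => j.
  have E1 : expR (- n.+1%:R * r j) @[n --> \oo] --> (0 : R).
    apply: (@squeeze_cvgr _ _ _ _ (fun=> 0) (fun n => n.+1%:R^-1 * (r j)^-1)).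
    - apply: nearW => n; rewrite expR_ge0 /= mulNr -invfM.
      by have [] := @expRN_le (n.+1%:R * r j) (ltac:(by rewrite mulr_gt0)).
    - exact: cvg_cst.
    - by rewrite -[X in _ --> X](mul0r (r j)^-1); apply: cvgM; [exact: cvg_harmonic|exact: cvg_cst].
  have E2 : n.+1%:R * expR (- n.+1%:R * r j) @[n --> \oo] --> (0 : R).
    apply: (@squeeze_cvgr _ _ _ _ (fun=> 0) (fun n => n.+1%:R^-1 * (4 / r j ^+ 2))).
    - apply: nearW => n; rewrite mulr_ge0 ?expR_ge0 //= mulNr.
      have [_] := @expRN_le (n.+1%:R * r j) (ltac:(by rewrite mulr_gt0)).
      rewrite -(ler_pM2r (_ : 0 < (r j)^-1)) ?invr_gt0 //.
      rewrite [X in X <= _ -> _](_ : _ = n.+1%:R * expR (- (n.+1%:R * r j))); last by field.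
      by rewrite [X in _ <= X -> _](_ : _ = n.+1%:R^-1 * (4 / r j ^+ 2)) //; field; rewrite addrC natr1 pnatr_eq0 rn0.
    - exact: cvg_cst.
    - by rewrite -[X in _ --> X](mul0r (4 / r j ^+ 2)); apply: cvgM; [exact: cvg_harmonic|exact: cvg_cst].
  have -> : (fun n => f j n.+1%:R) = (fun n => - (c0 j / r j + c1 j / r j ^+ 2) * expR (- n.+1%:R * r j) +
      - (c1 j / r j) * (n.+1%:R * expR (- n.+1%:R * r j))).
    by apply/funext => n; rewrite /f; ring.
  have -> : (0 : R) = - (c0 j / r j + c1 j / r j ^+ 2) * 0 + - (c1 j / r j) * 0 by rewrite !mulr0 addr0.
  by apply: cvgD; apply: cvgM => //; exact: cvg_cst.
have : \sum_j f j 0 <= limn (fun n => \sum_j f j n.+1%:R).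
  by apply: limr_ge; [apply/cvg_ex; eexists; exact: L|exact: nearW].
rewrite (cvg_lim (@Rhausdorff R) L) [X in _ <= X]big1 // -oppr_ge0 -sumrN; congr (_ <= _).
by apply: eq_bigr => j _; rewrite /f oppr0 !mul0r addr0 expR0 mulr1 opprK.
Qed.

(** A regularized Kelvin matrix: [kdiag] is its scalar part and [kdir] the weight of [x_i * x_j], as functions of
    the squared distance [r2]. At [tau = 0] it is [- 16 pi] times the Kelvin matrix. The term [tau / (r2 + tau)]
    is there to make the derivative in [tau] the opposite of a Laplace transform of the kernels of
    [gauss_lame_psd]. *)
Definition kdiag (al be tau r2 : R) : R := - (4 * al * ln (r2 + tau)) + 4 * (al + be) * tau / (r2 + tau).
Definition kdir (be tau r2 : R) : R := 8 * be / (r2 + tau).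

Definition kernel_form (I : finType) (al be : R) (X Y u w : I -> R) tau : R :=
  \sum_i \sum_j (kdiag al be tau ((X i - X j) ^+ 2 + (Y i - Y j) ^+ 2) * (u i * u j + w i * w j)
    + kdir be tau ((X i - X j) ^+ 2 + (Y i - Y j) ^+ 2) *
     ((u i * (X i - X j) + w i * (Y i - Y j)) * (u j * (X i - X j) + w j * (Y i - Y j)))).

(** The opposite of the derivative in [tau] is, by [laplace_ge0], an integral of the forms of [gauss_lame_psd]. *)
Lemma kernel_form_nonincreasing (I : finType) (al be : R) (X Y u w : I -> R) tau tau' :
  0 <= al + be -> 0 <= al - be -> 0 < tau -> tau <= tau' ->
  kernel_form al be X Y u w tau' <= kernel_form al be X Y u w tau.
Proof.
move=> A0 B0 t0; rewrite le_eqVlt => /orP[/eqP->//|tt'].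
pose F := kernel_form al be X Y u w; rewrite -/(F tau) -/(F tau').
pose r2 i j := (X i - X j) ^+ 2 + (Y i - Y j) ^+ 2.
pose p i j := u i * u j + w i * w j.
pose q i j := (u i * (X i - X j) + w i * (Y i - Y j)) * (u j * (X i - X j) + w j * (Y i - Y j)).
have r20 i j : 0 <= r2 i j by rewrite addr_ge0 ?sqr_ge0.
pose c1 i j := 8 * be * q i j - 4 * (al + be) * r2 i j * p i j.
pose dF t := \sum_i \sum_j - (4 * al * p i j / (r2 i j + t) + c1 i j / (r2 i j + t) ^+ 2).
have dFE (t : R) : 0 < t -> is_derive t 1 F (dF t).
  move=> tp; apply: is_derive_bigsum => i; apply: is_derive_bigsum => j.
  have Rp : 0 < r2 i j + t by rewrite ltr_wpDl.
  have Rn : r2 i j + t != 0 by rewrite gt_eqF.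
  have dln : is_derive t 1 (fun t => ln (r2 i j + t)) (r2 i j + t)^-1.
    rewrite -[X in is_derive _ _ _ X]mulr1; apply: (is_derive1_comp (f := @ln R)); first exact: is_derive1_ln.
    by apply: is_derive_eq; rewrite add0r.
  have dinv : is_derive t 1 (fun t => (r2 i j + t)^-1) (- (r2 i j + t) ^- 2).
    have d1 : is_derive t 1 (fun t : R => r2 i j + t) (1 : R).
      by apply: is_derive_eq; rewrite add0r mulr1.
    by have d2 := is_deriveV Rn d1; apply: is_derive_eq; rewrite /GRing.scale /= mulr1.
  rewrite /kdiag /kdir; apply: is_derive_eq; rewrite /GRing.scale /= /c1 /p /q.
  rewrite -!/(r2 i j) !mulr0 !add0r; move: (r2 i j) Rn => r Rn; by field.
have [||t] := @MVT _ F dF _ _ tt'.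
- move=> t; rewrite in_itv /= => /andP[tt _]; apply: dFE; exact: lt_trans tt.
- apply: derivable_within_continuous => t; rewrite in_itv /= => /andP[tt _].
  by have [] := dFE t (lt_le_trans t0 tt).
rewrite in_itv /= => /andP[tt _] E.
have tp := lt_trans t0 tt.
rewrite -subr_le0 E; apply: mulr_le0_ge0; last by rewrite subr_ge0 ltW.
rewrite /dF; under eq_bigr do rewrite sumrN.
rewrite sumrN oppr_le0 pair_bigA /=.
apply: (@laplace_ge0 _ (fun ij => 4 * al * p ij.1 ij.2) (fun ij => c1 ij.1 ij.2) (fun ij => r2 ij.1 ij.2 + t)).
  by move=> ij; rewrite ltr_wpDl.
move=> s s0; rewrite -(pair_bigA _ (fun i j => (4 * al * p i j + s * c1 i j) * expR (- s * (r2 i j + t)))) /=.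
have := mulr_ge0 (expR_ge0 (- s * t)) (gauss_lame_psd X Y u w s0 A0 B0); congr (_ <= _).
rewrite mulr_sumr; apply: eq_bigr => i _; rewrite mulr_sumr; apply: eq_bigr => j _.
rewrite (_ : - s * (r2 i j + t) = - s * r2 i j + - s * t); last by ring.
by rewrite expRD /c1 /p /q /r2; ring.
Qed.

End kernel_monotone.


(** * Integrals on an interval *)

Section interval_integrals.
Variable R : realType.
Local Notation mu := (@lebesgue_measure R).
Implicit Types (f g : R -> R) (c d e : R).

Definition integ c d f := mu.-integrable `[c, d] (EFin \o f).
Definition RI c d f : R := \int[mu]_(t in `[c, d]) f t.

Lemma integ_sub c d c' d' f : c <= c' -> d' <= d -> integ c d f -> integ c' d' f.
Proof.
move=> cc dd; apply: integrableS => //; apply: subset_itv; rewrite bnd_simp //.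
Qed.

Lemma integ_meas c d f : integ c d f -> measurable_fun `[c, d] f.
Proof. by move=> /measurable_int /measurable_EFinP. Qed.

Lemma integD c d f g : integ c d f -> integ c d g -> integ c d (fun t => f t + g t).
Proof. by move=> i1 i2; apply: eq_integrable (integrableD _ i1 i2). Qed.

Lemma integB c d f g : integ c d f -> integ c d g -> integ c d (fun t => f t - g t).
Proof. by move=> i1 i2; apply: eq_integrable (integrableB _ i1 i2). Qed.

Lemma integZ c d k f : integ c d f -> integ c d (fun t => k * f t).
Proof. by move=> i1; apply: eq_integrable (integrableZl _ k i1). Qed.

Lemma integ_cont c d f : continuous f -> integ c d f.
Proof.
move=> cf; apply: continuous_compact_integrable; first exact: segment_compact.
exact: continuous_subspaceT.
Qed.

Lemma integ_norm c d f : integ c d f -> integ c d (fun t => `|f t|).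
Proof. exact: integrable_norm. Qed.

Lemma integ_le c d f g : measurable_fun `[c, d] f -> integ c d g ->
  (forall t, c <= t <= d -> `|f t| <= `|g t|) -> integ c d f.
Proof.
move=> /measurable_EFinP mf ig fg.
apply: (le_integrable (mu:=mu) (measurable_itv _) mf _ ig) => t.
by rewrite /= in_itv /= lee_fin => /fg.
Qed.

Lemma integ_mul c d f g B : integ c d f -> measurable_fun `[c, d] g ->
  (forall t, c <= t <= d -> `|g t| <= B) -> integ c d (fun t => f t * g t).
Proof.
move=> if_ mg gB; apply: (@integ_le _ _ _ (fun t => B * f t)).
- by apply: measurable_funM => //; exact: integ_meas.
- exact: integZ.
move=> t tI; rewrite !normrM mulrC ler_wpM2r //.
by apply: le_trans (gB t tI) (ler_norm _).
Qed.

Lemma RID c d f g : integ c d f -> integ c d g -> RI c d (fun t => f t + g t) = RI c d f + RI c d g.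
Proof. by move=> *; exact: (RintegralD (mu:=mu) (measurable_itv _)). Qed.

Lemma RIB c d f g : integ c d f -> integ c d g -> RI c d (fun t => f t - g t) = RI c d f - RI c d g.
Proof. by move=> *; exact: (RintegralB (mu:=mu) (measurable_itv _)). Qed.

Lemma RIZ c d k f : integ c d f -> RI c d (fun t => k * f t) = k * RI c d f.
Proof. by move=> *; exact: (RintegralZl (mu:=mu) _ (measurable_itv _)). Qed.

Lemma RI_eq c d f g : (forall t, c <= t <= d -> f t = g t) -> RI c d f = RI c d g.
Proof. by move=> fg; apply: eq_Rintegral => t; rewrite inE /= in_itv /= => /fg. Qed.

Lemma RI_le c d f g : integ c d f -> integ c d g -> (forall t, c <= t <= d -> f t <= g t) ->
  RI c d f <= RI c d g.
Proof. by move=> if_ ig fg; apply: (le_Rintegral (mu:=mu) (measurable_itv _)) => // t /=; rewrite in_itv => /fg. Qed.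

Lemma RI_norm c d f : integ c d f -> `|RI c d f| <= RI c d (fun t => `|f t|).
Proof. by move=> *; exact: (le_normr_Rintegral (mu:=mu) (measurable_itv _)). Qed.

Lemma RI_norm_ge0 c d f : 0 <= RI c d (fun t => `|f t|).
Proof. by apply: Rintegral_ge0. Qed.

Lemma RI_cst c d k : c <= d -> RI c d (fun=> k) = k * (d - c).
Proof.
move=> cd; rewrite /RI Rintegral_cst //= lebesgue_measure_itv /= lte_fin.
case: ifPn => //; rewrite -leNgt => dc.
by rewrite (_ : c = d) ?subrr //; apply/le_anti; rewrite cd.
Qed.

Lemma RI_mul_le c d f g B : 0 <= B -> integ c d f -> measurable_fun `[c, d] g ->
  (forall t, c <= t <= d -> `|g t| <= B) ->
  `|RI c d (fun t => f t * g t)| <= B * RI c d (fun t => `|f t|).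
Proof.
move=> B0 if_ mg gB; apply: le_trans (RI_norm (integ_mul if_ mg gB)) _.
rewrite -RIZ; last exact: integ_norm.
apply: RI_le; [exact/integ_norm/(integ_mul if_ mg gB)|exact/integZ/integ_norm|].
by move=> t tI; rewrite normrM mulrC ler_wpM2r // gB.
Qed.

Lemma RI_split c d e f : c <= d -> d <= e -> integ c e f -> RI c e f = RI c d f + RI d e f.
Proof.
move=> cd de ic; have := @Rintegral_itvB R f (BLeft c) (BRight e) d ic.
rewrite !bnd_simp => /(_ cd de) E; rewrite /RI.
rewrite -(Rintegral_itv_obnd_cbnd (r := d)); first by rewrite -E addrC subrK.
apply: integrableS ic => //; apply: subset_itv; rewrite bnd_simp //.
Qed.

Definition node (L : R) (n j : nat) : R := L * j%:R / n.+1%:R.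
Definition piece (L : R) n j f : R := RI (node L n j) (node L n j.+1) f.

Lemma node_le L n i j : 0 <= L -> (i <= j)%N -> node L n i <= node L n j.
Proof. by move=> L0 ij; rewrite ler_wpM2r ?invr_ge0 // ler_wpM2l // ler_nat. Qed.

Lemma node0 L n : node L n 0 = 0. Proof. by rewrite /node mulr0 mul0r. Qed.

Lemma nodeS L n : node L n n.+1 = L. Proof. by rewrite /node mulfK // pnatr_eq0. Qed.

Lemma node_step L n j : node L n j.+1 - node L n j = L / n.+1%:R.
Proof. by rewrite /node -natr1; ring. Qed.

Lemma integ_node L n j f : 0 <= L -> (j <= n)%N -> integ 0 L f -> integ (node L n j) (node L n j.+1) f.
Proof.
move=> L0 jn; apply: integ_sub.
  by rewrite -(node0 L n) node_le.
by rewrite -[leRHS](nodeS L n) node_le.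
Qed.

Lemma RI_partition L n f : 0 <= L -> integ 0 L f -> RI 0 L f = \sum_(j < n.+1) piece L n j f.
Proof.
move=> L0 i0; rewrite -(big_mkord xpredT (fun j => piece L n j f)).
suff H m : (m <= n.+1)%N -> RI 0 (node L n m) f = \sum_(0 <= j < m) piece L n j f.
  by rewrite -H // nodeS.
elim: m => [_|m IH mn]; first by rewrite node0 big_geq // /RI set_itv1 Rintegral_set1.
rewrite big_nat_recr //= -IH ?(ltnW mn) //; apply: RI_split.
- by rewrite -(node0 L n) node_le.
- exact: node_le.
- by apply: integ_sub i0 => //; rewrite -[leRHS](nodeS L n) node_le.
Qed.

(** The step common to the discretization of double integrals and to the estimates of oscillating integrals. *)
Lemma freeze L n f g (k eta : nat -> R) : 0 <= L -> integ 0 L g -> measurable_fun `[0, L] f ->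
  integ 0 L (fun t => g t * f t) ->
  (forall j t, (j <= n)%N -> node L n j <= t <= node L n j.+1 -> `|f t - k j| <= eta j) ->
  `|RI 0 L (fun t => g t * f t) - \sum_(j < n.+1) k j * piece L n j g| <=
  \sum_(j < n.+1) eta j * piece L n j (fun t => `|g t|).
Proof.
move=> L0 ig mf igf H; rewrite (RI_partition n L0 igf) -sumrB.
apply: le_trans (ler_norm_sum _ _ _) _; apply: ler_sum => j _.
have jn : (j <= n)%N by rewrite -ltnS.
have igj := integ_node L0 jn ig; have igfj := integ_node L0 jn igf.
have nj := node_le n L0 (leqnSn j).
rewrite /piece -RIZ // -RIB //; last exact: integZ.
rewrite (@RI_eq _ _ _ (fun t => g t * (f t - k j))) => [|t _]; last by ring.
have eta0 : 0 <= eta j.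
  by apply: le_trans (normr_ge0 _) (H j (node L n j) jn _); rewrite lexx.
apply: RI_mul_le => // [|t tj]; last exact: H.
apply: measurable_funB => //; apply: measurable_funS mf => //.
by apply: subset_itv; rewrite bnd_simp; [rewrite -(node0 L n)|rewrite -[leRHS](nodeS L n)]; apply: node_le.
Qed.

End interval_integrals.


(** * Potentials and energies on a curve *)

Section bilinear_forms.
Variable R : realType.
Implicit Types (f g : R -> R) (z w : R[i]).
Variables (L : R) (x : R -> R[i]) (K : R).
Hypothesis L0 : 0 < L.
Hypothesis xK : forall t, cabs (x t) <= K.
Hypothesis xU : forall e, 0 < e -> exists2 d, 0 < d &
  forall s t, `|s - t| < d -> cabs (x s - x t) < e.

(** The regularized kernels are Lipschitz on the disc of radius [K], which contains the curve; this makes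
    discretization elementary. *)
Definition lip_kernel (k : R[i] -> R[i] -> R) (Lam : R) := forall z w z' w',
  cabs z <= K -> cabs w <= K -> cabs z' <= K -> cabs w' <= K ->
  `|k z w - k z' w'| <= Lam * (cabs (z - z') + cabs (w - w')).

Definition pot (k : R[i] -> R[i] -> R) g z := RI 0 L (fun s => g s * k z (x s)).
Definition bil k f g := RI 0 L (fun t => f t * pot k g (x t)).

Section one_kernel.
Variables (k : R[i] -> R[i] -> R) (Lam : R).
Hypothesis Lam0 : 0 <= Lam.
Hypothesis kL : lip_kernel k Lam.

Lemma kernel_section_continuous z : cabs z <= K -> continuous (fun s : R => k z (x s)).
Proof.
move=> zK s; apply/cvgrPdist_lt => e e0.
have e'0 : 0 < e / (Lam + 1) by rewrite divr_gt0 //; have := Lam0; lra.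
have [d d0 Hd] := xU e'0.
apply/nbhs_ballP; exists d => // t; rewrite /ball /= => /Hd H.
apply: le_lt_trans (kL zK (xK s) zK (xK t)) _; rewrite subrr cabs0 add0r.
have L1 : 0 < Lam + 1 by have := Lam0; lra.
move: H; rewrite ltr_pdivlMr // => H; have := cabs_ge0 (x s - x t); have := Lam0; nra.
Qed.

Lemma kernel_bounded : exists2 B, 0 <= B & forall z w, cabs z <= K -> cabs w <= K -> `|k z w| <= B.
Proof.
exists (`|k (x 0) (x 0)| + Lam * (4 * K)).
  by rewrite addr_ge0 ?mulr_ge0 //; apply: le_trans (cabs_ge0 (x 0)) (xK 0).
move=> z w zK wK; have := kL zK wK (xK 0) (xK 0).
have H1 : cabs (z - x 0) <= 2 * K by have := cabsD z (- x 0); rewrite cabsN; have := xK 0; lra.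
have H2 : cabs (w - x 0) <= 2 * K by have := cabsD w (- x 0); rewrite cabsN; have := xK 0; lra.
have H3 : Lam * (cabs (z - x 0) + cabs (w - x 0)) <= Lam * (4 * K).
  by apply: ler_wpM2l => //; lra.
have := ler_normD (k z w - k (x 0) (x 0)) (k (x 0) (x 0)); rewrite subrK; lra.
Qed.

Lemma integ_kernel g z : cabs z <= K -> integ 0 L g -> integ 0 L (fun s => g s * k z (x s)).
Proof.
move=> zK ig; have [B _ HB] := kernel_bounded.
apply: (integ_mul (B := B) ig); last by move=> t _; exact: HB.
by apply: measurable_funTS; apply: continuous_measurable_fun; exact: kernel_section_continuous.
Qed.

Lemma pot_lip g z w : cabs z <= K -> cabs w <= K -> integ 0 L g ->
  `|pot k g z - pot k g w| <= Lam * cabs (z - w) * RI 0 L (fun s => `|g s|).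
Proof.
move=> zK wK ig; rewrite /pot -RIB; [|exact: integ_kernel..].
rewrite (@RI_eq _ _ _ _ (fun s => g s * (k z (x s) - k w (x s)))) => [|t _]; last by ring.
apply: RI_mul_le => //.
- by rewrite mulr_ge0 // cabs_ge0.
- by apply: measurable_funB; apply: measurable_funTS; apply: continuous_measurable_fun; exact: kernel_section_continuous.
move=> t _; apply: le_trans (kL zK (xK t) wK (xK t)) _.
by rewrite subrr cabs0 addr0.
Qed.

Lemma pot_continuous g : integ 0 L g -> continuous (fun t : R => pot k g (x t)).
Proof.
move=> ig s; apply/cvgrPdist_lt => e e0.
pose Q := Lam * RI 0 L (fun s => `|g s|).
have Q0 : 0 <= Q by rewrite mulr_ge0 // RI_norm_ge0.
have Q1 : 0 < Q + 1 by rewrite ltr_wpDl.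
have e'0 : 0 < e / (Q + 1) by rewrite divr_gt0.
have [d d0 Hd] := xU e'0.
apply/nbhs_ballP; exists d => // t; rewrite /ball /= => /Hd H.
apply: le_lt_trans (pot_lip (xK s) (xK t) ig) _; rewrite mulrAC -/Q.
move: H; rewrite ltr_pdivlMr // => H; have := cabs_ge0 (x s - x t); nra.
Qed.

Lemma pot_bounded g : integ 0 L g -> exists2 B, 0 <= B & forall t, `|pot k g (x t)| <= B.
Proof.
move=> ig; have [B B0 HB] := kernel_bounded.
exists (B * RI 0 L (fun s => `|g s|)) => [|t]; first by rewrite mulr_ge0 // RI_norm_ge0.
apply: RI_mul_le => // [|s _]; last exact: HB.
by apply: measurable_funTS; apply: continuous_measurable_fun; exact: kernel_section_continuous.
Qed.

Lemma integ_pot f g : integ 0 L f -> integ 0 L g -> integ 0 L (fun t => f t * pot k g (x t)).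
Proof.
move=> if_ ig; have [B _ HB] := pot_bounded ig.
apply: (integ_mul (B := B) if_); last by move=> t _; exact: HB.
by apply: measurable_funTS; apply: continuous_measurable_fun; exact: pot_continuous.
Qed.

(** The interaction of the point masses [piece L n i f] and [piece L n j g] placed at the nodes. *)
Definition dsum n f g := \sum_(i < n.+1) \sum_(j < n.+1)
  piece L n i f * piece L n j g * k (x (node L n i)) (x (node L n j)).

(** Both variables are frozen at the nodes. Properties of finite families of point masses pass to densities
    through this limit. *)
Lemma bil_discrete f g : integ 0 L f -> integ 0 L g -> dsum n f g @[n --> \oo] --> bil k f g.
Proof.
move=> if_ ig; apply/cvgrPdist_lt => e e0.
have L0' : 0 <= L := ltW L0.
set nf := RI 0 L (fun s => `|f s|); set ng := RI 0 L (fun s => `|g s|).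
have nf0 : 0 <= nf by apply: RI_norm_ge0.
have ng0 : 0 <= ng by apply: RI_norm_ge0.
have Q0 : 0 <= 2 * Lam * ng * nf by rewrite !mulr_ge0.
have e'0 : 0 < e / (2 * Lam * ng * nf + 1) by rewrite divr_gt0 // ltr_wpDl.
set e' := e / _ in e'0.
have e'E : e' * (2 * Lam * ng * nf + 1) = e by rewrite /e' divfK // gt_eqF // ltr_wpDl.
have [d d0 Hd] := xU e'0.
have dL : 0 < d / L by rewrite divr_gt0.
have /cvgrPdist_lt/(_ _ dL)[N _ HN] := @cvg_harmonic R.
exists N => // n /= Nn; have {HN} := HN n Nn; rewrite /= sub0r normrN ger0_norm // => nd.
have close j t : node L n j <= t <= node L n j.+1 -> cabs (x t - x (node L n j)) <= e'.
  move=> /andP[t1 t2]; apply/ltW/Hd; rewrite ger0_norm ?subr_ge0 //.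
  have := node_step L n j; have : L / n.+1%:R < d by rewrite mulrC -ltr_pdivlMr.
  by move: (L / n.+1%:R) => q; lra.
have inner i t : (i <= n)%N -> node L n i <= t <= node L n i.+1 ->
    `|pot k g (x t) - \sum_(j < n.+1) k (x (node L n i)) (x (node L n j)) * piece L n j g| <= 2 * Lam * e' * ng.
  move=> _ ti.
  have := @freeze _ L n (fun s => k (x t) (x s)) g (fun j => k (x (node L n i)) (x (node L n j)))
     (fun=> 2 * Lam * e') L0' ig _ _ _.
  rewrite -mulr_sumr -RI_partition //; last exact: integ_norm.
  apply.
  - by apply: measurable_funTS; apply: continuous_measurable_fun; exact: kernel_section_continuous.
  - exact: integ_kernel.
  move=> j s _ sj; apply: le_trans (kL _ _ _ _) _ => //.
  have := close i t ti; have := close j s sj => H1 H2.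
  rewrite (_ : 2 * Lam * e' = Lam * (2 * e')); last by ring.
  by apply: ler_wpM2l => //; lra.
have := @freeze _ L n (fun t => pot k g (x t)) f
  (fun i => \sum_(j < n.+1) k (x (node L n i)) (x (node L n j)) * piece L n j g)
  (fun=> 2 * Lam * e' * ng) L0' if_ _ _ inner.
rewrite -mulr_sumr -RI_partition //; last exact: integ_norm.
rewrite -/nf -/(bil k f g).
have -> : \sum_(j < n.+1) (\sum_(j0 < n.+1) k (x (node L n j)) (x (node L n j0)) * piece L n j0 g) * piece L n j f
   = dsum n f g.
  apply: eq_bigr => i _; rewrite mulr_suml; apply: eq_bigr => j _; ring.
move=> H; apply: le_lt_trans (H _ _) _.
- by apply: measurable_funTS; apply: continuous_measurable_fun; exact: pot_continuous.
- exact: integ_pot.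
- rewrite -e'E; have := e'0; nra.
Qed.

End one_kernel.

(** Fubini's theorem, inherited from the finite sums. *)
Lemma bil_sym k Lam f g : 0 <= Lam -> lip_kernel k Lam -> integ 0 L f -> integ 0 L g ->
  bil k f g = bil (fun z w => k w z) g f.
Proof.
move=> Lam0 kL if_ ig.
have kL' : lip_kernel (fun z w => k w z) Lam.
  by move=> z w z' w' *; rewrite [cabs _ + _]addrC; exact: kL.
have H1 := bil_discrete Lam0 kL if_ ig.
have H2 := bil_discrete Lam0 kL' ig if_.
rewrite -(cvg_lim (@Rhausdorff R) H1) -(cvg_lim (@Rhausdorff R) H2); congr (limn _).
apply/funext => n; rewrite /dsum exchange_big /=.
by apply: eq_bigr => i _; apply: eq_bigr => j _; rewrite [_ * piece L n j f]mulrC.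
Qed.

Lemma potD k Lam f g z : 0 <= Lam -> lip_kernel k Lam -> cabs z <= K -> integ 0 L f -> integ 0 L g ->
  pot k (fun t => f t + g t) z = pot k f z + pot k g z.
Proof.
move=> Lam0 kL zK if_ ig; rewrite /pot -RID; [|exact: (integ_kernel Lam0 kL)..].
by apply: RI_eq => t _; rewrite mulrDl.
Qed.

Lemma potZ k Lam c f z : 0 <= Lam -> lip_kernel k Lam -> cabs z <= K -> integ 0 L f ->
  pot k (fun t => c * f t) z = c * pot k f z.
Proof.
move=> Lam0 kL zK if_; rewrite /pot -RIZ; last exact: (integ_kernel Lam0 kL).
by apply: RI_eq => t _; rewrite mulrA.
Qed.

End bilinear_forms.


(** * Energies of the regularized Kelvin matrix *)

Section kelvin_forms.
Variable R : realType.
Implicit Types (f g : R -> R) (z w : R[i]) (tau : R).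
Variables (L : R) (x : R -> R[i]) (K : R).
Hypothesis L0 : 0 < L.
Hypothesis xK : forall t, cabs (x t) <= K.
Hypothesis xU : forall e, 0 < e -> exists2 d, 0 < d &
  forall s t, `|s - t| < d -> cabs (x s - x t) < e.
Variables (al be : R).
Hypothesis A0 : 0 <= al + be.
Hypothesis B0 : 0 <= al - be.

Definition lipk (k : R[i] -> R[i] -> R) := exists2 Lam, 0 <= Lam & lip_kernel K k Lam.

Lemma lipkD k k' : lipk k -> lipk k' -> lipk (fun z w => k z w + k' z w).
Proof.
move=> [M M0 HM] [M' M'0 HM']; exists (M + M') => [|z w z' w' zK wK zK' wK']; first by rewrite addr_ge0.
have := HM _ _ _ _ zK wK zK' wK'; have := HM' _ _ _ _ zK wK zK' wK'.
have := ler_normD (k z w - k z' w') (k' z w - k' z' w').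
rewrite (_ : k z w - k z' w' + (k' z w - k' z' w') = k z w + k' z w - (k z' w' + k' z' w')); last by ring.
lra.
Qed.

Lemma lipk_cst c : lipk (fun _ _ => c).
Proof.
by exists 0 => // z w z' w' *; rewrite subrr normr0 mul0r.
Qed.

Lemma lipkM k k' : lipk k -> lipk k' -> lipk (fun z w => k z w * k' z w).
Proof.
move=> [M M0 HM] [M' M'0 HM'].
have [C C0 HC] := kernel_bounded xK M0 HM; have [C' C'0 HC'] := kernel_bounded xK M'0 HM'.
exists (C' * M + C * M') => [|z w z' w' zK wK zK' wK']; first by rewrite addr_ge0 ?mulr_ge0.
rewrite (_ : k z w * k' z w - k z' w' * k' z' w' =
  k' z w * (k z w - k z' w') + k z' w' * (k' z w - k' z' w')); last by ring.
apply: le_trans (ler_normD _ _) _; rewrite !normrM mulrDl -!mulrA.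
by apply: lerD; apply: ler_pM; rewrite ?normr_ge0 ?HC ?HC' ?HM ?HM'.
Qed.

Lemma lipkZ c k : lipk k -> lipk (fun z w => c * k z w).
Proof. by move=> H; apply: lipkM => //; exact: lipk_cst. Qed.

Lemma lipk_comp (phi : R -> R) (c M : R) k : 0 <= M ->
  (forall a b, c <= a -> c <= b -> `|phi a - phi b| <= M * `|a - b|) ->
  (forall z w, c <= k z w) -> lipk k -> lipk (fun z w => phi (k z w)).
Proof.
move=> M0 Hphi kc [M' M'0 HM']; exists (M * M') => [|z w z' w' *]; first exact: mulr_ge0.
apply: le_trans (Hphi _ _ (kc _ _) (kc _ _)) _; rewrite -mulrA ler_wpM2l //.
exact: HM'.
Qed.

Definition dx z w : R := complex.Re z - complex.Re w.
Definition dy z w : R := complex.Im z - complex.Im w.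
Definition dist2 z w : R := dx z w ^+ 2 + dy z w ^+ 2.

Lemma lipk_dx : lipk dx.
Proof.
exists 1 => // z w z' w' _ _ _ _; rewrite mul1r /dx.
have := cabs_Re (z - z'); have := cabs_Re (w - w'); rewrite !ReD !ReN => H1 H2.
rewrite (_ : _ - _ - (_ - _) = (complex.Re z - complex.Re z') - (complex.Re w - complex.Re w')); last by ring.
by apply: le_trans (ler_normB _ _) _; apply: lerD.
Qed.

Lemma lipk_dy : lipk dy.
Proof.
exists 1 => // z w z' w' _ _ _ _; rewrite mul1r /dy.
have := cabs_Im (z - z'); have := cabs_Im (w - w'); rewrite !ImD !ImN => H1 H2.
rewrite (_ : _ - _ - (_ - _) = (complex.Im z - complex.Im z') - (complex.Im w - complex.Im w')); last by ring.
by apply: le_trans (ler_normB _ _) _; apply: lerD.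
Qed.

Lemma lipk_dist2 : lipk dist2.
Proof. exact: (lipkD (lipkM lipk_dx lipk_dx) (lipkM lipk_dy lipk_dy)). Qed.

Lemma dist2_ge0 z w : 0 <= dist2 z w. Proof. by rewrite addr_ge0 ?sqr_ge0. Qed.

Lemma inv_lip c (a b : R) : 0 < c -> c <= a -> c <= b -> `|a^-1 - b^-1| <= (c ^+ 2)^-1 * `|a - b|.
Proof.
move=> c0 ca cb; have a0 := lt_le_trans c0 ca; have b0 := lt_le_trans c0 cb.
rewrite (_ : a^-1 - b^-1 = (b - a) / (a * b)); last by field; rewrite !gt_eqF.
rewrite normrM distrC mulrC ler_wpM2r // gtr0_norm ?invr_gt0 ?mulr_gt0 //.
rewrite lef_pV2 ?posrE ?exprn_gt0 ?mulr_gt0 // expr2.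
by apply: ler_pM => //; exact: ltW.
Qed.

Lemma ln_lip c (a b : R) : 0 < c -> c <= a -> c <= b -> `|ln a - ln b| <= c^-1 * `|a - b|.
Proof.
move=> c0; have main (p q : R) : c <= p -> c <= q -> ln p - ln q <= c^-1 * `|p - q|.
  move=> cp cq; have p0 := lt_le_trans c0 cp; have q0 := lt_le_trans c0 cq.
  have e : ln p - ln q = ln (p / q) by rewrite ln_div ?posrE.
  have pq0 : 0 < p / q by rewrite divr_gt0.
  have h : ln (p / q) <= (p - q) / q.
    rewrite mulrBl divff ?gt_eqF //.
    by have := @ln_sublinear R (p / q) pq0; have := expR_ge1Dx (ln (p / q)); rewrite lnK ?posrE //; lra.
  rewrite e; apply: le_trans h _; rewrite mulrC; apply: (@le_trans _ _ (q^-1 * `|p - q|)).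
    by rewrite ler_pM2l ?invr_gt0 // ler_norm.
  by rewrite ler_wpM2r // lef_pV2 ?posrE.
move=> ca cb; rewrite ler_norml; apply/andP; split; last exact: main.
by rewrite lerNl opprB distrC; exact: main.
Qed.

Lemma lipk_inv tau : 0 < tau -> lipk (fun z w => (dist2 z w + tau)^-1).
Proof.
move=> t0; apply: (@lipk_comp (fun s => s^-1) tau (tau ^+ 2)^-1 (fun z w => dist2 z w + tau)).
- by rewrite invr_ge0 exprn_ge0 // ltW.
- by move=> a b; exact: inv_lip.
- by move=> z w; rewrite lerDr dist2_ge0.
- by apply: lipkD; [exact: lipk_dist2|exact: lipk_cst].
Qed.

Lemma lipk_ln tau : 0 < tau -> lipk (fun z w => ln (dist2 z w + tau)).
Proof.
move=> t0; apply: (@lipk_comp (@ln R) tau tau^-1 (fun z w => dist2 z w + tau)).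
- by rewrite invr_ge0 ltW.
- by move=> a b; exact: ln_lip.
- by move=> z w; rewrite lerDr dist2_ge0.
- by apply: lipkD; [exact: lipk_dist2|exact: lipk_cst].
Qed.

Definition k11 tau z w := kdiag al be tau (dist2 z w) + kdir be tau (dist2 z w) * (dx z w * dx z w).
Definition k12 tau z w := kdir be tau (dist2 z w) * (dx z w * dy z w).
Definition k22 tau z w := kdiag al be tau (dist2 z w) + kdir be tau (dist2 z w) * (dy z w * dy z w).

Lemma lipk_kdiag tau : 0 < tau -> lipk (fun z w => kdiag al be tau (dist2 z w)).
Proof.
move=> t0; have := lipkD (lipkZ (- (4 * al)) (lipk_ln t0)) (lipkZ (4 * (al + be) * tau) (lipk_inv t0)).
congr lipk; apply/funext => z; apply/funext => w; rewrite /kdiag mulNr //.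
Qed.

Lemma lipk_kdir tau : 0 < tau -> lipk (fun z w => kdir be tau (dist2 z w)).
Proof. by move=> t0; exact: (lipkZ (8 * be) (lipk_inv t0)). Qed.

Lemma lipk_k11 tau : 0 < tau -> lipk (k11 tau).
Proof.
by move=> t0; exact: (lipkD (lipk_kdiag t0) (lipkM (lipk_kdir t0) (lipkM lipk_dx lipk_dx))).
Qed.

Lemma lipk_k12 tau : 0 < tau -> lipk (k12 tau).
Proof. by move=> t0; exact: (lipkM (lipk_kdir t0) (lipkM lipk_dx lipk_dy)). Qed.

Lemma lipk_k22 tau : 0 < tau -> lipk (k22 tau).
Proof.
by move=> t0; exact: (lipkD (lipk_kdiag t0) (lipkM (lipk_kdir t0) (lipkM lipk_dy lipk_dy))).
Qed.

Local Notation integ0 f := (integ 0 L f).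
Local Notation I0 f := (RI 0 L f).
Local Notation Bil k f g := (bil L x k f g).
Local Notation Pot k g z := (pot L x k g z).

Lemma bil_cvg k f g : lipk k -> integ0 f -> integ0 g -> dsum L x k n f g @[n --> \oo] --> Bil k f g.
Proof. by move=> [M M0 HM] *; exact: (bil_discrete L0 xK xU M0 HM). Qed.

(** The energy of the density [(f, g)] for the regularized kernel. *)
Definition form tau f g :=
  Bil (k11 tau) f f + Bil (k12 tau) f g + Bil (k12 tau) g f + Bil (k22 tau) g g.

(** The limit of [kernel_form_nonincreasing] for point masses on the curve. *)
Lemma form_nonincreasing tau tau' f g : integ0 f -> integ0 g -> 0 < tau -> tau <= tau' ->
  form tau' f g <= form tau f g.
Proof.
move=> if_ ig t0 tt'; have t'0 := lt_le_trans t0 tt'.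
pose d t n := dsum L x (k11 t) n f f + dsum L x (k12 t) n f g + dsum L x (k12 t) n g f + dsum L x (k22 t) n g g.
have dc t : 0 < t -> d t n @[n --> \oo] --> form t f g.
  move=> tp; have c1 := bil_cvg (lipk_k11 tp) if_ if_; have c2 := bil_cvg (lipk_k12 tp) if_ ig.
  have c3 := bil_cvg (lipk_k12 tp) ig if_; have c4 := bil_cvg (lipk_k22 tp) ig ig.
  exact: (cvgD (cvgD (cvgD c1 c2) c3) c4).
apply: (ler_cvg_to (dc _ t'0) (dc _ t0)); apply: nearW => n.
have dE t : d t n = kernel_form al be (fun i : 'I_n.+1 => complex.Re (x (node L n i)))
    (fun i => complex.Im (x (node L n i))) (fun i => piece L n i f) (fun i => piece L n i g) t.
  rewrite /d /dsum /kernel_form -!big_split; apply: eq_bigr => i _.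
  rewrite -!big_split; apply: eq_bigr => j _ /=.
  rewrite /k11 /k12 /k22 -/(dx (x (node L n i)) (x (node L n j))) -/(dy (x (node L n i)) (x (node L n j))).
  rewrite -/(dist2 (x (node L n i)) (x (node L n j))); ring.
by rewrite !dE; apply: kernel_form_nonincreasing.
Qed.


Lemma Rex_continuous : continuous (fun t : R => complex.Re (x t)).
Proof.
move=> s; apply/cvgrPdist_lt => e e0; have [d d0 Hd] := xU e0.
apply/nbhs_ballP; exists d => // t; rewrite /ball /= => /Hd H.
by rewrite -ReN -ReD; apply: le_lt_trans (cabs_Re _) _.
Qed.

Lemma Imx_continuous : continuous (fun t : R => complex.Im (x t)).
Proof.
move=> s; apply/cvgrPdist_lt => e e0; have [d d0 Hd] := xU e0.
apply/nbhs_ballP; exists d => // t; rewrite /ball /= => /Hd H.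
by rewrite -ImN -ImD; apply: le_lt_trans (cabs_Im _) _.
Qed.

Lemma integ_mulc f (g : R -> R) B : integ0 f -> continuous g -> (forall t, `|g t| <= B) ->
  integ0 (fun t => f t * g t).
Proof.
move=> if_ cg gB; apply: (integ_mul (B := B) if_) => [|t _]; last exact: gB.
by apply: measurable_funTS; exact: continuous_measurable_fun.
Qed.

Lemma Rex_bounded t : `|complex.Re (x t)| <= K. Proof. exact: le_trans (cabs_Re _) (xK t). Qed.
Lemma Imx_bounded t : `|complex.Im (x t)| <= K. Proof. exact: le_trans (cabs_Im _) (xK t). Qed.

Lemma integ_Rex f : integ0 f -> integ0 (fun t => f t * complex.Re (x t)).
Proof. by move=> H; apply: (integ_mulc H Rex_continuous Rex_bounded). Qed.

Lemma integ_Imx f : integ0 f -> integ0 (fun t => f t * complex.Im (x t)).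
Proof. by move=> H; apply: (integ_mulc H Imx_continuous Imx_bounded). Qed.

Definition mom1 f := I0 (fun t => f t * complex.Re (x t)).
Definition mom2 f := I0 (fun t => f t * complex.Im (x t)).

Lemma lipk_integ k f z : lipk k -> cabs z <= K -> integ0 f -> integ0 (fun s => f s * k z (x s)).
Proof. by move=> [M M0 HM] *; exact: (integ_kernel xK xU M0 HM). Qed.

Lemma lipk_integ_pot k f g : lipk k -> integ0 f -> integ0 g -> integ0 (fun t => f t * Pot k g (x t)).
Proof. by move=> [M M0 HM] *; exact: (integ_pot xK xU M0 HM). Qed.

Lemma bilkD k k' f g : lipk k -> lipk k' -> integ0 f -> integ0 g ->
  Bil (fun z w => k z w + k' z w) f g = Bil k f g + Bil k' f g.
Proof.
move=> lk lk' if_ ig; rewrite /bil -RID; [|exact: lipk_integ_pot..].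
apply: RI_eq => t _; rewrite -mulrDr; congr (_ * _); rewrite /pot -RID; [|exact: lipk_integ..].
by apply: RI_eq => s _; rewrite mulrDr.
Qed.

Lemma bilkZ c k f g : lipk k -> integ0 f -> integ0 g ->
  Bil (fun z w => c * k z w) f g = c * Bil k f g.
Proof.
move=> lk if_ ig; rewrite /bil -RIZ; last exact: lipk_integ_pot.
apply: RI_eq => t _; rewrite mulrCA; congr (_ * _); rewrite /pot -RIZ; last exact: lipk_integ.
by apply: RI_eq => s _; rewrite mulrCA.
Qed.

Lemma bil_cst c f g : integ0 f -> integ0 g -> Bil (fun _ _ => c) f g = c * (I0 f * I0 g).
Proof.
move=> if_ ig; rewrite /bil (@RI_eq _ _ _ _ (fun t => (c * I0 g) * f t)) ?RIZ //; first by ring.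
move=> t _; rewrite /pot (@RI_eq _ _ _ _ (fun s => c * g s)) ?RIZ //; first by rewrite mulrC.
by move=> s _; rewrite mulrC.
Qed.

Lemma bil_close k k' eta f g : 0 <= eta -> lipk k -> lipk k' -> integ0 f -> integ0 g ->
  (forall z w, cabs z <= K -> cabs w <= K -> `|k z w - k' z w| <= eta) ->
  `|Bil k f g - Bil k' f g| <= eta * I0 (fun t => `|g t|) * I0 (fun t => `|f t|).
Proof.
move=> e0 lk lk' if_ ig H.
have lkk : lipk (fun z w => k z w + -1 * k' z w) by apply: lipkD => //; exact: lipkZ.
have -> : Bil k f g - Bil k' f g = Bil (fun z w => k z w + -1 * k' z w) f g.
  by rewrite bilkD // ?bilkZ ?mulN1r //; exact: lipkZ.
have [M M0 HM] := lkk.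
apply: RI_mul_le => //; first by rewrite mulr_ge0 // RI_norm_ge0.
  by apply: measurable_funTS; apply: continuous_measurable_fun; exact: (pot_continuous xK xU M0 HM).
move=> t _; apply: RI_mul_le => //; last by move=> s _; rewrite mulN1r; exact: H.
apply: measurable_funTS; apply: continuous_measurable_fun.
exact: (kernel_section_continuous xK xU M0 HM).
Qed.

(** Against densities of mean zero only the cross terms of a kernel of degree two survive. *)
Lemma bil_product (F G : R[i] -> R) (CF CG : R) f g :
  let a h := I0 (fun t => h t * F (x t)) in let b h := I0 (fun t => h t * G (x t)) in
  continuous (fun t : R => F (x t)) -> continuous (fun t : R => G (x t)) ->
  (forall t, `|F (x t)| <= CF) -> (forall t, `|G (x t)| <= CG) ->
  integ0 f -> integ0 g -> I0 f = 0 -> I0 g = 0 ->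
  Bil (fun z w => (F z - F w) * (G z - G w)) f g = - (a f * b g + b f * a g).
Proof.
move=> a b cF cG bF bG if_ ig f0 g0.
have iF h : integ0 h -> integ0 (fun t => h t * F (x t)) by move=> ih; exact: (integ_mulc ih cF bF).
have iG h : integ0 h -> integ0 (fun t => h t * G (x t)) by move=> ih; exact: (integ_mulc ih cG bG).
pose m := I0 (fun s => g s * F (x s) * G (x s)).
have potE z : Pot (fun z w => (F z - F w) * (G z - G w)) g z = m - (F z * b g + G z * a g).
  rewrite /pot (@RI_eq _ _ _ _ (fun s => F z * G z * g s +
     (g s * F (x s) * G (x s) - (F z * (g s * G (x s)) + G z * (g s * F (x s)))))); last first.
    by move=> s _; ring.
  have i1 := iF _ ig; have i2 := iG _ ig; have i3 := iG _ i1.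
  rewrite RID ?RIB ?RID ?RIZ ?g0 ?mulr0 ?add0r //; try exact: integZ; try (apply: integD; exact: integZ).
  by apply: integB => //; apply: integD; exact: integZ.
rewrite /bil (@RI_eq _ _ _ _ (fun t => m * f t - (b g * (f t * F (x t)) + a g * (f t * G (x t))))).
  have i1 := iF _ if_; have i2 := iG _ if_.
  rewrite RIB ?RID ?RIZ ?f0 ?mulr0 ?sub0r //; try exact: integZ; last by apply: integD; exact: integZ.
  by rewrite -/(a f) -/(b f); ring.
by move=> t _; rewrite potE; ring.
Qed.

Section large_tau.
Variables (f g : R -> R).
Hypotheses (if_ : integ0 f) (ig : integ0 g) (f0 : I0 f = 0) (g0 : I0 g = 0).

(** Up to a constant, which is invisible to densities of mean zero, these are the limits of [tau] times the
    regularized kernels as [tau] tends to infinity. *)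
Definition p11 z w := - (4 * (al + (al + be))) * dist2 z w + 8 * be * (dx z w * dx z w).
Definition p12 z w := 8 * be * (dx z w * dy z w).
Definition p22 z w := - (4 * (al + (al + be))) * dist2 z w + 8 * be * (dy z w * dy z w).

Lemma lipk_p11 : lipk p11.
Proof. exact: (lipkD (lipkZ _ lipk_dist2) (lipkZ _ (lipkM lipk_dx lipk_dx))). Qed.
Lemma lipk_p12 : lipk p12.
Proof. exact: (lipkZ _ (lipkM lipk_dx lipk_dy)). Qed.
Lemma lipk_p22 : lipk p22.
Proof. exact: (lipkD (lipkZ _ lipk_dist2) (lipkZ _ (lipkM lipk_dy lipk_dy))). Qed.

Lemma disc_dist z w : cabs z <= K -> cabs w <= K ->
  [/\ `|dx z w| <= 2 * K, `|dy z w| <= 2 * K & dist2 z w <= 8 * K ^+ 2].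
Proof.
move=> zK wK; have zw : cabs (z - w) <= 2 * K by have := cabsD z (- w); rewrite cabsN; lra.
have h1 : `|dx z w| <= 2 * K by apply: le_trans zw; rewrite /dx -ReN -ReD cabs_Re.
have h2 : `|dy z w| <= 2 * K by apply: le_trans zw; rewrite /dy -ImN -ImD cabs_Im.
split => //; rewrite /dist2 -[dx z w ^+ 2]real_normK ?num_real // -[dy z w ^+ 2]real_normK ?num_real //.
have := normr_ge0 (dx z w); have := normr_ge0 (dy z w); rewrite !expr2; nra.
Qed.

Lemma kdiag_large tau y rho : 1 <= tau -> 0 <= y <= rho ->
  `|tau * kdiag al be tau y - tau * (- (4 * al * ln tau) + 4 * (al + be)) - - (4 * (al + (al + be))) * y|
   <= (4 * al + 4 * (al + be)) * rho ^+ 2 / tau.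
Proof.
move=> t1 /andP[y0 yr]; have t0 : 0 < tau by lra.
have al0 : 0 <= al by have := A0; have := B0; lra.
have A0' := A0.
have R0 : 0 < y + tau by lra.
have u0 : 0 <= y / tau by rewrite divr_ge0 // ltW.
have lnE : ln (y + tau) = ln tau + ln (1 + y / tau).
  by rewrite -lnM ?posrE //; [congr ln; rewrite mulrDr mulr1 mulrCA divff ?gt_eqF // mulr1 addrC|lra].
set l := ln (1 + y / tau) in lnE.
have y2 : y ^+ 2 / tau <= rho ^+ 2 / tau.
  by rewrite ler_pM2r ?invr_gt0 // lerXn2r // nnegrE //; lra.
have uE : tau * (y / tau) = y by rewrite mulrC divfK // gt_eqF.
have l1 : tau * l <= y.
  rewrite -uE ler_pM2l //; have := expR_ge1Dx l; rewrite lnK ?posrE; lra.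
have l2 : y - y ^+ 2 / tau <= tau * l.
  have : 1 - (1 + y / tau)^-1 <= l.
    have v0 : 0 < 1 + y / tau by lra.
    have := expR_ge1Dx (- l); rewrite expRN lnK ?posrE //; lra.
  rewrite -(ler_pM2l t0) => h; apply: le_trans h.
  have -> : tau * (1 - (1 + y / tau)^-1) = y - y ^+ 2 / (y + tau).
    have tn : tau != 0 by rewrite gt_eqF.
    have Rn : y + tau != 0 by rewrite gt_eqF.
    have Rn' : tau + y != 0 by rewrite addrC.
    by field; rewrite ?tn ?Rn ?Rn'.
  rewrite lerD2l lerN2 ler_wpM2l ?sqr_ge0 // lef_pV2 ?posrE //; lra.
have m1 : 0 <= y - tau * (y / (y + tau)) <= y ^+ 2 / tau.
  have -> : y - tau * (y / (y + tau)) = y ^+ 2 / (y + tau) by field; rewrite gt_eqF.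
  rewrite divr_ge0 ?sqr_ge0 ?(ltW R0) //= ler_wpM2l ?sqr_ge0 // lef_pV2 ?posrE //; lra.
have -> : tau * kdiag al be tau y - tau * (- (4 * al * ln tau) + 4 * (al + be)) - - (4 * (al + (al + be))) * y
   = 4 * al * (y - tau * l) + 4 * (al + be) * (y - tau * (y / (y + tau))).
  by rewrite /kdiag lnE; field; rewrite gt_eqF.
case/andP: m1 => m1 m2.
have n1 : 0 <= y - tau * l by lra.
rewrite ger0_norm; last by rewrite addr_ge0 // mulr_ge0 // mulr_ge0.
rewrite (_ : (4 * al + 4 * (al + be)) * rho ^+ 2 / tau =
  4 * al * (rho ^+ 2 / tau) + 4 * (al + be) * (rho ^+ 2 / tau)); last by ring.
by apply: lerD; (apply: ler_wpM2l; first by rewrite mulr_ge0); lra.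
Qed.

Lemma kdir_large tau y rho p : 1 <= tau -> 0 <= y <= rho -> `|p| <= rho ->
  `|tau * (kdir be tau y * p) - 8 * be * p| <= 8 * `|be| * rho ^+ 2 / tau.
Proof.
move=> t1 /andP[y0 yr] pr; have t0 : 0 < tau by lra.
have R0 : 0 < y + tau by lra.
have -> : tau * (kdir be tau y * p) - 8 * be * p = - (8 * be * (y / (y + tau) * p)).
  by rewrite /kdir; field; rewrite gt_eqF.
rewrite normrN !normrM [`|8|]ger0_norm // [`|y|]ger0_norm // [`|_^-1|]gtr0_norm ?invr_gt0 //.
rewrite (_ : 8 * `|be| * rho ^+ 2 / tau = 8 * `|be| * (rho / tau * rho)); last by ring.
apply: ler_wpM2l; first by rewrite mulr_ge0.
apply: ler_pM => //; first by rewrite divr_ge0 // ltW.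
by apply: ler_pM => //; [rewrite invr_ge0 ltW|rewrite lef_pV2 ?posrE //; lra].
Qed.

(** The limit of [tau] times the energy. *)
Definition qform := 8 * (al + (al + be)) * (mom1 f ^+ 2 + mom2 f ^+ 2 + mom1 g ^+ 2 + mom2 g ^+ 2)
   - 16 * be * (mom1 f ^+ 2 + mom2 g ^+ 2 + mom1 f * mom2 g + mom2 f * mom1 g).

Lemma form_large : exists2 E, 0 <= E & forall tau, 1 <= tau -> `|tau * form tau f g - qform| <= E / tau.
Proof.
pose rho := 8 * K ^+ 2.
have rho0 : 0 <= rho by rewrite mulr_ge0 ?sqr_ge0.
have al0 : 0 <= al by have := A0; have := B0; lra.
have A0' := A0.
pose e1 := (4 * al + 4 * (al + be)) * rho ^+ 2 + 8 * `|be| * rho ^+ 2.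
have e10 : 0 <= e1 by rewrite addr_ge0 // mulr_ge0 ?sqr_ge0 // ?mulr_ge0 // addr_ge0 // mulr_ge0.
pose nf := I0 (fun t => `|f t|); pose ng := I0 (fun t => `|g t|).
have nf0 : 0 <= nf := RI_norm_ge0 _ _ _; have ng0 : 0 <= ng := RI_norm_ge0 _ _ _.
exists (e1 * (nf * nf + ng * nf + nf * ng + ng * ng)) => [|tau t1].
  by rewrite mulr_ge0 // !addr_ge0 // mulr_ge0.
have t0 : 0 < tau by lra.
pose c := tau * (- (4 * al * ln tau) + 4 * (al + be)).
have eta0 : 0 <= e1 / tau by rewrite divr_ge0 // ltW.
have bdx z w : cabs z <= K -> cabs w <= K -> `|dx z w * dx z w| <= rho /\ `|dx z w * dy z w| <= rho /\
    `|dy z w * dy z w| <= rho.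
  move=> zK wK; have [h1 h2 _] := disc_dist zK wK; rewrite !normrM.
  have := normr_ge0 (dx z w); have := normr_ge0 (dy z w); rewrite /rho expr2; do !split; nra.
have diag k k' d h1 h2 : integ0 h1 -> integ0 h2 -> I0 h1 = 0 ->
    k = (fun z w => kdiag al be tau (dist2 z w) + kdir be tau (dist2 z w) * d z w) ->
    k' = (fun z w => - (4 * (al + (al + be))) * dist2 z w + 8 * be * d z w) ->
    lipk k -> lipk k' -> (forall z w, cabs z <= K -> cabs w <= K -> `|d z w| <= rho) ->
    `|tau * Bil k h1 h2 - Bil k' h1 h2| <= e1 / tau * I0 (fun t => `|h2 t|) * I0 (fun t => `|h1 t|).
  move=> i1 i2 z1 kE kE' lk lk' db.
  have -> : tau * Bil k h1 h2 = Bil (fun z w => tau * k z w + - c) h1 h2.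
    rewrite (bilkD (lipkZ tau lk) (lipk_cst (- c)) i1 i2) (bil_cst _ i1 i2) z1 mul0r mulr0 addr0.
    by rewrite (bilkZ tau lk i1 i2).
  apply: bil_close => //; first by apply: lipkD; [exact: lipkZ|exact: lipk_cst].
  move=> z w zK wK; rewrite kE kE'.
  have [_ _ yr] := disc_dist zK wK.
  have yI : 0 <= dist2 z w <= rho by rewrite dist2_ge0.
  have H1 := kdiag_large t1 yI; have H2 := kdir_large t1 yI (db z w zK wK).
  rewrite (_ : _ - (_ + _) = (tau * kdiag al be tau (dist2 z w) - c - - (4 * (al + (al + be))) * dist2 z w)
    + (tau * (kdir be tau (dist2 z w) * d z w) - 8 * be * d z w)); last by ring.
  apply: le_trans (ler_normD _ _) _; apply: le_trans (lerD H1 H2) _.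
  by rewrite le_eqVlt; apply/orP; left; apply/eqP; rewrite /e1; ring.
have off h1 h2 : integ0 h1 -> integ0 h2 ->
    `|tau * Bil (k12 tau) h1 h2 - Bil p12 h1 h2| <= e1 / tau * I0 (fun t => `|h2 t|) * I0 (fun t => `|h1 t|).
  move=> i1 i2; have lk := lipk_k12 t0.
  rewrite -bilkZ //; apply: bil_close => //; [exact: lipkZ|exact: lipk_p12|].
  move=> z w zK wK; have [_ _ yr] := disc_dist zK wK.
  have yI : 0 <= dist2 z w <= rho by rewrite dist2_ge0.
  apply: le_trans (kdir_large t1 yI (bdx z w zK wK).2.1) _.
  rewrite ler_pM2r ?invr_gt0 // /e1 lerDr mulr_ge0 ?sqr_ge0 // addr_ge0 // mulr_ge0 //.
have q1 := diag _ _ _ f f if_ if_ f0 erefl erefl (lipk_k11 t0) lipk_p11 (fun z w zK wK => (bdx z w zK wK).1).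
have q4 := diag _ _ _ g g ig ig g0 erefl erefl (lipk_k22 t0) lipk_p22 (fun z w zK wK => (bdx z w zK wK).2.2).
have q2 := off f g if_ ig; have q3 := off g f ig if_.
have bxx h1 h2 : integ0 h1 -> integ0 h2 -> I0 h1 = 0 -> I0 h2 = 0 ->
    Bil (fun z w => dx z w * dx z w) h1 h2 = - (mom1 h1 * mom1 h2 + mom1 h1 * mom1 h2).
  move=> i1 i2 z1 z2; exact: (bil_product Rex_continuous Rex_continuous Rex_bounded Rex_bounded).
have bxy h1 h2 : integ0 h1 -> integ0 h2 -> I0 h1 = 0 -> I0 h2 = 0 ->
    Bil (fun z w => dx z w * dy z w) h1 h2 = - (mom1 h1 * mom2 h2 + mom2 h1 * mom1 h2).
  move=> i1 i2 z1 z2; exact: (bil_product Rex_continuous Imx_continuous Rex_bounded Imx_bounded).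
have byy h1 h2 : integ0 h1 -> integ0 h2 -> I0 h1 = 0 -> I0 h2 = 0 ->
    Bil (fun z w => dy z w * dy z w) h1 h2 = - (mom2 h1 * mom2 h2 + mom2 h1 * mom2 h2).
  move=> i1 i2 z1 z2; exact: (bil_product Imx_continuous Imx_continuous Imx_bounded Imx_bounded).
have bdd h : integ0 h -> I0 h = 0 -> Bil dist2 h h = - (2 * mom1 h ^+ 2 + 2 * mom2 h ^+ 2).
  move=> ih h0; rewrite -[dist2]/(fun z w => dx z w * dx z w + dy z w * dy z w).
  rewrite bilkD // ?bxx ?byy //; [ring|exact: (lipkM lipk_dx lipk_dx)|exact: (lipkM lipk_dy lipk_dy)].
have b11 : Bil p11 f f = - (4 * (al + (al + be))) * Bil dist2 f f + 8 * be * Bil (fun z w => dx z w * dx z w) f f.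
  have l1 := lipkM lipk_dx lipk_dx; have l2 := lipk_dist2.
  by rewrite /p11 (bilkD (lipkZ _ l2) (lipkZ _ l1) if_ if_) (bilkZ _ l2 if_ if_) (bilkZ _ l1 if_ if_).
have b22 : Bil p22 g g = - (4 * (al + (al + be))) * Bil dist2 g g + 8 * be * Bil (fun z w => dy z w * dy z w) g g.
  have l1 := lipkM lipk_dy lipk_dy; have l2 := lipk_dist2.
  by rewrite /p22 (bilkD (lipkZ _ l2) (lipkZ _ l1) ig ig) (bilkZ _ l2 ig ig) (bilkZ _ l1 ig ig).
have b12 h1 h2 : integ0 h1 -> integ0 h2 -> Bil p12 h1 h2 = 8 * be * Bil (fun z w => dx z w * dy z w) h1 h2.
  by move=> *; rewrite /p12 bilkZ //; exact: (lipkM lipk_dx lipk_dy).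
rewrite b11 bdd // bxx // in q1; rewrite b22 bdd // byy // in q4.
rewrite b12 // bxy // in q2; rewrite b12 // bxy // in q3.
rewrite /form /qform.
move: q1 q2 q3 q4; rewrite -/nf -/ng.
move: (Bil (k11 tau) f f) (Bil (k12 tau) f g) (Bil (k12 tau) g f) (Bil (k22 tau) g g) => v1 v2 v3 v4.
move: (mom1 f) (mom2 f) (mom1 g) (mom2 g) => m1 m2 m3 m4.
move: nf ng e1 {nf0 ng0 e10 eta0 diag off} => nf ng e1.
set u := e1 / tau.
rewrite (_ : e1 * (nf * nf + ng * nf + nf * ng + ng * ng) / tau = u * nf * nf + u * ng * nf + u * nf * ng + u * ng * ng); last by rewrite /u; ring.
move=> q1 q2 q3 q4; have := lerD (lerD (lerD q1 q2) q3) q4; apply: le_trans.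
apply: le_trans (_ : _ <= _) ; last first.
  by apply: le_trans (ler_normD _ _) _; apply: lerD => //; apply: le_trans (ler_normD _ _) _; apply: lerD => //;
     exact: ler_normD.
by rewrite le_eqVlt; apply/orP; left; apply/eqP; congr `|_|; ring.
Qed.

End large_tau.

(** When the torque vanishes, the two mixed moments agree and the form is a positive combination of squares. *)
Lemma qform_eq0 f g : 0 < al - be -> 0 < al -> mom2 f = mom1 g -> qform f g <= 0 ->
  [/\ mom1 f = 0, mom2 f = 0, mom1 g = 0 & mom2 g = 0].
Proof.
move=> B0' al0 E; rewrite /qform E => H.
have be_al : be < al by lra.
have A0' := A0.
have s1 := sqr_ge0 (mom1 f); have s2 := sqr_ge0 (mom2 g); have s3 := sqr_ge0 (mom1 g).
have s4 := sqr_ge0 (mom1 f + mom2 g); have s5 := sqr_ge0 (mom1 f - mom2 g).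
have key : 8 * ((al - be) * (mom1 f + mom2 g) ^+ 2 + al * (mom1 f - mom2 g) ^+ 2 + 4 * al * mom1 g ^+ 2) <= 0.
  apply: le_trans H; rewrite -subr_ge0.
  have -> : forall p q r : R, 8 * (al + (al + be)) * (p ^+ 2 + r ^+ 2 + r ^+ 2 + q ^+ 2) - 16 * be * (p ^+ 2 + q ^+ 2 + p * q + r * r) -
    8 * ((al - be) * (p + q) ^+ 2 + al * (p - q) ^+ 2 + 4 * al * r ^+ 2) = 0 by move=> p q r; ring.
  by [].
have t1 : 0 <= (al - be) * (mom1 f + mom2 g) ^+ 2 by rewrite mulr_ge0.
have t2 : 0 <= al * (mom1 f - mom2 g) ^+ 2 by rewrite mulr_ge0 // ltW.
have t3 : 0 <= 4 * al * mom1 g ^+ 2 by rewrite mulr_ge0 // mulr_ge0 // ltW.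
have z1 : (al - be) * (mom1 f + mom2 g) ^+ 2 = 0 by apply/le_anti/andP; split => //; lra.
have z2 : al * (mom1 f - mom2 g) ^+ 2 = 0 by apply/le_anti/andP; split => //; lra.
have z3 : 4 * al * mom1 g ^+ 2 = 0 by apply/le_anti/andP; split => //; lra.
move/eqP: z1; rewrite mulf_eq0 gt_eqF //= expf_eq0 /= => /eqP z1.
move/eqP: z2; rewrite mulf_eq0 gt_eqF //= expf_eq0 /= => /eqP z2.
move/eqP: z3; rewrite mulf_eq0 gt_eqF ?mulr_gt0 //= expf_eq0 /= => /eqP z3.
split => //; lra.
Qed.

End kelvin_forms.


(** * Uniqueness and reciprocity *)

Section densities.
Variable R : realType.
Implicit Types (f g : R -> R) (z w : R[i]) (tau : R).
Variables (L : R) (x : R -> R[i]) (K : R).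
Hypothesis L0 : 0 < L.
Hypothesis xK : forall t, cabs (x t) <= K.
Hypothesis xU : forall e, 0 < e -> exists2 d, 0 < d &
  forall s t, `|s - t| < d -> cabs (x s - x t) < e.
Variables (al be : R).
Hypothesis A0 : 0 <= al + be.
Hypothesis B0 : 0 < al - be.
Hypothesis al0 : 0 < al.
Let B0' : 0 <= al - be.
Proof. exact: ltW. Qed.

Local Notation integ0 f := (integ 0 L f).
Local Notation I0 f := (RI 0 L f).
Local Notation Bil k f g := (bil L x k f g).
Local Notation Pot k g z := (pot L x k g z).
Local Notation K11 := (k11 al be).
Local Notation K12 := (@k12 R be).
Local Notation K22 := (k22 al be).
Local Notation Mom1 f := (mom1 L x f).
Local Notation Mom2 f := (mom2 L x f).

(** The rate at which the regularized potentials converge. The exponent 1/8 is small enough for the singular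
    weight that comes with it, [r^(-1/4)], to be integrable against a square integrable density. *)
Definition qroot (tau : R) : R := Num.sqrt (Num.sqrt (Num.sqrt tau)).

Lemma qroot_ge0 tau : 0 <= qroot tau. Proof. exact: sqrtr_ge0. Qed.

Lemma qroot_small (X C : R) : (forall tau, 0 < tau <= 1 -> X <= C * qroot tau) -> X <= 0.
Proof.
move=> H; rewrite leNgt; apply/negP => X0.
pose s := Num.min 1 (X / (2 * (`|C| + 1))).
have C1 : 0 < `|C| + 1 by rewrite ltr_wpDl.
have s0 : 0 < s by rewrite lt_min ltr01 divr_gt0 // mulr_gt0.
have s1 : s <= 1 by rewrite ge_min lexx.
have s2 : s * (2 * (`|C| + 1)) <= X by rewrite -ler_pdivlMr ?mulr_gt0 // ge_min lexx orbT.
have := H (s ^+ 8); rewrite exprn_gt0 //= exprn_ile1 ?(ltW s0) // => /(_ isT).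
have -> : qroot (s ^+ 8) = s.
  rewrite /qroot (_ : s ^+ 8 = ((s ^+ 2) ^+ 2) ^+ 2); last by ring.
  by do 3 rewrite sqrtr_sqr ger0_norm ?sqr_ge0 ?(ltW s0) //.
have := ler_norm C; nra.
Qed.

Definition pot1 tau f g z := Pot (K11 tau) f z + Pot (K12 tau) g z.
Definition pot2 tau f g z := Pot (K12 tau) f z + Pot (K22 tau) g z.

(** The trace of the potential on the curve is expressed through the regularized potentials, so that the singular
    kernel is never evaluated on the curve. Potentials are [- 16 pi] times the elastic ones. *)
Record affine_density (a1 b1 c1 a2 b2 c2 : R) f g : Prop := AffineDensity {
  ad_integ1 : integ0 f;
  ad_integ2 : integ0 g;
  ad_mean1 : I0 f = 0;
  ad_mean2 : I0 g = 0;
  ad_torque : Mom2 f = Mom1 g;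
  ad_trace : exists C, forall tau t, 0 < tau <= 1 ->
    `|pot1 tau f g (x t) - (a1 + b1 * complex.Re (x t) + c1 * complex.Im (x t))| <= C * qroot tau /\
    `|pot2 tau f g (x t) - (a2 + b2 * complex.Re (x t) + c2 * complex.Im (x t))| <= C * qroot tau }.

Lemma mom1_lin p f f' : integ0 f -> integ0 f' -> Mom1 (fun t => f t + p * f' t) = Mom1 f + p * Mom1 f'.
Proof.
move=> jf jf'; have z := integZ p (integ_Rex xK xU jf').
rewrite /mom1 (@RI_eq _ _ _ _ (fun t => f t * complex.Re (x t) + p * (f' t * complex.Re (x t)))).
  by rewrite RID ?RIZ //; exact: integ_Rex.
by move=> t _; ring.
Qed.

Lemma mom2_lin p f f' : integ0 f -> integ0 f' -> Mom2 (fun t => f t + p * f' t) = Mom2 f + p * Mom2 f'.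
Proof.
move=> jf jf'; have z := integZ p (integ_Imx xK xU jf').
rewrite /mom2 (@RI_eq _ _ _ _ (fun t => f t * complex.Im (x t) + p * (f' t * complex.Im (x t)))).
  by rewrite RID ?RIZ //; exact: integ_Imx.
by move=> t _; ring.
Qed.

Lemma affine_density_lin (p a1 b1 c1 a2 b2 c2 a1' b1' c1' a2' b2' c2' : R) f g f' g' :
  affine_density a1 b1 c1 a2 b2 c2 f g -> affine_density a1' b1' c1' a2' b2' c2' f' g' ->
  affine_density (a1 + p * a1') (b1 + p * b1') (c1 + p * c1') (a2 + p * a2') (b2 + p * b2') (c2 + p * c2')
    (fun t => f t + p * f' t) (fun t => g t + p * g' t).
Proof.
move=> [i1 i2 m1 m2 t12 [C HC]] [i1' i2' m1' m2' t12' [C' HC']].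
have z1 := integZ p i1'; have z2 := integZ p i2'.
split.
- exact: integD.
- exact: integD.
- by rewrite RID // RIZ // m1 m1' mulr0 addr0.
- by rewrite RID // RIZ // m2 m2' mulr0 addr0.
- by rewrite mom2_lin // mom1_lin // t12 t12'.
exists (C + `|p| * C') => tau t tI; have [h1 h2] := HC tau t tI; have [h1' h2'] := HC' tau t tI.
have t0 : 0 < tau by case/andP: tI.
have potE k h h' : lipk K k -> integ0 h -> integ0 h' ->
    Pot k (fun t => h t + p * h' t) (x t) = Pot k h (x t) + p * Pot k h' (x t).
  move=> [M M0 HM] ih ih'; rewrite (potD xK xU M0 HM) //; last exact: integZ.
  by rewrite (potZ xK xU _ M0 HM).
have l11 := lipk_k11 (x := x) xK al be t0; have l12 := lipk_k12 (x := x) xK be t0.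
have l22 := lipk_k22 (x := x) xK al be t0.
rewrite /pot1 /pot2 !potE //; split.
  rewrite (_ : _ - _ = (pot1 tau f g (x t) - (a1 + b1 * complex.Re (x t) + c1 * complex.Im (x t))) +
    p * (pot1 tau f' g' (x t) - (a1' + b1' * complex.Re (x t) + c1' * complex.Im (x t)))); last by rewrite /pot1; ring.
  apply: le_trans (ler_normD _ _) _; rewrite mulrDl normrM -mulrA; apply: lerD => //; exact: ler_wpM2l.
rewrite (_ : _ - _ = (pot2 tau f g (x t) - (a2 + b2 * complex.Re (x t) + c2 * complex.Im (x t))) +
  p * (pot2 tau f' g' (x t) - (a2' + b2' * complex.Re (x t) + c2' * complex.Im (x t)))); last by rewrite /pot2; ring.
apply: le_trans (ler_normD _ _) _; rewrite mulrDl normrM -mulrA; apply: lerD => //; exact: ler_wpM2l.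
Qed.

(** The polarized energy. *)
Definition mixed tau f g f' g' :=
  Bil (K11 tau) f f' + Bil (K12 tau) f g' + Bil (K12 tau) g f' + Bil (K22 tau) g g'.

Lemma mixed_sym tau f g f' g' : 0 < tau -> integ0 f -> integ0 g -> integ0 f' -> integ0 g' ->
  mixed tau f g f' g' = mixed tau f' g' f g.
Proof.
move=> t0 i1 i2 i1' i2'; rewrite /mixed.
have dxN (z w : R[i]) : dx w z = - dx z w by rewrite /dx opprB.
have dyN (z w : R[i]) : dy w z = - dy z w by rewrite /dy opprB.
have dS (z w : R[i]) : dist2 w z = dist2 z w by rewrite /dist2 dxN dyN !sqrrN.
have sym k h h' : lipk K k -> (forall z w, k w z = k z w) -> integ0 h -> integ0 h' -> Bil k h h' = Bil k h' h.
  move=> [M M0 HM] ks ih ih'; have kE : (fun z w => k w z) = k.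
    by apply/funext => z; apply/funext => w; exact: ks.
  by have := bil_sym L0 xK xU M0 HM ih ih'; rewrite kE.
have l11 := lipk_k11 (x := x) xK al be t0; have l12 := lipk_k12 (x := x) xK be t0.
have l22 := lipk_k22 (x := x) xK al be t0.
have s11 z w : K11 tau w z = K11 tau z w by rewrite /k11 dS dxN mulrNN.
have s12 z w : K12 tau w z = K12 tau z w by rewrite /k12 dS dxN dyN mulrNN.
have s22 z w : K22 tau w z = K22 tau z w by rewrite /k22 dS dyN mulrNN.
have e1 := sym _ _ _ l11 s11 i1 i1'; have e2 := sym _ _ _ l12 s12 i1 i2'.
have e3 := sym _ _ _ l12 s12 i2 i1'; have e4 := sym _ _ _ l22 s22 i2 i2'.
have swap (v1 v2 v3 v4 w1 w2 w3 w4 : R) : v1 = w1 -> v2 = w2 -> v3 = w3 -> v4 = w4 ->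
  v1 + v2 + v3 + v4 = w1 + w3 + w2 + w4 by move=> -> -> -> ->; ring.
exact: swap.
Qed.

(** The potential of [(f', g')] tends uniformly to an affine field on the curve; its pairing with a density of
    mean zero tends to a combination of moments. *)
Lemma mixed_limit a1 b1 c1 a2 b2 c2 f' g' f g : affine_density a1 b1 c1 a2 b2 c2 f' g' ->
  integ0 f -> integ0 g -> I0 f = 0 -> I0 g = 0 ->
  exists C, forall tau, 0 < tau <= 1 ->
   `|mixed tau f g f' g' - (b1 * Mom1 f + c1 * Mom2 f + b2 * Mom1 g + c2 * Mom2 g)| <= C * qroot tau.
Proof.
move=> [i1' i2' m1' m2' _ [C HC]] i1 i2 m1 m2.
exists (C * I0 (fun t => `|f t|) + C * I0 (fun t => `|g t|)) => tau tI.
have t0 : 0 < tau by case/andP: tI.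
have Cq0 : 0 <= C * qroot tau by apply: le_trans (normr_ge0 _) (HC tau 0 tI).1.
have [M11 M110 l11] := lipk_k11 (x := x) xK al be t0.
have [M12 M120 l12] := lipk_k12 (x := x) xK be t0.
have [M22 M220 l22] := lipk_k22 (x := x) xK al be t0.
have cR := Rex_continuous xU; have cI := Imx_continuous xU.
have ct (a b c : R) : continuous (fun t : R => a + b * complex.Re (x t) + c * complex.Im (x t)).
  move=> t; apply: cvgD; last by apply: cvgM; [exact: cvg_cst|exact: cI].
  by apply: cvgD; [exact: cvg_cst|apply: cvgM; [exact: cvg_cst|exact: cR]].
have c11 := pot_continuous xK xU M110 l11 i1'; have c12 := pot_continuous xK xU M120 l12 i2'.
have c12' := pot_continuous xK xU M120 l12 i1'; have c22 := pot_continuous xK xU M220 l22 i2'.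
have cp1 : continuous (fun t : R => pot1 tau f' g' (x t) - (a1 + b1 * complex.Re (x t) + c1 * complex.Im (x t))).
  by move=> t; apply: cvgB; [apply: cvgD; [exact: c11|exact: c12]|exact: ct].
have cp2 : continuous (fun t : R => pot2 tau f' g' (x t) - (a2 + b2 * complex.Re (x t) + c2 * complex.Im (x t))).
  by move=> t; apply: cvgB; [apply: cvgD; [exact: c12'|exact: c22]|exact: ct].
have split1 h P Q a b c : integ0 h -> I0 h = 0 -> integ0 (fun t => h t * P t) -> integ0 (fun t => h t * Q t) ->
    I0 (fun t => h t * P t) + I0 (fun t => h t * Q t) - (b * Mom1 h + c * Mom2 h) =
    I0 (fun t => h t * (P t + Q t - (a + b * complex.Re (x t) + c * complex.Im (x t)))).
  move=> ih h0 iP iQ; have iR := integ_Rex xK xU ih; have iI := integ_Imx xK xU ih.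
  rewrite (@RI_eq _ _ _ (fun t => h t * (P t + Q t - (a + b * complex.Re (x t) + c * complex.Im (x t))))
    (fun t => (h t * P t + h t * Q t) - (a * h t + (b * (h t * complex.Re (x t)) + c * (h t * complex.Im (x t))))));
    last by move=> t _; ring.
  have zR := integZ b iR; have zI := integZ c iI; have zh := integZ a ih.
  rewrite RIB; [|exact: integD|by apply: integD => //; exact: integD].
  by rewrite RID // (RID zh (integD zR zI)) (RID zR zI) !RIZ // h0 mulr0 add0r.
have e1 := split1 f _ _ a1 b1 c1 i1 m1 (integ_pot xK xU M110 l11 i1 i1') (integ_pot xK xU M120 l12 i1 i2').
have e2 := split1 g _ _ a2 b2 c2 i2 m2 (integ_pot xK xU M120 l12 i2 i1') (integ_pot xK xU M220 l22 i2 i2').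
have reg (v1 v2 v3 v4 p q r s u w : R) : v1 + v2 - (p + q) = u -> v3 + v4 - (r + s) = w ->
  v1 + v2 + v3 + v4 - (p + q + r + s) = u + w by move=> <- <-; ring.
rewrite /mixed (reg _ _ _ _ _ _ _ _ _ _ e1 e2); apply: le_trans (ler_normD _ _) _.
rewrite mulrDl -!mulrA [I0 _ * _]mulrC [X in _ + _ * X]mulrC !mulrA.
apply: lerD; apply: RI_mul_le => //; try (by apply: measurable_funTS; exact: continuous_measurable_fun).
  by move=> t _; exact: (HC tau t tI).1.
by move=> t _; exact: (HC tau t tI).2.
Qed.

(** Reciprocity: both sides are limits of the same mixed energy, by [mixed_sym]. *)
Lemma affine_density_sym a1 b1 c1 a2 b2 c2 f g a1' b1' c1' a2' b2' c2' f' g' :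
  affine_density a1 b1 c1 a2 b2 c2 f g -> affine_density a1' b1' c1' a2' b2' c2' f' g' ->
  b1 * Mom1 f' + c1 * Mom2 f' + b2 * Mom1 g' + c2 * Mom2 g' =
  b1' * Mom1 f + c1' * Mom2 f + b2' * Mom1 g + c2' * Mom2 g.
Proof.
move=> d d'; have [i1 i2 m1 m2 _ _] := d; have [i1' i2' m1' m2' _ _] := d'.
have [C HC] := mixed_limit d i1' i2' m1' m2'; have [C' HC'] := mixed_limit d' i1 i2 m1 m2.
set u := (X in X = _); set v := (X in _ = X).
apply/eqP; rewrite -subr_eq0 -normr_eq0 eq_le normr_ge0 andbT.
apply: (@qroot_small _ (C + C')) => tau tI; have t0 : 0 < tau by case/andP: tI.
have := HC tau tI; rewrite (mixed_sym t0 i1' i2' i1 i2) -/u => h; have := HC' tau tI; rewrite -/v => h'.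
rewrite (_ : u - v = (mixed tau f g f' g' - v) - (mixed tau f g f' g' - u)); last by ring.
by apply: le_trans (ler_normB _ _) _; rewrite mulrDl addrC; exact: lerD.
Qed.

(** Uniqueness up to rigid displacements. As [tau] tends to 0 the energy tends to the work of a rigid
    displacement, which is 0 for a density of zero force and torque; since the energy is nonincreasing, it is
    nonpositive. But as [tau] tends to infinity, [tau] times the energy tends to a positive definite form in the
    moments. *)
Lemma affine_density_rigid a1 a2 c f g : affine_density a1 0 c a2 (- c) 0 f g ->
  [/\ Mom1 f = 0, Mom2 f = 0, Mom1 g = 0 & Mom2 g = 0].
Proof.
move=> d; have [i1 i2 m1 m2 t12 _] := d.
have [C HC] := mixed_limit d i1 i2 m1 m2.
have qmono s t : s <= t -> qroot s <= qroot t by move=> st; rewrite /qroot; do 3 apply: ler_wsqrtr.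
have form_le0 tau : 0 < tau -> form L x al be tau f g <= 0.
  move=> t0; apply: (@qroot_small _ `|C|) => t1 t1I; have t10 : 0 < t1 by case/andP: t1I.
  have s0 : 0 < Num.min tau t1 by rewrite lt_min t0.
  have sI : 0 < Num.min tau t1 <= 1.
    by rewrite s0 /=; case/andP: t1I => _; apply: le_trans; rewrite ge_min lexx orbT.
  have st : Num.min tau t1 <= tau by rewrite ge_min lexx.
  apply: (le_trans (form_nonincreasing L0 xK xU A0 B0' i1 i2 s0 st)).
  have := HC _ sI; rewrite t12 (_ : 0 * _ + _ * _ + _ * _ + _ = 0); last by ring.
  rewrite subr0 => h; apply: le_trans (ler_norm _) _; apply: le_trans h _.
  apply: (@le_trans _ _ (`|C| * qroot (Num.min tau t1))).
    by apply: ler_wpM2r; [exact: qroot_ge0|exact: ler_norm].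
  by apply: ler_wpM2l => //; apply: qmono; rewrite ge_min lexx orbT.
apply: (qform_eq0 A0 B0' B0 al0 t12).
have [E E0 HE] := form_large xK xU A0 B0' i1 i2 m1 m2.
apply/ler_addgt0Pr => e e0; rewrite add0r.
pose tau := 1 + E / e.
have t1 : 1 <= tau by rewrite lerDl divr_ge0 // ltW.
have t0 : 0 < tau := lt_le_trans ltr01 t1.
have := HE tau t1; have := form_le0 tau t0 => h1.
have h2 : E / tau <= e.
  rewrite ler_pdivrMr // /tau mulrDr mulr1 mulrCA divff ?gt_eqF // mulr1; lra.
have h3 : tau * form L x al be tau f g <= 0 by rewrite mulr_ge0_le0 // ltW.
rewrite ler_norml => /andP[h4 _]; lra.
Qed.

(** Linear relations between boundary traces, modulo rigid displacements, hold between the moments. *)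
Lemma affine_density_rigid3 (p q a1 b1 c1 a2 b2 c2 a1' b1' c1' a2' b2' c2' a1'' b1'' c1'' a2'' b2'' c2'' : R)
    f g f' g' f'' g'' :
  affine_density a1 b1 c1 a2 b2 c2 f g -> affine_density a1' b1' c1' a2' b2' c2' f' g' ->
  affine_density a1'' b1'' c1'' a2'' b2'' c2'' f'' g'' ->
  b1 + p * b1' + q * b1'' = 0 -> c2 + p * c2' + q * c2'' = 0 ->
  b2 + p * b2' + q * b2'' = - (c1 + p * c1' + q * c1'') ->
  [/\ Mom1 f + p * Mom1 f' + q * Mom1 f'' = 0, Mom2 f + p * Mom2 f' + q * Mom2 f'' = 0,
      Mom1 g + p * Mom1 g' + q * Mom1 g'' = 0 & Mom2 g + p * Mom2 g' + q * Mom2 g'' = 0].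
Proof.
move=> d d' d'' e1 e2 e3; have := affine_density_lin q (affine_density_lin p d d') d''.
rewrite e1 e2 e3 => /affine_density_rigid.
have [jf jg _ _ _ _] := d; have [jf' jg' _ _ _ _] := d'; have [jf'' jg'' _ _ _ _] := d''.
have hf := integD jf (integZ p jf'); have hg := integD jg (integZ p jg').
by rewrite !(mom1_lin _ hf, mom1_lin _ hg, mom2_lin _ hf, mom2_lin _ hg) // !mom1_lin // !mom2_lin.
Qed.

End densities.


(** * Integrability of boundary densities *)

Section boundary_densities.
Variable R : realType.
Variables (D : set 'rV[R]_2) (gam : R) (Phi : R[i] -> R[i]) (a : nat -> R[i]).
Hypothesis Phi_ext : exterior_conformal_map D gam Phi a.
Hypothesis oD : open D.
Hypothesis lipD : lipschitz_boundary D.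
Implicit Types (w z p u : R[i]) (s t tau : R).
Local Notation mu := (@lebesgue_measure R).
Local Notation b := (bcurve gam Phi).
Local Notation h := (scale_factor gam Phi).
Local Notation L := (2 * pi : R).
Local Notation integ0 f := (integ 0 L f).
Local Notation I0 f := (RI 0 L f).
Let g0 : 0 < gam.
Proof. exact: ecm_gam_gt0 Phi_ext. Qed.

Lemma measurable_inv : measurable_fun (setT : set R) (fun x : R => x^-1).
Proof.
have -> : setT = [set 0 : R] `|` [set~ 0].
  by apply/seteqP; split => // x _; have [->|/eqP x0] := eqVneq x 0; [left|right].
apply/measurable_funU; [exact: measurable_set1|by apply: measurableC; exact: measurable_set1|split].
  exact: measurable_fun_set1.
apply: open_continuous_measurable_fun; first by apply: closed_openC; exact: closed_eq.
by move=> x; rewrite inE /= => x0; apply: inv_continuous; apply/eqP.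
Qed.

Lemma bcurve_uniform e : 0 < e -> exists2 d, 0 < d & forall s t, `|s - t| < d -> cabs (b s - b t) < e.
Proof.
move=> e0; have [d d0 Hd] := @Phi_uniform _ _ _ _ _ Phi_ext gam e e0.
have dg0 : 0 < d / gam by rewrite divr_gt0.
have [d' d'0 Hd'] := @expi_continuous R 0 _ dg0.
exists d' => // s t st; apply: Hd; rewrite ?cabs_circle ?lexx //; try exact: ltW.
have := Hd' (s - t); rewrite subr0 => /(_ st) H.
rewrite -mulrBr cabsM cabs_real gtr0_norm // mulrC -ltr_pdivlMr //.
apply: le_lt_trans H; rewrite -[leRHS]mulr1 -(cabs_expi t) -cabsM mulrBl -expiD subrK expi0 mul1r.
exact: lexx.
Qed.

Lemma bcurve_bounded : exists2 K, 0 <= K & forall t, cabs (b t) <= K.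
Proof.
have [K K0 HK] := @Phi_bounded _ _ _ _ _ Phi_ext gam.
by exists K => // t; apply: HK; rewrite cabs_circle ?lexx // ltW.
Qed.

Lemma exterior_near_curve t e : 0 < e -> exists2 z, exterior D (ofC z) & cabs (z - b t) < e.
Proof.
move=> e0; have [|w' [gw _ H]] := @Phi_radial _ _ _ _ _ Phi_ext (gam%:C * expi t) e _ e0.
  by rewrite cabs_circle // ltW.
by exists (Phi w') => //; exact: (Phi_exterior Phi_ext).
Qed.

Lemma exterior_curve_neq z t : exterior D (ofC z) -> 0 < cabs (b t - z).
Proof.
move=> ez; rewrite cabs_gt0 subr_eq0; apply/eqP => E; apply: ez; rewrite -E.
have [] // : bdry D (ofC (b t)); apply: (Phi_bdry Phi_ext); by rewrite cabs_circle // ltW.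
Qed.

(** Off a finite set, hence almost everywhere, [majorant] bounds the integrand. The constant does not depend on
    the exterior point [z]. *)
Lemma dominated_integrable (q : R -> R) : integ0 q -> exists2 C : R, 0 <= C &
  forall z (F : R -> R), exterior D (ofC z) -> measurable_fun `[0, L] F ->
  (forall t, 0 <= t <= L -> 0 <= F t <= q t + (1 + (Num.sqrt (cabs (b t - z)))^-1) * h t) ->
  integ0 F /\ I0 F <= C.
Proof.
move=> iq; have [C C0 HC] := majorant Phi_ext oD lipD.
exists (I0 (fun t => `|q t|) + C) => [|z F ez mF HF]; first by rewrite addr_ge0 ?RI_norm_ge0.
have [G [S [mG G0 iG HG]]] := HC z ez.
have mF' : measurable_fun `[0, L] (EFin \o F) by apply/measurable_EFinP.
have miq := integ_norm iq.
have le : (\int[mu]_(t in `[0%R, L]) (F t)%:E <= (I0 (fun t => `|q t|) + C)%:E)%E.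
  apply: (@le_trans _ _ (\int[mu]_(t in `[0%R, L]) (`|q t|%:E + G t))%E).
    apply: ae_ge0_le_integral => //.
    - by move=> t /=; rewrite in_itv /= lee_fin => /HF/andP[].
    - by move=> t _; rewrite adde_ge0 // lee_fin.
    - by apply: emeasurable_funD; [exact: measurable_int miq|exact: measurable_funTS].
    exists [set` S]; split.
    - by apply: countable_measurable => [x|]; [exact: measurable_set1|exact: (finite_set_countable (finite_seq S))].
    - exact: countable_lebesgue_measure0 (finite_set_countable (finite_seq S)).
    move=> t /= nH; apply: contrapT => tS; apply: nH; rewrite in_itv /= => tI.
    have tS' : t \notin S by apply/negP.
    have /andP[_ h1] := HF t tI; have h2 := HG t tI tS'.
    apply: (@le_trans _ _ (`|q t|%:E + ((1 + (Num.sqrt (cabs (b t - z)))^-1) * h t)%:E)%E).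
      by rewrite -EFinD lee_fin; apply: le_trans h1 _; rewrite lerD2r ler_norm.
    by rewrite leeD2l.
  rewrite ge0_integralD //; first last.
  - exact: measurable_funTS.
  - exact: measurable_int miq.
  rewrite EFinD; apply: leeD.
    by rewrite /RI /Rintegral fineK // integrable_fin_num.
  by apply: le_trans iG; apply: ge0_subset_integral.
have F0 t : t \in `[0, L] -> (0 <= (F t)%:E)%E by rewrite in_itv /= lee_fin => /HF/andP[].
have iF : integ0 F.
  apply/integrableP; split => //; apply: le_lt_trans (ltry (I0 (fun t => `|q t|) + C)); apply: le_trans le.
  rewrite le_eqVlt; apply/orP; left; apply/eqP; apply: eq_integral => t; rewrite inE /= => /F0.
  by rewrite lee_fin => ?; rewrite ger0_norm.
split=> //; have fn : (\int[mu]_(t in `[0%R, L]) (F t)%:E)%E \is a fin_num by exact: integrable_fin_num.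
by rewrite -lee_fin /RI /Rintegral fineK.
Qed.

End boundary_densities.


(** * From the regularized to the singular potential *)

Section regularization_defect.
Variable R : realType.
Implicit Types (tau y p : R).

Lemma qrootX y : 0 <= y -> qroot y ^+ 8 = y.
Proof.
move=> y0; rewrite /qroot (_ : forall v : R, v ^+ 8 = ((v ^+ 2) ^+ 2) ^+ 2); last by move=> v; ring.
by rewrite !sqr_sqrtr ?sqrtr_ge0.
Qed.

Lemma qrootV y : 0 <= y -> qroot y^-1 = (qroot y)^-1.
Proof. by move=> y0; rewrite /qroot !sqrtrV ?sqrtr_ge0. Qed.

Lemma qrootM y p : 0 <= y -> qroot (y * p) = qroot y * qroot p.
Proof. by move=> y0; rewrite /qroot !sqrtrM ?sqrtr_ge0. Qed.

Lemma qroot_gt0 y : 0 < y -> 0 < qroot y.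
Proof. by move=> y0; rewrite /qroot !sqrtr_gt0. Qed.

(** From [1 + X ^ 8 <= (1 + X) ^ 8] with [X = qroot y]. *)
Lemma ln_qroot y : 0 < y -> 0 <= ln (1 + y) <= 8 * qroot y.
Proof.
move=> y0; rewrite ln_ge0; last by lra.
set X := qroot y; have X0 : 0 < X := qroot_gt0 y0; have XE : X ^+ 8 = y by rewrite qrootX // ltW.
have X1 : 0 < 1 + X by lra.
have le1 : ln (1 + y) <= ln ((1 + X) ^+ 8).
  rewrite ler_ln ?posrE ?exprn_gt0 //; last by lra.
  have sup (m : nat) : 1 + X ^+ m.+1 <= (1 + X) ^+ m.+1.
    elim: m => [|m IH]; first by rewrite !expr1.
    rewrite exprS [leRHS]exprS; have := exprn_gt0 m.+1 X0; nra.
  by rewrite -XE.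
apply: le_trans le1 _; rewrite lnXn // -[ln _ *+ _]mulr_natl ler_wpM2l //.
by apply: le_ln1Dx; lra.
Qed.

Lemma ratio_qroot y : 0 < y -> 0 <= y / (1 + y) <= qroot y.
Proof.
move=> y0; have y1 : 0 < 1 + y by lra.
rewrite divr_ge0 ?(ltW y0) ?(ltW y1) //= ler_pdivrMr //.
set X := qroot y; have X0 : 0 < X := qroot_gt0 y0; have XE : X ^+ 8 = y by rewrite qrootX // ltW.
have [x1|x1] := lerP X 1.
  have : X ^+ 8 <= X by rewrite exprS ger_pMr // exprn_ile1 // ltW.
  rewrite XE; nra.
nra.
Qed.

Lemma kdiag_defect al be tau y : 0 <= al -> 0 <= al + be -> 0 < tau -> 0 < y ->
  `|kdiag al be tau y + 4 * al * ln y| <= (32 * al + 4 * (al + be)) * (qroot tau * (qroot y)^-1).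
Proof.
move=> al0 A0 t0 y0; have ty : 0 < tau / y by rewrite divr_gt0.
have -> : qroot tau * (qroot y)^-1 = qroot (tau / y) by rewrite qrootM ?qrootV // ltW.
have lnE : ln (y + tau) = ln y + ln (1 + tau / y).
  rewrite -lnM ?posrE //; last by lra.
  by congr ln; rewrite mulrDr mulr1 mulrC divfK // gt_eqF.
have rE : tau / (y + tau) = (tau / y) / (1 + tau / y) by field; apply/andP; split; rewrite ?gt_eqF //; lra.
have /andP[l0 l1] := ln_qroot ty; have /andP[r0 r1] := ratio_qroot ty.
have -> : kdiag al be tau y = - (4 * al * ln (y + tau)) + 4 * (al + be) * (tau / (y + tau)) by rewrite /kdiag mulrA.
rewrite lnE rE.
move: (ln y) (ln (1 + tau / y)) (tau / y / (1 + tau / y)) (qroot (tau / y)) l0 l1 r0 r1 => v l r q l0 l1 r0 r1.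
rewrite ler_norml; apply/andP; split; nra.
Qed.

Lemma kdir_defect be tau y p : 0 < tau -> 0 < y -> `|p| <= y ->
  `|kdir be tau y * p - 8 * be / y * p| <= 8 * `|be| * (qroot tau * (qroot y)^-1).
Proof.
move=> t0 y0 py; have ty : 0 < tau / y by rewrite divr_gt0.
have -> : qroot tau * (qroot y)^-1 = qroot (tau / y) by rewrite qrootM ?qrootV // ltW.
have /andP[r0 r1] := ratio_qroot ty.
have -> : kdir be tau y * p - 8 * be / y * p = - (8 * be * (tau / y / (1 + tau / y)) * (p / y)).
  by rewrite /kdir; field; do ![apply/andP; split]; rewrite ?gt_eqF //; lra.
have pq : `|p / y| <= 1 by rewrite normrM normfV (ger0_norm (ltW y0)) ler_pdivrMr // mul1r.
move: (tau / y / (1 + tau / y)) (p / y) (qroot (tau / y)) r0 r1 pq => r v q r0 r1 v1.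
rewrite normrN !normrM [`|8|]ger0_norm // (ger0_norm r0) -!mulrA ler_pM2l // ler_wpM2l //.
by rewrite -[leRHS]mulr1 ler_pM.
Qed.

End regularization_defect.

Section boundary_densities.
Variable R : realType.
Variables (D : set 'rV[R]_2) (gam : R) (Phi : R[i] -> R[i]) (a : nat -> R[i]).
Hypothesis Phi_ext : exterior_conformal_map D gam Phi a.
Hypothesis oD : open D.
Hypothesis lipD : lipschitz_boundary D.
Implicit Types (w z p u : R[i]) (s t tau : R).
Local Notation mu := (@lebesgue_measure R).
Local Notation b := (bcurve gam Phi).
Local Notation h := (scale_factor gam Phi).
Local Notation L := (2 * pi : R).
Local Notation integ0 f := (integ 0 L f).
Local Notation I0 f := (RI 0 L f).

Lemma dist2_cabs z w : dist2 z w = cabs (z - w) ^+ 2.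
Proof. by rewrite cabs_def sqr_sqrtr ?addr_ge0 ?sqr_ge0 // ReD ImD ReN ImN. Qed.

Lemma qroot_dist2 z w : qroot (dist2 z w) = Num.sqrt (Num.sqrt (cabs (z - w))).
Proof. by rewrite /qroot dist2_cabs sqrtr_sqr ger0_norm // cabs_ge0. Qed.

Lemma bcurve_Re_continuous : continuous (fun t : R => complex.Re (b t)).
Proof. exact: Rex_continuous (bcurve_uniform Phi_ext). Qed.

Lemma bcurve_Im_continuous : continuous (fun t : R => complex.Im (b t)).
Proof. exact: Imx_continuous (bcurve_uniform Phi_ext). Qed.

Lemma dx_continuous z : continuous (fun t : R => dx z (b t)).
Proof. by move=> t; apply: cvgB; [exact: cvg_cst|exact: bcurve_Re_continuous]. Qed.

Lemma dy_continuous z : continuous (fun t : R => dy z (b t)).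
Proof. by move=> t; apply: cvgB; [exact: cvg_cst|exact: bcurve_Im_continuous]. Qed.

Lemma dist2_continuous z : continuous (fun t : R => dist2 z (b t)).
Proof.
move=> t; rewrite /dist2; under eq_fun do rewrite !expr2.
by apply: cvgD; apply: cvgM; try exact: dx_continuous; exact: dy_continuous.
Qed.

Lemma exterior_dist2_gt0 z t : exterior D (ofC z) -> 0 < dist2 z (b t).
Proof. by move=> ez; rewrite dist2_cabs exprn_gt0 // cabsB (exterior_curve_neq Phi_ext). Qed.

(** The hypothesis [dom] is the inequality of arithmetic and geometric means for [psi = phi * h] and
    [q = phi ^ 2 * h]. *)
Section singular_potential.
Variables (q psi : R -> R).
Hypothesis iq : integ0 q.
Hypothesis mpsi : measurable_fun `[0, L] psi.
Hypothesis dom : forall t (x : R), 0 <= t <= L -> 0 <= x -> `|psi t| * x <= q t + x ^+ 2 * h t.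

Lemma dominated_density_integ : integ0 psi.
Proof.
have [C _ HC] := dominated_integrable Phi_ext oD lipD iq.
have [z ez _] := exterior_near_curve Phi_ext 0 (@ltr01 R).
have [||ip _] := HC z (fun t => `|psi t|) ez.
- exact: measurableT_comp.
- move=> t tI; rewrite normr_ge0 /=; have := dom tI ler01; rewrite mulr1 expr1n mul1r => H.
  apply: le_trans H _; rewrite lerD2l mulrDl mul1r lerDl mulr_ge0 ?invr_ge0 ?sqrtr_ge0 //.
apply: integ_le ip _ => // t _; by rewrite normr_id.
Qed.

(** Taking [x = r^(-1/4)] in [dom], the product [|psi| * r^(-1/4)] is at most [q + r^(-1/2) * h], whose integral
    is bounded uniformly in [z]. The distance is squared, so the eighth root [qroot] gives [r^(1/4)]. *)
Lemma singular_potential : exists2 C : R, 0 <= C & forall z (k : R[i] -> R[i] -> R) (n : R -> R) (M : R),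
  exterior D (ofC z) -> 0 <= M -> measurable_fun `[0, L] n -> integ0 (fun s => psi s * k z (b s)) ->
  (forall s, `|k z (b s) - n s| <= M * (qroot (dist2 z (b s)))^-1) ->
  integ0 (fun s => psi s * n s) /\ `|pot L b k psi z - I0 (fun s => psi s * n s)| <= M * C.
Proof.
have [C C0 HC] := dominated_integrable Phi_ext oD lipD iq.
exists C => // z k n M ez M0 mn ik Hn.
have [||iF FC] := HC z (fun t => `|psi t| * (qroot (dist2 z (b t)))^-1) ez.
- apply: measurable_funM; first exact: measurableT_comp.
  apply: (measurableT_comp (@measurable_inv R)); apply: measurable_funTS.
  apply: continuous_measurable_fun => t; rewrite /qroot.
  by do 3 (apply: continuous_cvg; first exact: sqrt_continuous); exact: dist2_continuous.
- move=> t tI; rewrite mulr_ge0 ?invr_ge0 ?qroot_ge0 //=.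
  apply: le_trans (dom tI _) _; first by rewrite invr_ge0 qroot_ge0.
  rewrite lerD2l ler_wpM2r ?sqrtr_ge0 //.
  by rewrite qroot_dist2 cabsB exprVn sqr_sqrtr ?sqrtr_ge0 // lerDr.
have mk : measurable_fun `[0, L] (fun s => psi s * n s) by exact: measurable_funM.
have id : integ0 (fun s => psi s * k z (b s) - psi s * n s).
  apply: integ_le (integZ M iF) _; first by apply: measurable_funB => //; exact: integ_meas.
  move=> t _; rewrite -mulrBr normrM mulrCA; apply: le_trans (ler_norm _).
  by apply: ler_wpM2l => //; exact: Hn.
have in_ : integ0 (fun s => psi s * n s).
  have := integB ik id; apply: eq_integrable => // t _ /=; by rewrite opprB addrC subrK.
split=> //; rewrite /pot -RIB //.
apply: le_trans (RI_norm id) _; apply: le_trans (ler_wpM2l M0 FC); rewrite -RIZ //.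
apply: RI_le; [exact: integ_norm|exact: integZ|move=> t _].
by rewrite -mulrBr normrM mulrCA; apply: ler_wpM2l => //; exact: Hn.
Qed.

End singular_potential.

(** The density against the angle instead of arc length. *)
Definition dens (phi : 'rV[R]_2 -> 'rV[R]_2) k t : R := phi (bdpt gam Phi t) 0 k * h t.

(** Measurability of [h] is not known separately; that of [phi] and of [phi ^ 2 * h] suffices. *)
Lemma dens_measurable phi k : bdL2 gam Phi phi -> measurable_fun `[0, L] (dens phi k).
Proof.
move=> /(_ k)[mp ip]; have mq := integ_meas ip.
have -> : dens phi k = fun t => (phi (bdpt gam Phi t) 0 k ^+ 2 * h t) * (phi (bdpt gam Phi t) 0 k)^-1.
  apply/funext => t; rewrite /dens; have [->|p0] := eqVneq (phi (bdpt gam Phi t) 0 k) 0.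
    by rewrite expr0n !mul0r.
  by field.
by apply: measurable_funM => //; exact: (measurableT_comp (@measurable_inv R)).
Qed.

Lemma dens_dominated phi k t (x : R) : 0 <= x ->
  `|dens phi k t| * x <= phi (bdpt gam Phi t) 0 k ^+ 2 * h t + x ^+ 2 * h t.
Proof.
move=> x0; have h0 : 0 <= h t by rewrite sqrtr_ge0.
rewrite /dens normrM (ger0_norm h0) -mulrDl mulrAC ler_wpM2r // -real_normK ?num_real //.
have := sqr_ge0 (`|phi (bdpt gam Phi t) 0 k| - x); have := normr_ge0 (phi (bdpt gam Phi t) 0 k).
move: (`|_|) => v; nra.
Qed.

Lemma dens_integ phi k : bdL2 gam Phi phi -> integ0 (dens phi k).
Proof.
move=> L2; apply: (dominated_density_integ (L2 k).2 (dens_measurable k L2)).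
by move=> t x _; exact: dens_dominated.
Qed.

End boundary_densities.

Section boundary_traces.
Variable R : realType.
Variables (D : set 'rV[R]_2) (gam : R) (Phi : R[i] -> R[i]) (a : nat -> R[i]).
Hypothesis Phi_ext : exterior_conformal_map D gam Phi a.
Hypothesis oD : open D.
Hypothesis lipD : lipschitz_boundary D.
Implicit Types (w z p u : R[i]) (s t tau : R).
Local Notation b := (bcurve gam Phi).
Local Notation h := (scale_factor gam Phi).
Local Notation L := (2 * pi : R).
Local Notation integ0 f := (integ 0 L f).
Local Notation I0 f := (RI 0 L f).
Local Notation Dens := (dens gam Phi).
Variables (lam mu : R).
Hypothesis mu0 : 0 < mu.
Hypothesis lm0 : 0 < lam + mu.

Definition kelvin_alpha : R := 2^-1 * (mu^-1 + (2 * mu + lam)^-1).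
Definition kelvin_beta : R := 2^-1 * (mu^-1 - (2 * mu + lam)^-1).
Local Notation al := kelvin_alpha.
Local Notation be := kelvin_beta.

Lemma kelvin_add : al + be = mu^-1.
Proof. rewrite /kelvin_alpha /kelvin_beta; lra. Qed.

Lemma kelvin_sub : al - be = (2 * mu + lam)^-1.
Proof. rewrite /kelvin_alpha /kelvin_beta; lra. Qed.

Lemma kelvin_add_ge0 : 0 <= al + be.
Proof. by have m := mu0; rewrite kelvin_add invr_ge0 ltW. Qed.

Lemma kelvin_sub_gt0 : 0 < al - be.
Proof. by have m := mu0; have l := lm0; rewrite kelvin_sub invr_gt0; lra. Qed.

Lemma kelvin_alpha_gt0 : 0 < al.
Proof. by have := kelvin_add_ge0; have := kelvin_sub_gt0; lra. Qed.

(** The Kelvin kernel, multiplied by [- 16 pi]. *)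
Definition n11 z w : R := - (4 * al * ln (dist2 z w)) + 8 * be / dist2 z w * (dx z w * dx z w).
Definition n12 z w : R := 8 * be / dist2 z w * (dx z w * dy z w).
Definition n22 z w : R := - (4 * al * ln (dist2 z w)) + 8 * be / dist2 z w * (dy z w * dy z w).

Lemma kelvinE z w : 0 < dist2 z w -> let K := kelvin lam mu (ofC z - ofC w) in
  [/\ n11 z w = - (16 * pi) * K i1 i1, n12 z w = - (16 * pi) * K i1 i2,
      n12 z w = - (16 * pi) * K i2 i1 & n22 z w = - (16 * pi) * K i2 i2].
Proof.
move=> d0; have p0 : pi != 0 :> R by rewrite gt_eqF // pi_gt0.
have d0' : dist2 z w != 0 by rewrite gt_eqF.
have eE : enorm (ofC z - ofC w) ^+ 2 = dist2 z w by rewrite -ofCB enormE ofCK dist2_cabs.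
have e0 : 0 < enorm (ofC z - ofC w).
  by rewrite lt_neqAle sqrtr_ge0 andbT eq_sym -sqrf_eq0 eE.
have lnE : ln (dist2 z w) = 2 * ln (enorm (ofC z - ofC w)) by rewrite -eE lnXn // mulr_natl.
rewrite /kelvin -/kelvin_alpha -/kelvin_beta /n11 /n12 /n22 lnE !mxE /= eE -/(dx z w) -/(dy z w).
by move: (@pi R) p0 => P p0; split; field; rewrite d0'.
Qed.

Lemma kernel_measurable z : exterior D (ofC z) ->
  [/\ measurable_fun `[0, L] (fun s => n11 z (b s)), measurable_fun `[0, L] (fun s => n12 z (b s)) &
      measurable_fun `[0, L] (fun s => n22 z (b s))].
Proof.
move=> ez.
have cd : continuous (fun s : R => dist2 z (b s)) by exact: (dist2_continuous Phi_ext).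
have cx : continuous (fun s : R => dx z (b s)) by exact: (dx_continuous Phi_ext).
have cy : continuous (fun s : R => dy z (b s)) by exact: (dy_continuous Phi_ext).
have ml : measurable_fun `[0, L] (fun s => - (4 * al * ln (dist2 z (b s)))).
  apply: measurableT_comp => //; apply: measurable_funM; first exact: measurable_cst.
  apply: (measurableT_comp (@measurable_ln R)); apply: measurable_funTS; exact: continuous_measurable_fun.
have mi : measurable_fun `[0, L] (fun s => 8 * be / dist2 z (b s)).
  apply: measurable_funM; first exact: measurable_cst.
  apply: (measurableT_comp (@measurable_inv R)); apply: measurable_funTS; exact: continuous_measurable_fun.
have mc (f : R -> R) : continuous f -> measurable_fun `[0, L] f.
  by move=> cf; apply: measurable_funTS; exact: continuous_measurable_fun.
have mx : measurable_fun `[0, L] (fun s => dx z (b s)) by exact: mc.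
have my : measurable_fun `[0, L] (fun s => dy z (b s)) by exact: mc.
rewrite /n11 /n12 /n22; split.
- by apply: measurable_funD => //; apply: measurable_funM => //; apply: measurable_funM.
- by apply: measurable_funM => //; apply: measurable_funM.
- by apply: measurable_funD => //; apply: measurable_funM => //; apply: measurable_funM.
Qed.

Lemma kernel_defect tau z w : 0 < tau -> 0 < dist2 z w ->
  let M := (32 * al + 4 * (al + be) + 8 * `|be|) * qroot tau in
  [/\ `|k11 al be tau z w - n11 z w| <= M * (qroot (dist2 z w))^-1,
      `|k12 be tau z w - n12 z w| <= M * (qroot (dist2 z w))^-1 &
      `|k22 al be tau z w - n22 z w| <= M * (qroot (dist2 z w))^-1].
Proof.
move=> t0 d0 M; have al0 := ltW kelvin_alpha_gt0; have A0 := kelvin_add_ge0.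
have dg := kdiag_defect al0 A0 t0 d0.
have px := fun v => @kdir_defect R be tau (dist2 z w) v t0 d0.
have x0 := sqr_ge0 (dx z w); have y0 := sqr_ge0 (dy z w).
have hxx : `|dx z w * dx z w| <= dist2 z w by rewrite ger0_norm -expr2 // /dist2; lra.
have hyy : `|dy z w * dy z w| <= dist2 z w by rewrite ger0_norm -expr2 // /dist2; lra.
have hxy : `|dx z w * dy z w| <= dist2 z w.
  rewrite /dist2 ler_norml; have := sqr_ge0 (dx z w - dy z w); have := sqr_ge0 (dx z w + dy z w).
  by move=> ? ?; apply/andP; split; nra.
have {hxx} dxx := px _ hxx; have {hyy} dyy := px _ hyy; have {hxy} dxy := px _ hxy.
have q0 : 0 <= qroot tau * (qroot (dist2 z w))^-1 by rewrite mulr_ge0 ?invr_ge0 ?qroot_ge0.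
rewrite /M -!mulrA /k11 /k12 /k22 /n11 /n12 /n22.
move: (qroot tau * _) q0 dg dxx dyy dxy => Q Q0.
move: (kdiag _ _ _ _) (ln _) (kdir _ _ _ * _) (kdir _ _ _ * _) (kdir _ _ _ * _)
  (8 * be / dist2 z w * _) (8 * be / dist2 z w * _) (8 * be / dist2 z w * _) => kd ll v1 v2 v3 w1 w2 w3 dg d1 d2 d3.
have b0 : 0 <= `|be| by [].
have sum (v w' : R) : `|v - w'| <= 8 * `|be| * Q -> `|kd + v - (- (4 * al * ll) + w')| <= (32 * al + 4 * (al + be) + 8 * `|be|) * Q.
  move=> H; have -> : kd + v - (- (4 * al * ll) + w') = (kd + 4 * al * ll) + (v - w') by ring.
  by apply: le_trans (ler_normD _ _) _; rewrite [leRHS]mulrDl; exact: lerD.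
split; [exact: sum| |exact: sum].
by apply: le_trans d3 _; rewrite ler_wpM2r // lerDr; lra.
Qed.

Lemma single_layerE phi z : exterior D (ofC z) ->
  - (16 * pi) * single_layer lam mu gam Phi phi (ofC z) 0 i1 =
    - (16 * pi) * I0 (fun t => (- (16 * pi))^-1 * (Dens phi i1 t * n11 z (b t) + Dens phi i2 t * n12 z (b t))) /\
  - (16 * pi) * single_layer lam mu gam Phi phi (ofC z) 0 i2 =
    - (16 * pi) * I0 (fun t => (- (16 * pi))^-1 * (Dens phi i1 t * n12 z (b t) + Dens phi i2 t * n22 z (b t))).
Proof.
move=> ez; have p0 : - (16 * pi) != 0 :> R by rewrite oppr_eq0 mulf_neq0 // gt_eqF // pi_gt0.
have reg (P k k' v v' c : R) : P != 0 -> (k * v + k' * v') * c = P^-1 * (v * c * (P * k) + v' * c * (P * k')).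
  by move=> P0; field.
have l2 : lift ord0 ord0 = i2 :> 'I_2 by exact/val_inj.
split; congr (_ * _); rewrite mxE; apply: RI_eq => t _;
  have [e11 e12 e21 e22] := kelvinE (exterior_dist2_gt0 Phi_ext t ez).
  by rewrite e11 e12 /dens bdptE -reg // !big_ord_recl big_ord0 -/i1 l2 addr0.
by rewrite e22 e21 /dens bdptE -reg // !big_ord_recl big_ord0 -/i1 l2 addr0.
Qed.

End boundary_traces.


(** * Boundary traces of densities *)

Section boundary_traces.
Variable R : realType.
Variables (D : set 'rV[R]_2) (gam : R) (Phi : R[i] -> R[i]) (a : nat -> R[i]).
Hypothesis Phi_ext : exterior_conformal_map D gam Phi a.
Hypothesis oD : open D.
Hypothesis lipD : lipschitz_boundary D.
Implicit Types (w z u : R[i]) (s t tau : R).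
Local Notation b := (bcurve gam Phi).
Local Notation h := (scale_factor gam Phi).
Local Notation L := (2 * pi : R).
Local Notation integ0 f := (integ 0 L f).
Local Notation I0 f := (RI 0 L f).
Local Notation Dens := (dens gam Phi).
Variables (lam mu : R).
Hypothesis mu0 : 0 < mu.
Hypothesis lm0 : 0 < lam + mu.
Local Notation al := (kelvin_alpha lam mu).
Local Notation be := (kelvin_beta lam mu).

(** The defects of the kernels are of order [qroot tau * r^(-1/4)], and [singular_potential] integrates this
    weight uniformly in [z]. *)
Lemma regularized_potential phi K : bdL2 gam Phi phi -> (forall t, cabs (b t) <= K) ->
  exists C, forall tau z, 0 < tau -> exterior D (ofC z) -> cabs z <= K ->
  `|pot1 L b al be tau (Dens phi i1) (Dens phi i2) z - - (16 * pi) * single_layer lam mu gam Phi phi (ofC z) 0 i1|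
    <= C * qroot tau /\
  `|pot2 L b al be tau (Dens phi i1) (Dens phi i2) z - - (16 * pi) * single_layer lam mu gam Phi phi (ofC z) 0 i2|
    <= C * qroot tau.
Proof.
move=> L2 xK; set f := Dens phi i1; set g := Dens phi i2.
have if_ : integ0 f := dens_integ Phi_ext oD lipD i1 L2.
have ig : integ0 g := dens_integ Phi_ext oD lipD i2 L2.
have [C1 C10 H1] := singular_potential Phi_ext oD lipD (L2 i1).2 (dens_measurable i1 L2)
  (fun t x _ => @dens_dominated R gam Phi phi i1 t x).
have [C2 C20 H2] := singular_potential Phi_ext oD lipD (L2 i2).2 (dens_measurable i2 L2)
  (fun t x _ => @dens_dominated R gam Phi phi i2 t x).
have al0 := kelvin_alpha_gt0 mu0 lm0; have A0 := kelvin_add_ge0 lam mu0.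
pose M0 := 32 * al + 4 * (al + be) + 8 * `|be|.
have M00 : 0 <= M0 by rewrite /M0; have := normr_ge0 be; lra.
exists (M0 * (C1 + C2)) => tau z t0 ez zK.
have M1 : 0 <= M0 * qroot tau by rewrite mulr_ge0 // qroot_ge0.
have xU := bcurve_uniform Phi_ext.
have l11 := lipk_k11 (x := b) xK al be t0; have l12 := lipk_k12 (x := b) xK be t0.
have l22 := lipk_k22 (x := b) xK al be t0.
have [m11 m12 m22] := kernel_measurable Phi_ext lam mu ez.
have df s := kernel_defect mu0 lm0 t0 (exterior_dist2_gt0 Phi_ext s ez).
have df11 s := let: And3 e _ _ := df s in e.
have df12 s := let: And3 _ e _ := df s in e.
have df22 s := let: And3 _ _ e := df s in e.
have [jf11 ef11] := H1 z _ _ _ ez M1 m11 (lipk_integ xK xU l11 zK if_) df11.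
have [jf12 ef12] := H1 z _ _ _ ez M1 m12 (lipk_integ xK xU l12 zK if_) df12.
have [jg12 eg12] := H2 z _ _ _ ez M1 m12 (lipk_integ xK xU l12 zK ig) df12.
have [jg22 eg22] := H2 z _ _ _ ez M1 m22 (lipk_integ xK xU l22 zK ig) df22.
have [e1 e2] := single_layerE Phi_ext lam mu phi ez.
have p0 : - (16 * pi) != 0 :> R by rewrite oppr_eq0 mulf_neq0 // gt_eqF // pi_gt0.
have fin (v v' w w' : R) : `|v - w| <= M0 * qroot tau * C1 -> `|v' - w'| <= M0 * qroot tau * C2 ->
    `|v + v' - (w + w')| <= M0 * (C1 + C2) * qroot tau.
  move=> h1 h2; rewrite (_ : v + v' - (w + w') = (v - w) + (v' - w')); last by ring.
  apply: le_trans (ler_normD _ _) _; rewrite mulrAC mulrDr; exact: lerD.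
by rewrite e1 e2 !RIZ; [|exact: integD..]; rewrite !mulVKf // !RID //; split; exact: fin.
Qed.

Lemma rigid_combE (c : 'I_3 -> R) (y : 'rV[R]_2) :
  rigid_comb c y 0 i1 = c ord0 + c (lift ord0 (lift ord0 ord0)) * y 0 i2 /\
  rigid_comb c y 0 i2 = c (lift ord0 ord0) - c (lift ord0 (lift ord0 ord0)) * y 0 i1.
Proof.
rewrite /rigid_comb !summxE !big_ord_recl !big_ord0 /rigid /= !mxE /=.
by split; ring.
Qed.

Definition affine_field (p0 p1 p2 q0 q1 q2 : R) (H : 'rV[R]_2 -> 'rV[R]_2) := forall x,
  H x 0 i1 = p0 + p1 * x 0 i1 + p2 * x 0 i2 /\ H x 0 i2 = q0 + q1 * x 0 i1 + q2 * x 0 i2.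

(** In the exterior the single layer potential is [u - H], and [u] tends to a rigid displacement at the boundary.
    The regularized potentials are continuous across the curve, so their closeness to the single layer potential
    in the exterior passes to the curve. The conditions of zero force and torque are the orthogonality to rigid
    displacements. *)
Lemma density_affine p0 p1 p2 q0 q1 q2 H phi : is_density lam mu D gam Phi H phi ->
  affine_field p0 p1 p2 q0 q1 q2 H -> exists r0 r1 r2 : R,
  affine_density L b al be (16 * pi * (p0 - r0)) (16 * pi * p1) (16 * pi * (p2 - r2))
    (16 * pi * (q0 - r1)) (16 * pi * (q1 + r2)) (16 * pi * q2) (Dens phi i1) (Dens phi i2).
Proof.
move=> [_ [L2 mom] [u [[_ [c uc] _ _] uE]]] HE.
set r0 := c ord0; set r1 := c (lift ord0 ord0); set r2 := c (lift ord0 (lift ord0 ord0)).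
exists r0, r1, r2.
have if_ : integ0 (Dens phi i1) := dens_integ Phi_ext oD lipD i1 L2.
have ig : integ0 (Dens phi i2) := dens_integ Phi_ext oD lipD i2 L2.
have [K K0 xK] := bcurve_bounded Phi_ext.
have xK1 t : cabs (b t) <= K + 1 by have := xK t; lra.
have xU := bcurve_uniform Phi_ext.
have iR (f : R -> R) : integ0 f -> integ0 (fun t => f t * complex.Re (b t)) by exact: integ_Rex xK xU _.
have iI (f : R -> R) : integ0 f -> integ0 (fun t => f t * complex.Im (b t)) by exact: integ_Imx xK xU _.
have momE (c0 c1 c2 : R) : c0 * I0 (Dens phi i1) + c1 * I0 (Dens phi i2) +
    c2 * (mom2 L b (Dens phi i1) - mom1 L b (Dens phi i2)) = 0.
  pose d := fun j : 'I_3 => match val j with 0%N => c0 | 1%N => c1 | _ => c2 end.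
  rewrite -[RHS](mom d) /bdintegral -/(RI 0 L _).
  rewrite [RHS](@RI_eq _ _ _ _ (fun t => (c0 * Dens phi i1 t + c1 * Dens phi i2 t) +
    c2 * (Dens phi i1 t * complex.Im (b t) - Dens phi i2 t * complex.Re (b t)))).
    rewrite RID; [|exact: integD (integZ _ if_) (integZ _ ig)|exact: integZ _ (integB (iI _ if_) (iR _ ig))].
    rewrite RID; [|exact: integZ|exact: integZ].
    rewrite !RIZ //; last exact: integB (iI _ if_) (iR _ ig).
    by rewrite RIB //; [exact: iI|exact: iR].
  move=> t _; rewrite dotE; have [-> ->] := rigid_combE d (bdpt gam Phi t).
  rewrite /d /= /dens bdptE !mxE /=; ring.
have m1 : I0 (Dens phi i1) = 0 by have := momE 1 0 0; rewrite !mul0r !addr0 mul1r.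
have m2 : I0 (Dens phi i2) = 0 by have := momE 0 1 0; rewrite !mul0r addr0 add0r mul1r.
have m3 : mom2 L b (Dens phi i1) = mom1 L b (Dens phi i2).
  by apply/eqP; rewrite -subr_eq0; have := momE 0 0 1; rewrite !mul0r !add0r mul1r => ->.
have [C HC] := regularized_potential L2 xK1.
split=> //; exists C => tau t /andP[t0 _].
(* Exterior points close to the curve where the single layer potential is close to its trace. *)
have trace e : 0 < e -> exists2 z, [/\ exterior D (ofC z), cabs z <= K + 1 & cabs (z - b t) < e] &
    (`|- (16 * pi) * single_layer lam mu gam Phi phi (ofC z) 0 i1 -
      (16 * pi * (p0 - r0) + 16 * pi * p1 * complex.Re (b t) + 16 * pi * (p2 - r2) * complex.Im (b t))| < e) /\
    (`|- (16 * pi) * single_layer lam mu gam Phi phi (ofC z) 0 i2 -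
      (16 * pi * (q0 - r1) + 16 * pi * (q1 + r2) * complex.Re (b t) + 16 * pi * q2 * complex.Im (b t))| < e).
  move=> e0; have pi0 : 0 < 16 * pi :> R by rewrite mulr_gt0 // pi_gt0.
  move: (16 * pi : R) pi0 => P P0.
  have e10 : 0 < e / P / 2 by rewrite !divr_gt0.
  have Kq0 : 0 < `|p1| + `|p2| + `|q1| + `|q2| + 1 by rewrite ltr_wpDl // !addr_ge0.
  have bt : bdry D (ofC (b t)).
    by apply: (Phi_bdry Phi_ext); rewrite cabs_circle // ltW // (ecm_gam_gt0 Phi_ext).
  have /cvgrPdist_lt/(_ _ e10)/nbhs_ofC[d d0 Hd] := uc _ bt.
  have [|z ez] := @exterior_near_curve _ _ _ _ _ Phi_ext t (Num.min (Num.min d 1)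
      (Num.min e (e / P / 2 / (`|p1| + `|p2| + `|q1| + `|q2| + 1)))).
    by rewrite !lt_min; do ![apply/andP; split] => //; exact: divr_gt0.
  rewrite !lt_min => /andP[/andP[zd z1] /andP[ze zq]].
  exists z.
    split=> //; have := cabs_lerB z (b t); have := xK t; lra.
  have uz := Hd z zd ez; have u12 k : `|rigid_comb c (ofC (b t)) 0 k - u (ofC z) 0 k| < e / P / 2.
    by have := coord_le_norm (rigid_comb c (ofC (b t)) - u (ofC z)) k; rewrite !mxE => /le_lt_trans; apply.
  have u1 := u12 i1; have u2 := u12 i2.
  have [re1 re2] := rigid_combE c (ofC (b t)); rewrite re1 in u1; rewrite re2 in u2.
  have E k : u (ofC z) 0 k = H (ofC z) 0 k + single_layer lam mu gam Phi phi (ofC z) 0 k by rewrite uE // mxE.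
  have [h1 h2] := HE (ofC z); rewrite E h1 in u1; rewrite E h2 in u2.
  move: (single_layer _ _ _ _ _ _ 0 i1) (single_layer _ _ _ _ _ _ 0 i2) u1 u2 => S1 S2 u1 u2.
  rewrite -/r0 -/r1 -/r2 !mxE /= in u1 u2.
  have cR := cabs_Re (z - b t); have cI := cabs_Im (z - b t); rewrite !(ReD, ImD, ReN, ImN) in cR cI.
  move: zq; rewrite ltr_pdivlMr // => zq.
  have key (k0 k1 k2 x y x' y' S r q : R) : `|x - x'| <= cabs (z - b t) -> `|y - y'| <= cabs (z - b t) ->
    `|r - (k0 + k1 * x + k2 * y + S)| < e / P / 2 -> `|k1| + `|k2| <= q -> cabs (z - b t) * (q + 1) < e / P / 2 ->
    `|- P * S - P * (k0 + k1 * x' + k2 * y' - r)| < e.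
    move=> hx hy hS hq hc.
    have -> : - P * S - P * (k0 + k1 * x' + k2 * y' - r) =
       P * ((r - (k0 + k1 * x + k2 * y + S)) + (k1 * (x - x') + k2 * (y - y'))) by ring.
    rewrite normrM gtr0_norm // mulrC -ltr_pdivlMr //; apply: le_lt_trans (ler_normD _ _) _.
    have : `|k1 * (x - x') + k2 * (y - y')| <= cabs (z - b t) * (q + 1).
      apply: le_trans (ler_normD _ _) _; rewrite !normrM.
      have := normr_ge0 k1; have := normr_ge0 k2; have := cabs_ge0 (z - b t); nra.
    lra.
  have f1 : `|p1| + `|p2| <= `|p1| + `|p2| + `|q1| + `|q2| by rewrite -addrA lerDl addr_ge0.
  have f2 : `|q1| + `|q2| <= `|p1| + `|p2| + `|q1| + `|q2| by rewrite -[leRHS]addrA lerDr addr_ge0.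
  split.
    have := key p0 p1 p2 _ _ _ _ _ _ _ cR cI u1 f1 zq.
    by congr (`|_| < _); ring.
  have := key q0 q1 q2 _ _ _ _ _ _ _ cR cI u2 f2 zq.
  by congr (`|_| < _); ring.
have lip k f : lipk (K + 1) k -> integ0 f -> exists2 Lam, 0 <= Lam & forall z, cabs z <= K + 1 ->
    `|pot L b k f (b t) - pot L b k f z| <= Lam * cabs (b t - z).
  move=> [M M0 HM] jf; exists (M * RI 0 L (fun s => `|f s|)) => [|z zK]; first by rewrite mulr_ge0 // RI_norm_ge0.
  by have := pot_lip xK1 xU M0 HM (xK1 t) zK jf; rewrite mulrAC.
have l11 := lipk_k11 (x := b) xK1 al be t0; have l12 := lipk_k12 (x := b) xK1 be t0.
have l22 := lipk_k22 (x := b) xK1 al be t0.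
have [A A_0 HA] := lip _ _ l11 if_; have [B B_0 HB] := lip _ _ l12 ig.
have [A' A'0 HA'] := lip _ _ l12 if_; have [B' B'0 HB'] := lip _ _ l22 ig.
have step (P Q S T m e v w d : R) : 0 < e -> 0 <= v -> 0 <= w -> d < e / (2 * (v + w + 1)) -> `|P - Q| <= (v + w) * d ->
    `|Q - S| <= m -> `|S - T| < e / 2 -> `|P - T| <= m + e.
  move=> e0 v0 w0; rewrite ltr_pdivlMr; last by lra.
  move=> dB PQ QS ST; rewrite (_ : P - T = (P - Q) + (Q - S) + (S - T)); last by ring.
  apply: le_trans (ler_normD _ _) _; apply: le_trans (lerD (ler_normD _ _) (lexx _)) _.
  have d0 : 0 <= d * (v + w + 1) * 2 - (v + w) * d * 2 \/ d < 0 by have [?|?] := ltP d 0; [right|left; nra].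
  case: d0 => d0; first by lra.
  have : (v + w) * d <= 0 by nra.
  lra.
have dd (p q p' q' v w : R) : `|p - p'| <= v -> `|q - q'| <= w -> `|p + q - (p' + q')| <= v + w.
  by move=> h1 h2; rewrite opprD addrACA; apply: le_trans (ler_normD _ _) _; exact: lerD.
split; apply/ler_addgt0Pr => e e0.
  have e'0 : 0 < Num.min (e / 2) (e / (2 * (A + B + 1))).
    by rewrite lt_min; apply/andP; split; apply: divr_gt0 => //; lra.
  have [z [ez zK zb] [+ _]] := trace _ e'0; rewrite lt_min => /andP[ST _].
  have [QS _] := HC tau z t0 ez zK; move: zb; rewrite cabsB lt_min => /andP[_ zb].
  apply: (step _ _ _ _ _ _ A B _ e0 A_0 B_0 zb _ QS ST).
  rewrite [leRHS]mulrDl; exact: dd (HA z zK) (HB z zK).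
have e'0 : 0 < Num.min (e / 2) (e / (2 * (A' + B' + 1))).
  by rewrite lt_min; apply/andP; split; apply: divr_gt0 => //; lra.
have [z [ez zK zb] [_ +]] := trace _ e'0; rewrite lt_min => /andP[ST _].
have [_ QS] := HC tau z t0 ez zK; move: zb; rewrite cabsB lt_min => /andP[_ zb].
apply: (step _ _ _ _ _ _ A' B' _ e0 A'0 B'0 zb _ QS ST).
rewrite [leRHS]mulrDl; exact: dd (HA' z zK) (HB' z zK).
Qed.

End boundary_traces.


(** * Oscillating integrals *)

Section oscillation.
Variable R : realType.
Implicit Types (f g : R -> R) (s t : R).
Local Notation mu := (@lebesgue_measure R).

Lemma continuous_uniform (L : R) f e : continuous f -> 0 < e -> exists2 d, 0 < d &
  forall s t, 0 <= s <= L -> 0 <= t <= L -> `|s - t| < d -> `|f s - f t| < e.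
Proof.
move=> cf e0; apply: contrapT => H.
have /choice[u Hu] : forall n : nat, exists ww : R * R, [/\ 0 <= ww.1 <= L,
    0 <= ww.2 <= L, `|ww.1 - ww.2| < n.+1%:R^-1 & e <= `|f ww.1 - f ww.2|].
  move=> n; apply: contrapT => Hn; apply: H; exists n.+1%:R^-1; first by rewrite invr_gt0.
  move=> s t sI tI d; rewrite ltNge; apply/negP => ee; apply: Hn; by exists (s, t).
have [|z zc] := @complex_cluster _ (fun n => ((u n).1)%:C) L.
  by move=> n; rewrite cabs_real; have [/andP[? ?] _ _ _] := Hu n; rewrite ger0_norm.
have e20 : 0 < e / 2 by rewrite divr_gt0.
have /cvgrPdist_lt/(_ _ e20)/nbhs_ballP[d /= d0 Hd] := cf (complex.Re z).
have d20 : 0 < d / 2 by rewrite divr_gt0.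
have [N HN] := harmonic_small d20.
have [n [Nn un]] := zc _ d20 N.
have [_ _ u12 ee] := Hu n; have {}u12 := lt_trans u12 (HN n Nn).
have := le_lt_trans (cabs_Re _) un; rewrite ReD ReN /= => {}un.
have h1 : `|f (complex.Re z) - f (u n).1| < e / 2.
  by apply: Hd; rewrite /ball /= distrC; lra.
have h2 : `|f (complex.Re z) - f (u n).2| < e / 2.
  apply: Hd; rewrite /ball /= distrC; have := ler_distD (u n).1 (u n).2 (complex.Re z).
  by rewrite [`|(u n).2 - (u n).1|]distrC; lra.
have := ler_distD (f (complex.Re z)) (f (u n).1) (f (u n).2).
rewrite [`|f (u n).1 - f (complex.Re z)|]distrC; lra.
Qed.

Lemma RI_derive (f F : R -> R) (c d : R) : c <= d -> continuous f -> (forall t, is_derive t 1 F (f t)) ->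
  RI c d f = F d - F c.
Proof.
move=> cd cf dF; move: cd; rewrite le_eqVlt => /orP[/eqP->|cd].
  by rewrite /RI set_itv1 Rintegral_set1 subrr.
have cF : continuous F by move=> t; apply: differentiable_continuous; apply/derivable1_diffP; have [] := dF t.
rewrite /RI /Rintegral (@continuous_FTC2 _ f F) //.
- exact: continuous_subspaceT.
- split; [by move=> t _; have [] := dF t|by apply: cvg_at_right_filter; exact: cF|by apply: cvg_at_left_filter; exact: cF].
by move=> t _; rewrite derive1E; have [_ ->] := dF t.
Qed.

(** The example is [cos (m.+1 * t)] or [sin (m.+1 * t)] on a full turn, cut into [m.+1] periods. *)
Section oscillating_family.
Variables (L : R) (W : nat -> R -> R).
Hypothesis L0 : 0 < L.
Hypothesis cW : forall m, continuous (W m).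
Hypothesis W1 : forall m t, `|W m t| <= 1.
Hypothesis W0 : forall m j, piece L m j (W m) = 0.

Let mW m : measurable_fun `[0, L] (W m).
Proof. by apply: measurable_funTS; apply: continuous_measurable_fun. Qed.

(** Freezing [f] at the nodes costs its oscillation on each piece, and the frozen integral vanishes. *)
Lemma oscillation_bound f m (eta : nat -> R) : continuous f ->
  (forall j t, (j <= m)%N -> node L m j <= t <= node L m j.+1 -> `|f t - f (node L m j)| <= eta j) ->
  `|RI 0 L (fun t => W m t * f t)| <= (\sum_(j < m.+1) eta j) * (L / m.+1%:R).
Proof.
move=> cf H; have L0' := ltW L0.
have mf : measurable_fun `[0, L] f by apply: measurable_funTS; apply: continuous_measurable_fun.
have iW : integ 0 L (W m) by exact: integ_cont.
have := freeze L0' iW mf _ H; rewrite [X in _ - X]big1 ?subr0 => [|j _]; last by rewrite W0 mulr0.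
move=> F; apply: le_trans (F _) _.
  by apply: integ_cont => t; apply: cvgM; [exact: cW|exact: cf].
rewrite mulr_suml; apply: ler_sum => j _; have jm : (j <= m)%N by rewrite -ltnS.
have nj := node_le m L0' (leqnSn j); apply: ler_wpM2l.
  by apply: le_trans (normr_ge0 _) (H j (node L m j) jm _); rewrite lexx nj.
rewrite -(node_step L m j) -[leRHS]mul1r -RI_cst //; apply: RI_le => //.
- by apply: integ_norm; exact: integ_cont.
- by apply: integ_cont => t; exact: cvg_cst.
Qed.

(** The oscillations on the pieces add up to at most the total variation. *)
Lemma oscillation_bv f (V : R -> R) m : continuous f ->
  (forall s t, 0 <= s -> s <= t -> t <= L -> `|f t - f s| <= V t - V s) ->
  `|RI 0 L (fun t => W m t * f t)| <= (V L - V 0) * (L / m.+1%:R).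
Proof.
move=> cf H; have L0' := ltW L0.
have Vle s t : 0 <= s -> s <= t -> t <= L -> V s <= V t.
  by move=> s0 st tL; have := H s t s0 st tL; have := normr_ge0 (f t - f s); lra.
have := @oscillation_bound f m (fun j => V (node L m j.+1) - V (node L m j)) cf.
rewrite -(big_mkord xpredT (fun j => V (node L m j.+1) - V (node L m j))) telescope_sumr // node0 nodeS; apply.
move=> j t jm /andP[t1 t2].
have n0 : 0 <= node L m j by rewrite -(node0 L m) node_le.
have nL : node L m j.+1 <= L by rewrite -[leRHS](nodeS L m) node_le.
apply: le_trans (H _ _ n0 t1 (le_trans t2 nL)) _; rewrite lerD2r; apply: Vle => //; exact: le_trans t1.
Qed.

(** For a continuous function this is [oscillation_bound], and continuous functions are dense. *)
Lemma riemann_lebesgue g e : integ 0 L g -> 0 < e -> exists N, forall m, (N <= m)%N ->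
  `|RI 0 L (fun t => g t * W m t)| <= e.
Proof.
move=> ig e0; have e20 : 0 < e / 2 by rewrite divr_gt0.
have fin : (mu `[0%R, L] < +oo)%E.
  by rewrite lebesgue_measure_itv /=; case: ifP => _; rewrite ?ltry // -EFinB ltry.
have [g_ [cg ig_ lim]] := approximation_continuous_integrable (measurable_itv _) fin ig.
have [n Hn] : exists n, RI 0 L (fun t => `|g t - g_ n t|) <= e / 2.
  have /fine_cvgP[_ /cvgrPdist_lt/(_ _ e20)[N _ HN]] := lim.
  exists N; have := HN N (leqnn N); rewrite sub0r normrN => /ltW; apply: le_trans; exact: ler_norm.
have eL : 0 < e / 2 / L by rewrite divr_gt0.
have [d d0 Hd] := continuous_uniform L (cg n) eL.
have dL : 0 < d / L by rewrite divr_gt0.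
have [N HN] := harmonic_small dL.
exists N => m Nm; have nd := HN m Nm.
have h1 : `|RI 0 L (fun t => W m t * g_ n t)| <= e / 2.
  have := @oscillation_bound (g_ n) m (fun=> e / 2 / L) (cg n).
  have -> : (\sum_(j < m.+1) e / 2 / L) * (L / m.+1%:R) = e / 2.
    have l0 : L != 0 by rewrite gt_eqF.
    have q0 : m.+1%:R != 0 :> R by rewrite pnatr_eq0.
    by rewrite sumr_const card_ord -[_ *+ m.+1]mulr_natr; move: (m.+1%:R : R) q0 => q q0; field; rewrite l0 q0.
  apply=> j t jm /andP[t1 t2]; apply/ltW/Hd.
  - apply/andP; split; first by apply: le_trans t1; rewrite -(node0 L m) node_le // ltW.
    by apply: le_trans t2 _; rewrite -[leRHS](nodeS L m) node_le // ltW.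
  - apply/andP; split; first by rewrite -(node0 L m) node_le // ltW.
    by rewrite -[leRHS](nodeS L m) node_le ?ltW // leqW.
  rewrite ger0_norm ?subr_ge0 //; have := node_step L m j.
  have : L / m.+1%:R < d by rewrite mulrC -ltr_pdivlMr.
  by move: (L / m.+1%:R) => q; lra.
have igW : integ 0 L (fun t => g t * W m t) by exact: (integ_mul (B := 1)).
have igW' : integ 0 L (fun t => W m t * g_ n t).
  by apply: integ_cont => t; apply: cvgM; [exact: cW|exact: cg].
have id : integ 0 L (fun t => g t - g_ n t) by apply: integB => //; exact: ig_.
have E : RI 0 L (fun t => g t * W m t) = RI 0 L (fun t => W m t * g_ n t) + RI 0 L (fun t => (g t - g_ n t) * W m t).
  rewrite -RID //; last exact: (integ_mul (B := 1)).
  by apply: RI_eq => t _; ring.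
rewrite E; apply: le_trans (ler_normD _ _) _.
have : `|RI 0 L (fun t => (g t - g_ n t) * W m t)| <= 1 * RI 0 L (fun t => `|g t - g_ n t|) by apply: RI_mul_le.
lra.
Qed.

End oscillating_family.
End oscillation.


(** * Complex integrals over a turn *)

Section complex_integrals.
Variable R : realType.
Implicit Types (f g psi F G : R -> R[i]) (s t : R) (z c : R[i]).
Local Notation L := (2 * pi : R).
Local Notation integ0 f := (integ 0 L f).
Local Notation I0 f := (RI 0 L f).

Lemma two_pi_gt0 : 0 < L.
Proof. by rewrite mulr_gt0 // pi_gt0. Qed.

Definition cinteg f := integ0 (fun t => complex.Re (f t)) /\ integ0 (fun t => complex.Im (f t)).

Definition cbounded F := [/\ continuous (fun t => complex.Re (F t)), continuous (fun t => complex.Im (F t)) &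
  exists B, forall t, cabs (F t) <= B].

Lemma cintegralE f : cintegral f = I0 (fun t => complex.Re (f t)) +i* I0 (fun t => complex.Im (f t)).
Proof. by []. Qed.

Lemma cintegral_eq f g : (forall t, f t = g t) -> cintegral f = cintegral g.
Proof. by move=> fg; congr cintegral; apply/funext. Qed.

Lemma cintegralD f g : cinteg f -> cinteg g ->
  cintegral (fun t => f t + g t) = cintegral f + cintegral g.
Proof.
move=> [f1 f2] [g1 g2]; rewrite !cintegralE.
rewrite (@RI_eq _ _ _ (fun t => complex.Re (f t + g t)) (fun t => complex.Re (f t) + complex.Re (g t)));
  last by move=> t _; rewrite ReD.
rewrite (@RI_eq _ _ _ (fun t => complex.Im (f t + g t)) (fun t => complex.Im (f t) + complex.Im (g t)));
  last by move=> t _; rewrite ImD.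
by rewrite !RID //; apply/eqP; rewrite eq_complex ReD ImD /= !eqxx.
Qed.

Lemma cintegZ c f : cinteg f -> cinteg (fun t => c * f t).
Proof.
move=> [f1 f2]; split.
  apply: eq_integrable (integB (integZ (complex.Re c) f1) (integZ (complex.Im c) f2)) => // t _ /=.
  by rewrite ReM.
apply: eq_integrable (integD (integZ (complex.Re c) f2) (integZ (complex.Im c) f1)) => // t _ /=.
by rewrite ImM.
Qed.

Lemma cintegralZ c f : cinteg f -> cintegral (fun t => c * f t) = c * cintegral f.
Proof.
move=> [f1 f2]; rewrite !cintegralE.
rewrite (@RI_eq _ _ _ (fun t => complex.Re (c * f t)) (fun t => complex.Re c * complex.Re (f t) - complex.Im c * complex.Im (f t)));
  last by move=> t _; rewrite ReM.
rewrite (@RI_eq _ _ _ (fun t => complex.Im (c * f t)) (fun t => complex.Re c * complex.Im (f t) + complex.Im c * complex.Re (f t)));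
  last by move=> t _; rewrite ImM.
have z1 := integZ (complex.Re c) f1; have z2 := integZ (complex.Im c) f2.
have z3 := integZ (complex.Re c) f2; have z4 := integZ (complex.Im c) f1.
by rewrite RIB // RID // !RIZ //; apply/eqP; rewrite eq_complex ReM ImM /= !eqxx.
Qed.

Lemma cbounded_Re F B : continuous (fun t => complex.Re (F t)) -> (forall t, cabs (F t) <= B) -> forall f : R -> R,
  integ0 f -> integ0 (fun t => f t * complex.Re (F t)).
Proof.
move=> cF FB f jf; apply: (integ_mul (B := B) jf).
  by apply: measurable_funTS; exact: continuous_measurable_fun.
by move=> t _; exact: le_trans (cabs_Re _) (FB t).
Qed.

Lemma cbounded_Im F B : continuous (fun t => complex.Im (F t)) -> (forall t, cabs (F t) <= B) -> forall f : R -> R,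
  integ0 f -> integ0 (fun t => f t * complex.Im (F t)).
Proof.
move=> cF FB f jf; apply: (integ_mul (B := B) jf).
  by apply: measurable_funTS; exact: continuous_measurable_fun.
by move=> t _; exact: le_trans (cabs_Im _) (FB t).
Qed.

Lemma cinteg_mul psi F : cinteg psi -> cbounded F -> cinteg (fun t => psi t * F t).
Proof.
move=> [p1 p2] [cR cI [B FB]]; split.
  apply: eq_integrable (integB (cbounded_Re cR FB p1) (cbounded_Im cI FB p2)) => // t _ /=.
  by rewrite ReM.
apply: eq_integrable (integD (cbounded_Im cI FB p1) (cbounded_Re cR FB p2)) => // t _ /=.
by rewrite ImM.
Qed.

Definition cnorm psi := I0 (fun t => `|complex.Re (psi t)|) + I0 (fun t => `|complex.Im (psi t)|).

Lemma cnorm_ge0 psi : 0 <= cnorm psi.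
Proof. by rewrite addr_ge0 // RI_norm_ge0. Qed.

Lemma cintegral_mul psi F : cinteg psi -> cbounded F ->
  cintegral (fun t => psi t * F t) =
    (I0 (fun t => complex.Re (psi t) * complex.Re (F t)) - I0 (fun t => complex.Im (psi t) * complex.Im (F t)))
    +i* (I0 (fun t => complex.Re (psi t) * complex.Im (F t)) + I0 (fun t => complex.Im (psi t) * complex.Re (F t))).
Proof.
move=> [p1 p2] [cR cI [B FB]]; rewrite cintegralE.
rewrite -RIB; [|exact: (cbounded_Re cR FB p1)|exact: (cbounded_Im cI FB p2)].
rewrite -RID; [|exact: (cbounded_Im cI FB p1)|exact: (cbounded_Re cR FB p2)].
congr (_ +i* _); apply: RI_eq => t _; by rewrite ?ReM ?ImM.
Qed.

Lemma cintegral_bound psi F B : 0 <= B -> cinteg psi -> cbounded F -> (forall t, cabs (F t) <= B) ->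
  cabs (cintegral (fun t => psi t * F t)) <= 2 * B * cnorm psi.
Proof.
move=> B0 ip bF FB; rewrite cintegral_mul //; have [p1 p2] := ip; have [cR cI _] := bF.
have mR : measurable_fun `[0, L] (fun t => complex.Re (F t)).
  by apply: measurable_funTS; exact: continuous_measurable_fun.
have mI : measurable_fun `[0, L] (fun t => complex.Im (F t)).
  by apply: measurable_funTS; exact: continuous_measurable_fun.
have bR t : 0 <= t <= L -> `|complex.Re (F t)| <= B by move=> _; exact: le_trans (cabs_Re _) (FB t).
have bI t : 0 <= t <= L -> `|complex.Im (F t)| <= B by move=> _; exact: le_trans (cabs_Im _) (FB t).
apply: le_trans (cabs_le _) _; rewrite /=.
apply: le_trans (lerD (ler_normB _ _) (ler_normD _ _)) _.
have := RI_mul_le B0 p1 mR bR; have := RI_mul_le B0 p1 mI bI.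
have := RI_mul_le B0 p2 mR bR; have := RI_mul_le B0 p2 mI bI.
rewrite /cnorm; move: (I0 _) (I0 _) (I0 _) (I0 _) (I0 _) (I0 _) => v1 v2 v3 v4 v5 v6; nra.
Qed.

Lemma cboundedD F G : cbounded F -> cbounded G -> cbounded (fun t => F t + G t).
Proof.
move=> [f1 f2 [B FB]] [g1 g2 [C GC]]; split.
- have -> : (fun t => complex.Re (F t + G t)) = (fun t => complex.Re (F t) + complex.Re (G t)).
    by apply/funext => t; rewrite ReD.
  by move=> t; apply: cvgD; [exact: f1|exact: g1].
- have -> : (fun t => complex.Im (F t + G t)) = (fun t => complex.Im (F t) + complex.Im (G t)).
    by apply/funext => t; rewrite ImD.
  by move=> t; apply: cvgD; [exact: f2|exact: g2].
by exists (B + C) => t; apply: le_trans (cabsD _ _) _; exact: lerD.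
Qed.

Lemma cboundedZ c F : cbounded F -> cbounded (fun t => c * F t).
Proof.
move=> [f1 f2 [B FB]]; split.
- have -> : (fun t => complex.Re (c * F t)) = (fun t => complex.Re c * complex.Re (F t) - complex.Im c * complex.Im (F t)).
    by apply/funext => t; rewrite ReM.
  by move=> t; apply: cvgB; apply: cvgM; try exact: cvg_cst; [exact: f1|exact: f2].
- have -> : (fun t => complex.Im (c * F t)) = (fun t => complex.Re c * complex.Im (F t) + complex.Im c * complex.Re (F t)).
    by apply/funext => t; rewrite ImM.
  by move=> t; apply: cvgD; apply: cvgM; try exact: cvg_cst; [exact: f2|exact: f1].
by exists (cabs c * B) => t; rewrite cabsM ler_wpM2l // cabs_ge0.
Qed.

Lemma cbounded_expi (k : R) : cbounded (fun t => expi (k * t)).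
Proof.
have ck : continuous (fun t : R => k * t) by move=> t; apply: cvgM; [exact: cvg_cst|exact: cvg_id].
split.
- by move=> t; apply: (continuous_comp (ck t)); exact: continuous_cos.
- by move=> t; apply: (continuous_comp (ck t)); exact: continuous_sin.
by exists 1 => t; rewrite cabs_expi.
Qed.

Lemma cbounded_cst c : cbounded (fun=> c).
Proof. by split; [move=> t; exact: cvg_cst|move=> t; exact: cvg_cst|exists (cabs c)]. Qed.

Lemma cbounded_cinteg F : cbounded F -> cinteg F.
Proof. by move=> [c1 c2 _]; split; exact: integ_cont. Qed.

Lemma cbounded_sum (n : nat) (F : nat -> R -> R[i]) : (forall k, cbounded (F k)) ->
  cbounded (fun t => \sum_(0 <= k < n) F k t).
Proof.
move=> H; elim: n => [|n IH].
  rewrite (_ : (fun t => _) = fun=> 0); first exact: cbounded_cst.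
  by apply/funext => t; rewrite big_geq.
rewrite (_ : (fun t => _) = fun t => \sum_(0 <= k < n) F k t + F n t); first exact: cboundedD.
by apply/funext => t; rewrite big_nat_recr.
Qed.

Lemma cintegral_sum psi (n : nat) (F : nat -> R -> R[i]) : cinteg psi -> (forall k, cbounded (F k)) ->
  cintegral (fun t => psi t * \sum_(0 <= k < n) F k t) = \sum_(0 <= k < n) cintegral (fun t => psi t * F k t).
Proof.
move=> ip H; elim: n => [|n IH].
  rewrite big_geq // (@cintegral_eq _ (fun t => 0 * psi t)); first by rewrite cintegralZ // mul0r.
  by move=> t; rewrite big_geq // mulr0 mul0r.
rewrite big_nat_recr //= -IH -cintegralD; [|apply: cinteg_mul => //; exact: cbounded_sum|exact: cinteg_mul].
by apply: cintegral_eq => t; rewrite big_nat_recr //= mulrDr.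
Qed.

Definition wcos (m : nat) t : R := cos (m.+1%:R * t).
Definition wsin (m : nat) t : R := sin (m.+1%:R * t).

Lemma wcos_continuous m : continuous (wcos m).
Proof. by have [c _ _] := cbounded_expi m.+1%:R. Qed.

Lemma wsin_continuous m : continuous (wsin m).
Proof. by have [_ c _] := cbounded_expi m.+1%:R. Qed.

Lemma wcos_le1 m t : `|wcos m t| <= 1.
Proof. by have := cabs_Re (expi (m.+1%:R * t)); rewrite cabs_expi. Qed.

Lemma wsin_le1 m t : `|wsin m t| <= 1.
Proof. by have := cabs_Im (expi (m.+1%:R * t)); rewrite cabs_expi. Qed.

Lemma expi_node m j : expi (m.+1%:R * node L m j) = 1 :> R[i].
Proof.
rewrite /node (_ : _ * _ = j%:R * L); first by rewrite -expiX expi_2pi expr1n.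
by rewrite mulrC divfK ?pnatr_eq0 // mulrC.
Qed.

Lemma is_derive_lin (k t : R) : is_derive t 1 (fun s : R => k * s) k.
Proof. by apply: is_derive_eq; rewrite /GRing.scale /= ?scaler0 ?mulr0 ?add0r ?addr0 ?mulr1. Qed.

Lemma wcos_piece m j : piece L m j (wcos m) = 0.
Proof.
have k0 : m.+1%:R != 0 :> R by rewrite pnatr_eq0.
have dW t : is_derive t 1 (fun t : R => m.+1%:R^-1 * sin (m.+1%:R * t)) (wcos m t).
  have d1 : is_derive t 1 (fun s : R => sin (m.+1%:R * s)) (cos (m.+1%:R * t) * m.+1%:R).
    apply: is_derive1_comp; exact: is_derive_lin.
  by apply: is_derive_eq; rewrite /GRing.scale /= ?mulr0 ?addr0 /wcos mulrCA mulVf // mulr1.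
rewrite /piece (RI_derive _ (@wcos_continuous m) dW); last by apply: node_le => //; exact/ltW/two_pi_gt0.
have e k : sin (m.+1%:R * node L m k) = 0 :> R by have := congr1 (@complex.Im R) (expi_node m k).
by rewrite !e !mulr0 subrr.
Qed.

Lemma wsin_piece m j : piece L m j (wsin m) = 0.
Proof.
have k0 : m.+1%:R != 0 :> R by rewrite pnatr_eq0.
have dW t : is_derive t 1 (fun t : R => - m.+1%:R^-1 * cos (m.+1%:R * t)) (wsin m t).
  have d1 : is_derive t 1 (fun s : R => cos (m.+1%:R * s)) (- sin (m.+1%:R * t) * m.+1%:R).
    apply: is_derive1_comp; exact: is_derive_lin.
  by apply: is_derive_eq; rewrite /GRing.scale /= ?mulr0 ?addr0 /wsin mulNr mulNr mulrN opprK mulrCA mulVf // mulr1.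
rewrite /piece (RI_derive _ (@wsin_continuous m) dW); last by apply: node_le => //; exact/ltW/two_pi_gt0.
have e k : cos (m.+1%:R * node L m k) = 1 :> R by have := congr1 (@complex.Re R) (expi_node m k).
by rewrite !e subrr.
Qed.

Lemma cintegral_expi m : cintegral (fun t => expi (m.+1%:R * t) : R[i]) = 0.
Proof.
have L0 := ltW two_pi_gt0.
rewrite cintegralE -/(wcos m) -/(wsin m) !(RI_partition m) //; try by apply: integ_cont; [exact: wcos_continuous||exact: wsin_continuous].
by rewrite !big1 // => j _; [exact: wsin_piece|exact: wcos_piece].
Qed.

Lemma cintegral_conj f : cinteg f -> cintegral (fun t => conjc (f t)) = conjc (cintegral f).
Proof.
move=> [f1 f2]; rewrite !cintegralE /=; congr (_ +i* _).
  by apply: RI_eq => t _; case: (f t).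
rewrite -[RHS]mulN1r -RIZ //; apply: RI_eq => t _; case: (f t) => u v /=; by rewrite mulN1r.
Qed.

Lemma expi_orthogonal (m k : nat) :
  cintegral (fun t => expi (m%:R * t) * expi (- (k%:R * t)) : R[i]) = if k == m then L%:C else 0.
Proof.
have mulN (n : nat) t : expi (- (n%:R * t)) = conjc (expi (n%:R * t)) :> R[i] by rewrite expiN.
case: (ltngtP k m) => km.
- have [n E] : exists n, m = (k + n.+1)%N by exists (m - k).-1; lia.
  rewrite -(cintegral_expi n); apply: cintegral_eq => t; rewrite -expiD; congr expi.
  by rewrite E natrD; ring.
- have [n E] : exists n, k = (m + n.+1)%N by exists (k - m).-1; lia.
  transitivity (conjc (cintegral (fun t => expi (n.+1%:R * t) : R[i]))); last first.
    by rewrite cintegral_expi; apply/eqP; rewrite eq_complex /= oppr0 !eqxx.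
  rewrite -cintegral_conj; last by apply: cbounded_cinteg; exact: cbounded_expi.
  apply: cintegral_eq => t; rewrite -expiN -expiD; congr expi.
  by rewrite E natrD; ring.
rewrite (@cintegral_eq _ (fun=> 1)) => [|t]; last by rewrite km -expiD subrr expi0.
rewrite cintegralE /= !RI_cst ?(ltW two_pi_gt0) //; apply/eqP; rewrite eq_complex /=.
by rewrite subr0 mul1r mul0r !eqxx.
Qed.

End complex_integrals.


(** * Fourier coefficients of the boundary curve *)

Section laurent_fourier.
Variable R : realType.
Variables (D : set 'rV[R]_2) (gam : R) (Phi : R[i] -> R[i]) (a : nat -> R[i]).
Hypothesis Phi_ext : exterior_conformal_map D gam Phi a.
Hypothesis oD : open D.
Hypothesis lipD : lipschitz_boundary D.
Implicit Types (psi F : R -> R[i]) (s t r e : R) (w : R[i]).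
Local Notation L := (2 * pi : R).
Let g0 : 0 < gam.
Proof. exact: ecm_gam_gt0 Phi_ext. Qed.

(** The part of [Phi] that is holomorphic at infinity, along a circle. *)
Definition tail r t : R[i] := Phi (r%:C * expi t) - r%:C * expi t.

(** Up to the factor [2 pi], a Fourier coefficient. *)
Definition fcoef psi (m : nat) : R[i] := cintegral (fun t => psi t * expi (- (m%:R * t))).

Lemma circle_expi_cont r t e : 0 < r -> 0 < e -> exists2 d, 0 < d &
  forall s, `|s - t| < d -> cabs (r%:C * expi s - r%:C * expi t) < e.
Proof.
move=> r0 e0; have er : 0 < e / r by rewrite divr_gt0.
have [d d0 Hd] := expi_continuous t er; exists d => // s /Hd H.
by rewrite -mulrBr cabsM cabs_real gtr0_norm // mulrC -ltr_pdivlMr.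
Qed.

Lemma cbounded_tail r : gam <= r -> cbounded (tail r).
Proof.
move=> gr; have r0 : 0 < r := lt_le_trans g0 gr.
have cr t : cabs (r%:C * expi t) = r by rewrite cabs_circle // ltW.
have ct t e : 0 < e -> exists2 d, 0 < d & forall s, `|s - t| < d -> cabs (tail r s - tail r t) < e.
  move=> e0; have e20 : 0 < e / 2 by rewrite divr_gt0.
  have [|d d0 Hd] := @Phi_continuous _ _ _ _ _ Phi_ext (r%:C * expi t) _ (e / 2) e20; first by rewrite cr.
  have [d1 d10 H1] := circle_expi_cont t r0 d0.
  have [d2 d20 H2] := circle_expi_cont t r0 e20.
  exists (Num.min d1 d2) => [|s]; first by rewrite lt_min d10.
  rewrite lt_min => /andP[/H1 s1 /H2 s2].
  have := Hd (r%:C * expi s); rewrite cr => /(_ gr s1) s3.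
  have -> : tail r s - tail r t = (Phi (r%:C * expi s) - Phi (r%:C * expi t)) - (r%:C * expi s - r%:C * expi t).
    by rewrite /tail; ring.
  apply: le_lt_trans (cabsD _ _) _; rewrite cabsN; lra.
have [K K0 HK] := @Phi_near_id _ _ _ _ _ Phi_ext.
split.
- move=> t; apply/cvgrPdist_lt => e e0; have [d d0 Hd] := ct t e e0.
  apply/nbhs_ballP; exists d => // s; rewrite /ball /= distrC => /Hd H.
  rewrite distrC -ReN -ReD; exact: le_lt_trans (cabs_Re _) H.
- move=> t; apply/cvgrPdist_lt => e e0; have [d d0 Hd] := ct t e e0.
  apply/nbhs_ballP; exists d => // s; rewrite /ball /= distrC => /Hd H.
  rewrite distrC -ImN -ImD; exact: le_lt_trans (cabs_Im _) H.
by exists K => t; apply: HK; rewrite cr.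
Qed.

Lemma tail_close e : 0 < e -> exists2 d, 0 < d & forall r, gam <= r -> r < gam + d ->
  forall t, cabs (tail r t - tail gam t) <= e.
Proof.
move=> e0; have e20 : 0 < e / 2 by rewrite divr_gt0.
have [d d0 Hd] := @Phi_uniform _ _ _ _ _ Phi_ext (gam + 1) (e / 2) e20.
exists (Num.min (Num.min d 1) (e / 2)) => [|r gr]; first by rewrite !lt_min d0 ltr01.
rewrite -ltrBlDl !lt_min => /andP[/andP[rd r1] re] t; have g0' := g0.
have dist : cabs (r%:C * expi t - gam%:C * expi t) = r - gam.
  by rewrite -mulrBl -rmorphB /= cabsM cabs_real cabs_expi mulr1 ger0_norm // subr_ge0.
have H : cabs (Phi (r%:C * expi t) - Phi (gam%:C * expi t)) < e / 2.
  by apply: Hd; rewrite ?cabs_circle ?dist //; try lra; apply/andP; split; lra.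
have -> : tail r t - tail gam t = (Phi (r%:C * expi t) - Phi (gam%:C * expi t)) - (r%:C * expi t - gam%:C * expi t).
  by rewrite /tail; ring.
apply: le_trans (cabsD _ _) _; rewrite cabsN dist; lra.
Qed.

(** On a circle larger than the boundary circle the expansion converges uniformly. *)
Lemma laurent_integral psi r e : cinteg psi -> gam < r -> 0 < e -> exists N, forall n, (N <= n)%N ->
  cabs (\sum_(0 <= k < n) a k / r%:C ^+ k * fcoef psi k - cintegral (fun t => psi t * tail r t)) <= e.
Proof.
move=> ip gr e0; have r0 : 0 < r := lt_trans g0 gr.
have c1 : 0 < 2 * cnorm psi + 1 by have := cnorm_ge0 psi; lra.
have ec : 0 < e / (2 * cnorm psi + 1) by rewrite divr_gt0.
have [N HN] := @lsum_uniform _ _ _ _ _ Phi_ext r gr _ ec.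
exists N => n Nn.
have bt := cbounded_tail (ltW gr).
have bk k : cbounded (fun t => a k / r%:C ^+ k * expi (- (k%:R * t))).
  by apply: cboundedZ; have := cbounded_expi (- k%:R : R); congr cbounded; apply/funext => t; rewrite mulNr.
have be k : cbounded (fun t => expi (- (k%:R * t)) : R[i]).
  by have := cbounded_expi (- k%:R : R); congr cbounded; apply/funext => t; rewrite mulNr.
have -> : \sum_(0 <= k < n) a k / r%:C ^+ k * fcoef psi k =
   cintegral (fun t => psi t * \sum_(0 <= k < n) (a k / r%:C ^+ k * expi (- (k%:R * t)))).
  rewrite cintegral_sum //; apply: eq_bigr => k _; rewrite -cintegralZ; last exact: cinteg_mul.
  by apply: cintegral_eq => t; rewrite mulrCA.
have bs := cbounded_sum n bk.
have bN : cbounded (fun t => -1 * tail r t) by exact: cboundedZ.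
have -> : cintegral (fun t => psi t * \sum_(0 <= k < n) (a k / r%:C ^+ k * expi (- (k%:R * t)))) -
   cintegral (fun t => psi t * tail r t) =
   cintegral (fun t => psi t * (\sum_(0 <= k < n) (a k / r%:C ^+ k * expi (- (k%:R * t))) + -1 * tail r t)).
  rewrite -[- cintegral _]mulN1r -cintegralZ; last exact: cinteg_mul.
  rewrite -cintegralD; [|exact: cinteg_mul|by apply: cintegZ; exact: cinteg_mul].
  by apply: cintegral_eq => t; rewrite /=; ring.
apply: le_trans (cintegral_bound (ltW ec) ip (cboundedD bs bN) _) _.
  move=> t; have := HN n Nn (r%:C * expi t); rewrite cabs_circle ?(ltW r0) // lexx => /(_ isT)/ltW.
  congr (cabs _ <= _); rewrite mulN1r -/(tail r t); congr (_ - _); apply: eq_bigr => k _.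
  by rewrite exprMn invfM expiX expiV mulrA.
have := cnorm_ge0 psi.
rewrite mulrAC mulrA ler_pdivrMr //; have := ltW e0; nra.
Qed.

Lemma tail_coefficient m r : gam < r ->
  cintegral (fun t => expi (m%:R * t) * tail r t) = L%:C * (a m / r%:C ^+ m).
Proof.
move=> gr; have ip : cinteg (fun t => expi (m%:R * t) : R[i]) by apply: cbounded_cinteg; exact: cbounded_expi.
apply/eqP; rewrite -subr_eq0 -cabs_eq0 eq_le cabs_ge0 andbT; apply/ler_addgt0Pr => e e0; rewrite add0r.
have [N HN] := laurent_integral ip gr e0.
have := HN (N + m.+1)%N (leq_addr _ _); rewrite cabsB; congr (cabs (_ - _) <= _).
rewrite big_mkord (bigD1 (Ordinal (ltn_addl N (ltnSn m)))) //= big1 ?addr0 => [|k km].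
  by rewrite /fcoef expi_orthogonal eqxx mulrC.
rewrite /fcoef expi_orthogonal ifF ?mulr0 //; by apply: contraNF km => /eqP km; apply/eqP/val_inj.
Qed.

(** The boundary curve has bounded variation, so its Fourier coefficients are of order [1 / m]. The coefficient is
    computed on a slightly larger circle, of radius [gam * (1 + s)] with [s <= 1 / m], where the powers of the
    radius differ by a factor at most [expR 1]. *)
Lemma coefficient_bound : exists2 C, 0 <= C & forall m, m%:R * cabs (a m / gam%:C ^+ m) <= C.
Proof.
have [V HV] := bcurve_bounded_variation Phi_ext oD lipD.
have L0 := two_pi_gt0 R; have L0' := ltW L0.
have xU := bcurve_uniform Phi_ext.
have cR : continuous (fun t : R => complex.Re (bcurve gam Phi t)) by exact: Rex_continuous xU.
have cI : continuous (fun t : R => complex.Im (bcurve gam Phi t)) by exact: Imx_continuous xU.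
have VR s t : 0 <= s -> s <= t -> t <= L ->
    `|complex.Re (bcurve gam Phi t) - complex.Re (bcurve gam Phi s)| <= V t - V s.
  by move=> s0 st tL; apply: le_trans (HV s t s0 st tL); rewrite -ReN -ReD; exact: cabs_Re.
have VI s t : 0 <= s -> s <= t -> t <= L ->
    `|complex.Im (bcurve gam Phi t) - complex.Im (bcurve gam Phi s)| <= V t - V s.
  by move=> s0 st tL; apply: le_trans (HV s t s0 st tL); rewrite -ImN -ImD; exact: cabs_Im.
have VL0 : 0 <= V L - V 0 by apply: le_trans (cabs_ge0 _) (HV 0 L (lexx _) L0' (lexx _)).
have bg := cbounded_tail (lexx gam).
pose C1 := 4 * ((V L - V 0) * L).
have C10 : 0 <= C1 by rewrite /C1 mulr_ge0 // mulr_ge0.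
have bdr n : cabs (cintegral (fun t => expi (n.+1%:R * t) * tail gam t)) <= C1 / n.+1%:R.
  have ip : cinteg (fun t => expi (n.+1%:R * t) : R[i]) by apply: cbounded_cinteg; exact: cbounded_expi.
  have bc : cbounded (bcurve gam Phi).
    by split=> //; have [K _ HK] := bcurve_bounded Phi_ext; exists K.
  (* [tail] and the boundary curve differ by an exponential, orthogonal to the one in the integral. *)
  have -> : cintegral (fun t => expi (n.+1%:R * t) * tail gam t) = cintegral (fun t => expi (n.+1%:R * t) * bcurve gam Phi t).
    have E : forall t, expi (n.+1%:R * t) * tail gam t =
        expi (n.+1%:R * t) * bcurve gam Phi t + - gam%:C * expi (n.+2%:R * t).
      move=> t; have -> : expi (n.+2%:R * t) = expi (n.+1%:R * t) * expi t :> R[i].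
        by rewrite -expiD; congr expi; rewrite -[n.+2%:R]natr1; ring.
      by rewrite /tail -/(bcurve gam Phi t); ring.
    have i1 : cinteg (fun t => expi (n.+1%:R * t) * bcurve gam Phi t) by exact: cinteg_mul.
    have i2 : cinteg (fun t => expi (n.+2%:R * t) : R[i]) by apply: cbounded_cinteg; exact: cbounded_expi.
    by rewrite (cintegral_eq E) (cintegralD i1 (cintegZ _ i2)) cintegralZ // cintegral_expi mulr0 addr0.
  rewrite cintegral_mul //=; apply: le_trans (cabs_le _) _; rewrite /=.
  apply: le_trans (lerD (ler_normB _ _) (ler_normD _ _)) _.
  have h1 := oscillation_bv L0 (@wcos_continuous R) (@wcos_le1 R) (@wcos_piece R) n cR VR.
  have h2 := oscillation_bv L0 (@wcos_continuous R) (@wcos_le1 R) (@wcos_piece R) n cI VI.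
  have h3 := oscillation_bv L0 (@wsin_continuous R) (@wsin_le1 R) (@wsin_piece R) n cR VR.
  have h4 := oscillation_bv L0 (@wsin_continuous R) (@wsin_le1 R) (@wsin_piece R) n cI VI.
  rewrite /C1 -!mulrA; apply: le_trans (lerD (lerD h1 h4) (lerD h2 h3)) _.
  by rewrite le_eqVlt; apply/orP; left; apply/eqP; ring.
exists (expR 1 * (C1 + 1)) => [|[|n]]; first by rewrite mulr_ge0 ?expR_ge0 //; lra.
  by rewrite mul0r mulr_ge0 ?expR_ge0 //; lra.
have n0 : 0 < n.+1%:R :> R by [].
have ip : cinteg (fun t => expi (n.+1%:R * t) : R[i]) by apply: cbounded_cinteg; exact: cbounded_expi.
have q0 := cnorm_ge0 (fun t => expi (n.+1%:R * t) : R[i]).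
set q := cnorm _ in q0.
pose e := (n.+1%:R * (2 * q + 1))^-1.
have q1 : 0 < 2 * q + 1 by lra.
have e0 : 0 < e by rewrite invr_gt0 mulr_gt0.
have [d d0 Hd] := tail_close e0.
pose s := Num.min (n.+1%:R^-1) (d / 2 / gam).
have s0 : 0 < s by rewrite lt_min invr_gt0 n0 !divr_gt0.
pose r := gam * (1 + s).
have gr : gam < r by rewrite /r mulrDr mulr1 ltrDl mulr_gt0.
have rd : r < gam + d.
  have : s <= d / 2 / gam by rewrite ge_min lexx orbT.
  rewrite ler_pdivlMr // /r; lra.
have r0 : 0 < r := lt_trans g0 gr.
have bt := cbounded_tail (ltW gr).
have near : cabs (cintegral (fun t => expi (n.+1%:R * t) * tail r t)) <= (C1 + 1) / n.+1%:R.
  have E : cintegral (fun t => expi (n.+1%:R * t) * tail r t) =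
     cintegral (fun t => expi (n.+1%:R * t) * tail gam t) +
     cintegral (fun t => expi (n.+1%:R * t) * (tail r t + -1 * tail gam t)).
    have b1 := cboundedZ (-1) bg.
    rewrite -cintegralD; [|exact: cinteg_mul|by apply: cinteg_mul => //; exact: cboundedD].
    by apply: cintegral_eq => t; ring.
  rewrite E; apply: le_trans (cabsD _ _) _; rewrite mulrDl; apply: lerD => //.
  have b1 := cboundedZ (-1) bg.
  apply: le_trans (cintegral_bound (ltW e0) ip (cboundedD bt b1) _) _.
    by move=> t; rewrite mulN1r; exact: Hd (ltW gr) rd t.
  by rewrite -/q mulrAC /e ler_pdivrMr ?mulr_gt0 // mul1r mulKf ?gt_eqF //; lra.
rewrite tail_coefficient // cabsM cabs_real gtr0_norm // in near.
have L1 : 1 <= L by have := pi_ge2 R; lra.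
have near' : n.+1%:R * cabs (a n.+1 / r%:C ^+ n.+1) <= C1 + 1.
  move: near; rewrite ler_pdivlMr // => near; apply: le_trans near.
  have c0 := cabs_ge0 (a n.+1 / r%:C ^+ n.+1); move: (cabs _) c0 => c c0.
  by rewrite mulrC; apply: ler_wpM2r; [exact: ltW|rewrite -[leLHS]mul1r; apply: ler_wpM2r].
have -> : cabs (a n.+1 / gam%:C ^+ n.+1) = (1 + s) ^+ n.+1 * cabs (a n.+1 / r%:C ^+ n.+1).
  rewrite !cabsM !cabsV !cabsX !cabs_real !gtr0_norm // /r exprMn invfM.
  have : (1 + s) ^+ n.+1 != 0 by rewrite expf_neq0 // gt_eqF //; lra.
  by move: (cabs _) (_ ^+ _)^-1 ((1 + s) ^+ _) => c y v v0; field.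
rewrite mulrCA; apply: ler_pM => //.
- by rewrite exprn_ge0 //; lra.
- by rewrite mulr_ge0 ?cabs_ge0.
apply: (@le_trans _ _ (expR s ^+ n.+1)).
  by rewrite lerXn2r ?nnegrE ?expR_ge0 ?expR_ge1Dx //; lra.
rewrite -expRM_natl ler_expR.
by rewrite -ler_pdivlMl // mulr1 ge_min lexx.
Qed.

End laurent_fourier.


(** * Convergence of the series *)

Section tauber.
Variable R : realType.
Implicit Types (e r : R).

(** The partial sum up to [n] is compared with the Abel sum at the radius [r = 1 + 1 / n]. Since [m * |u_m|] tends
    to 0, the terms before [n] change by its Cesaro means, and those after [n] add up to a small multiple of the
    bounded quantity [1 / n * \sum r^-m]. *)
Lemma tauber (u : nat -> R[i]) (A : R -> R[i]) (l : R[i]) :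
  (forall e, 0 < e -> exists N, forall m, (N <= m)%N -> m%:R * cabs (u m) <= e) ->
  (forall r e, 1 < r -> 0 < e -> exists N, forall n, (N <= n)%N ->
     cabs (\sum_(1 <= m < n) u m / r%:C ^+ m - A r) <= e) ->
  (forall e, 0 < e -> exists2 d, 0 < d & forall r, 1 < r -> r < 1 + d -> cabs (A r - l) <= e) ->
  forall e, 0 < e -> exists N, forall n, (N <= n)%N -> cabs (\sum_(1 <= m < n) u m - l) <= e.
Proof.
move=> small abel lim e e0; have e60 : 0 < e / 6 by rewrite divr_gt0.
have [N1 H1] := small _ e60; have [d d0 Hd] := lim _ e60.
pose S := \sum_(0 <= m < N1) m%:R * cabs (u m).
have S0 : 0 <= S by apply: sumr_ge0 => m _; rewrite mulr_ge0 // cabs_ge0.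
have [N2 H2] := harmonic_small d0.
have eS : 0 < e / 6 / (S + 1) by rewrite divr_gt0 // ltr_wpDl.
have [N3 H3] := harmonic_small eS.
exists (N1 + N2 + N3).+1 => -[//|k] kN.
have n0 : 0 < k.+1%:R :> R by [].
have d1 := H2 k (leq_trans (leq_trans (leq_addl _ _) (leq_addr _ _)) kN).
have d2 := H3 k (leq_trans (leq_addl _ _) kN).
have kN1 : (N1 <= k.+1)%N by move: kN; lia.
set x : R := k.+1%:R^-1 in d1 d2; have x0 : 0 < x by rewrite invr_gt0.
have x1 : x * k.+1%:R = 1 by rewrite mulVf // gt_eqF.
pose r := 1 + x; have r1 : 1 < r by rewrite /r; lra.
have r0 : 0 < r by lra.
have [N4 H4] := abel r _ r1 e60.
pose n' := (N4 + k.+1)%N.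
have c4 := H4 n' (leq_addr _ _).
have cd : cabs (A r - l) <= e / 6 by apply: Hd => //; rewrite /r; lra.
have rX m : 0 < r ^+ m by rewrite exprn_gt0.
have normu m : cabs (u m / r%:C ^+ m) = cabs (u m) / r ^+ m.
  by rewrite cabsM cabsV cabsX cabs_real gtr0_norm.
have head : cabs (\sum_(1 <= m < k.+1) u m - \sum_(1 <= m < k.+1) u m / r%:C ^+ m) <= e / 6 + e / 6.
  rewrite -sumrB; apply: le_trans (cabs_sum _ _ _) _.
  apply: (@le_trans _ _ (\sum_(1 <= m < k.+1) x * (m%:R * cabs (u m)))).
    apply: ler_sum => m _; rewrite -[X in cabs (X - _)]mulr1 -mulrBr cabsM mulrA mulrC.
    apply: ler_wpM2r; first exact: cabs_ge0.
    rewrite (_ : 1 - (r%:C ^+ m)^-1 = (1 - (r ^+ m)^-1)%:C); last by rewrite rmorphB /= fmorphV rmorphXn.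
    have y1 j : (r ^+ j)^-1 <= 1 by rewrite invf_le1 // exprn_ege1 // ltW.
    have bern : 1 - m%:R * x <= (r ^+ m)^-1.
      elim: m => [|m IH]; first by rewrite mul0r subr0 expr0 invr1.
      rewrite exprS invfM -natr1; have := y1 m; have : 0 < (r ^+ m)^-1 by rewrite invr_gt0.
      have rV : r^-1 >= 1 - x.
        by rewrite -[r^-1]mul1r ler_pdivlMr // /r; have := x0; nra.
      move: IH; move: (_ ^-1) (r^-1) rV (m%:R : R) => y v rV k' IH yp yy; nra.
    rewrite cabs_real ger0_norm ?subr_ge0 //; lra.
  rewrite -mulr_sumr.
  apply: (@le_trans _ _ (x * (S + e / 6 * k.+1%:R))).
    apply: ler_wpM2l; first exact: ltW.
    apply: (@le_trans _ _ (\sum_(0 <= m < k.+1) m%:R * cabs (u m))).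
      by rewrite [leRHS]big_ltn // lerDr mulr_ge0 // cabs_ge0.
    rewrite (big_cat_nat (n := N1)) //=; apply: lerD => //.
    apply: (@le_trans _ _ (\sum_(N1 <= m < k.+1) e / 6)).
      by rewrite big_seq_cond [leRHS]big_seq_cond; apply: ler_sum => m; rewrite mem_index_iota => /andP[/andP[? _] _]; exact: H1.
    rewrite sumr_const_nat -[_ *+ (_ - _)]mulr_natr; apply: ler_wpM2l; first exact: ltW.
    by rewrite ler_nat leq_subr.
  rewrite mulrDr mulrCA x1 mulr1; apply: lerD => //.
  move: d2; rewrite ltr_pdivlMr; last by lra.
  nra.
have tl : cabs (\sum_(1 <= m < k.+1) u m / r%:C ^+ m - \sum_(1 <= m < n') u m / r%:C ^+ m) <= e / 6 + e / 6.
  rewrite cabsB (@big_cat_nat _ _ _ k.+1 1%N n') //=; last exact: leq_addl.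
  rewrite addrAC subrr add0r; apply: le_trans (cabs_sum _ _ _) _.
  apply: (@le_trans _ _ (\sum_(k.+1 <= m < n') (e / 6 * x) * (r^-1 ^+ m))).
    rewrite big_seq_cond [leRHS]big_seq_cond; apply: ler_sum => m; rewrite mem_index_iota => /andP[/andP[km _] _].
    rewrite normu -exprVn; apply: ler_wpM2r; first by rewrite exprn_ge0 // invr_ge0 ltW.
    have H := H1 m (leq_trans kN1 km); have mk : k.+1%:R <= m%:R :> R by rewrite ler_nat.
    rewrite /x ler_pdivlMr // mulrC; apply: le_trans H; exact: ler_wpM2r (cabs_ge0 _) _ _ mk.
  rewrite -mulr_sumr.
  have q1 : \sum_(k.+1 <= m < n') r^-1 ^+ m * (1 - r^-1) <= 1.
    have q0 : 0 <= r^-1 by rewrite invr_ge0 ltW.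
    have E m : r^-1 ^+ m * (1 - r^-1) = (- r^-1 ^+ m.+1) - (- r^-1 ^+ m) by rewrite exprS; ring.
    under eq_bigr do rewrite E.
    rewrite telescope_sumr ?leq_addl // opprK.
    have : r^-1 ^+ k.+1 <= 1 by rewrite exprn_ile1 // invf_le1 // ltW.
    have : 0 <= r^-1 ^+ n' by rewrite exprn_ge0.
    lra.
  rewrite -mulr_suml in q1.
  have rV : 1 - r^-1 = x / r by rewrite /r; field; rewrite gt_eqF.
  move: q1; rewrite rV; move: (\sum_(_ <= m < _) _) => s; rewrite mulrA ler_pdivrMr // mul1r => sx.
  have : x <= 1 by rewrite invf_le1 // ler1n.
  move: sx e60; rewrite /r -mulrA [x * s]mulrC; move: (s * x) (e / 6) => y v; nra.
have -> : \sum_(1 <= m < k.+1) u m - l = (\sum_(1 <= m < k.+1) u m - \sum_(1 <= m < k.+1) u m / r%:C ^+ m) +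
  (\sum_(1 <= m < k.+1) u m / r%:C ^+ m - \sum_(1 <= m < n') u m / r%:C ^+ m) +
  (\sum_(1 <= m < n') u m / r%:C ^+ m - A r) + (A r - l) by ring.
apply: le_trans (cabsD _ _) _; have := cabsD (\sum_(1 <= m < k.+1) u m - \sum_(1 <= m < k.+1) u m / r%:C ^+ m +
  (\sum_(1 <= m < k.+1) u m / r%:C ^+ m - \sum_(1 <= m < n') u m / r%:C ^+ m))
  (\sum_(1 <= m < n') u m / r%:C ^+ m - A r).
have := cabsD (\sum_(1 <= m < k.+1) u m - \sum_(1 <= m < k.+1) u m / r%:C ^+ m)
  (\sum_(1 <= m < k.+1) u m / r%:C ^+ m - \sum_(1 <= m < n') u m / r%:C ^+ m).
lra.
Qed.

End tauber.

Section fourier_pairing.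
Variable R : realType.
Variables (D : set 'rV[R]_2) (gam : R) (Phi : R[i] -> R[i]) (a : nat -> R[i]).
Hypothesis Phi_ext : exterior_conformal_map D gam Phi a.
Hypothesis oD : open D.
Hypothesis lipD : lipschitz_boundary D.
Implicit Types (psi F : R -> R[i]) (s t r e : R) (w : R[i]).
Local Notation L := (2 * pi : R).
Local Notation I0 f := (RI 0 L f).
Let g0 : 0 < gam.
Proof. exact: ecm_gam_gt0 Phi_ext. Qed.

Lemma fcoef_small psi e : cinteg psi -> 0 < e -> exists N, forall m, (N <= m)%N -> cabs (fcoef psi m) <= e.
Proof.
move=> ip e0; have [i1 i2] := ip; have e40 : 0 < e / 4 by rewrite divr_gt0.
have L0 := two_pi_gt0 R.
have [N1 H1] := riemann_lebesgue L0 (@wcos_continuous R) (@wcos_le1 R) (@wcos_piece R) i1 e40.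
have [N2 H2] := riemann_lebesgue L0 (@wcos_continuous R) (@wcos_le1 R) (@wcos_piece R) i2 e40.
have [N3 H3] := riemann_lebesgue L0 (@wsin_continuous R) (@wsin_le1 R) (@wsin_piece R) i1 e40.
have [N4 H4] := riemann_lebesgue L0 (@wsin_continuous R) (@wsin_le1 R) (@wsin_piece R) i2 e40.
exists (N1 + N2 + N3 + N4).+1 => -[//|m] mN.
have bF : cbounded (fun t => expi (- (m.+1%:R * t)) : R[i]).
  by have := cbounded_expi (- m.+1%:R : R); congr cbounded; apply/funext => t; rewrite mulNr.
have sinE g : integ 0 L g -> I0 (fun t => g t * complex.Im (expi (- (m.+1%:R * t)))) = - I0 (fun t => g t * wsin m t).
  move=> ig; rewrite -mulN1r -RIZ.
    by apply: RI_eq => t _; rewrite expiN /wsin /=; ring.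
  apply: (integ_mul (B := 1) ig); last by move=> t _; exact: wsin_le1.
  by apply: measurable_funTS; apply: continuous_measurable_fun; exact: wsin_continuous.
have cosE g : I0 (fun t => g t * complex.Re (expi (- (m.+1%:R * t)))) = I0 (fun t => g t * wcos m t).
  by apply: RI_eq => t _; rewrite expiN.
rewrite /fcoef cintegral_mul // !sinE // !cosE; apply: le_trans (cabs_le _) _; rewrite /= opprK.
have := H1 m; have := H2 m; have := H3 m; have := H4 m => h4 h3 h2 h1.
have {}h1 := h1 ltac:(clear -mN; lia); have {}h2 := h2 ltac:(clear -mN; lia).
have {}h3 := h3 ltac:(clear -mN; lia); have {}h4 := h4 ltac:(clear -mN; lia).
apply: le_trans (lerD (ler_normD _ _) (ler_normD _ _)) _; rewrite normrN.
move: (`|_|) (`|_|) (`|_|) (`|_|) h1 h2 h3 h4 => *; lra.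
Qed.

(** The Abel sums are integrals over larger circles by [laurent_integral], and they converge since [Phi] is
    uniformly continuous up to the boundary circle. The terms are [o(1 / m)]: the coefficients of [Phi] are
    [O(1 / m)] and those of [psi] tend to 0. *)
Lemma fourier_pairing psi e : cinteg psi -> cintegral psi = 0 -> 0 < e ->
  exists N, forall n, (N <= n)%N ->
  cabs (\sum_(1 <= m < n) a m / gam%:C ^+ m * fcoef psi m - cintegral (fun t => psi t * tail Phi gam t)) <= e.
Proof.
move=> ip z0; have [C C0 HC] := coefficient_bound Phi_ext oD lipD.
apply: (@tauber R _ (fun r => cintegral (fun t => psi t * tail Phi (gam * r) t))) => {}e.
- move=> e0; have C1 : 0 < C + 1 by lra.
  have eC : 0 < e / (C + 1) by rewrite divr_gt0.
  have [N HN] := fcoef_small ip eC.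
  exists N => m Nm; rewrite cabsM mulrA; have := HC m; have := HN m Nm.
  rewrite ler_pdivlMr // => h1 h2; have := cabs_ge0 (fcoef psi m).
  have : 0 <= m%:R * cabs (a m / gam%:C ^+ m) by rewrite mulr_ge0 // cabs_ge0.
  move: (cabs (fcoef _ _)) (m%:R * _) h1 h2 => y v *; nra.
- move=> e' r1 e0; have gr : gam < gam * e by rewrite ltr_pMr.
  have [N HN] := laurent_integral Phi_ext ip gr e0.
  exists N.+1 => n Nn; have := HN n (ltnW Nn); congr (cabs (_ - _) <= _).
  have f0 : fcoef psi 0 = 0.
    by rewrite -z0; apply: cintegral_eq => t; rewrite mul0r oppr0 expi0 mulr1.
  rewrite big_ltn ?f0 ?mulr0 ?add0r; last exact: leq_ltn_trans Nn.
  by apply: eq_bigr => m _; rewrite rmorphM /= exprMn invfM; ring.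
move=> e0.
have ec : 0 < e / (2 * cnorm psi + 1) by rewrite divr_gt0 //; have := cnorm_ge0 psi; lra.
have [d d0 Hd] := tail_close Phi_ext ec.
exists (d / gam) => [|r r1 rd]; first by rewrite divr_gt0.
have gr : gam <= gam * r by rewrite ler_peMr ?ltW.
have grd : gam * r < gam + d.
  by move: rd; rewrite -ltrBlDl ltr_pdivlMr // => rd; lra.
have b1 := cbounded_tail Phi_ext gr; have b2 := cboundedZ (-1) (cbounded_tail Phi_ext (lexx gam)).
have -> : cintegral (fun t => psi t * tail Phi (gam * r) t) - cintegral (fun t => psi t * tail Phi gam t) =
   cintegral (fun t => psi t * (tail Phi (gam * r) t + -1 * tail Phi gam t)).
  have b3 := cbounded_tail Phi_ext (lexx gam).
  rewrite -[- cintegral _]mulN1r -cintegralZ; last exact: cinteg_mul.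
  rewrite -cintegralD; [|exact: cinteg_mul|by apply: cintegZ; exact: cinteg_mul].
  by apply: cintegral_eq => t; rewrite /=; ring.
apply: le_trans (cintegral_bound (ltW ec) ip (cboundedD b1 b2) _) _.
  by move=> t; rewrite mulN1r; exact: Hd.
have c0 := cnorm_ge0 psi; rewrite mulrAC mulrA ler_pdivrMr; last by lra.
have := ltW e0; nra.
Qed.

Lemma cvg_cabs (u : nat -> R[i]^o) (l : R[i]^o) :
  (forall e, 0 < e -> exists N, forall n, (N <= n)%N -> cabs (u n - l) <= e) -> u @ \oo --> l.
Proof.
move=> H; apply/cvgrPdist_le => -[er ei]; rewrite ltcE /= => /andP[/eqP ei0 e0].
have [N HN] := H er e0; exists N => // n /= Nn; have := HN n Nn.
by rewrite cabsB -[cabs _ <= _]lecR -normC_cabs ei0.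
Qed.

Lemma bcurve_split t : bcurve gam Phi t = tail Phi gam t + gam%:C * expi t.
Proof. by rewrite /tail subrK. Qed.

Lemma cbounded_bcurve : cbounded (bcurve gam Phi).
Proof.
have xU := bcurve_uniform Phi_ext; split; [exact: Rex_continuous xU|exact: Imx_continuous xU|].
by have [K _ HK] := bcurve_bounded Phi_ext; exists K.
Qed.

(** The exponential in [Phi] pairs with the coefficient of index [-1] of [psi]; the constant [a 0] drops out since
    [psi] has mean zero. *)
Lemma pairing_series psi (u : nat -> R[i]^o) : cinteg psi -> cintegral psi = 0 ->
  (forall n, u n = \sum_(1 <= m < n) a m * ((L^-1)%:C * fcoef psi m / gam%:C ^+ m)) ->
  cvgn u /\ L%:C * (gam%:C * ((L^-1)%:C * cintegral (fun t => psi t * expi t)) + limn u) =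
    cintegral (fun t => psi t * bcurve gam Phi t).
Proof.
move=> ip z0 uE; have L0 := two_pi_gt0 R.
have LC : L%:C * (L^-1)%:C = 1 :> R[i] by rewrite -rmorphM /= divff // gt_eqF.
have cu : u @ \oo --> ((L^-1)%:C * cintegral (fun t => psi t * tail Phi gam t) : R[i]^o).
  apply: cvg_cabs => e e0; have [|N HN] := @fourier_pairing psi (e * L) ip z0; first by rewrite mulr_gt0.
  exists N => n /HN H; rewrite uE.
  have -> : \sum_(1 <= m < n) a m * ((L^-1)%:C * fcoef psi m / gam%:C ^+ m) =
     (L^-1)%:C * \sum_(1 <= m < n) a m / gam%:C ^+ m * fcoef psi m.
    by rewrite mulr_sumr; apply: eq_bigr => m _; ring.
  by rewrite -mulrBr cabsM cabs_real gtr0_norm ?invr_gt0 // mulrC ler_pdivrMr.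
split; first by apply/cvg_ex; eexists; exact: cu.
rewrite (cvg_lim (@norm_hausdorff _ _) cu).
have reg (p q v x y : R[i]) : p * q = 1 -> p * (v * (q * x) + q * y) = y + v * x.
  by move=> pq; rewrite mulrDr [p * (v * _)]mulrCA !mulrA -(mulrA v) pq mulr1 mul1r addrC.
rewrite reg //.
have be : cbounded (fun t => expi t : R[i]).
  by have := cbounded_expi (1 : R); congr cbounded; apply/funext => t; rewrite mul1r.
have bt := cbounded_tail Phi_ext (lexx gam).
rewrite -cintegralZ; last exact: cinteg_mul.
rewrite -cintegralD; [|exact: cinteg_mul|by apply: cintegZ; exact: cinteg_mul].
by apply: cintegral_eq => t; rewrite bcurve_split; ring.
Qed.

End fourier_pairing.


(** * Moments *)

Section moments.
Variable R : realType.
Variables (D : set 'rV[R]_2) (gam : R) (Phi : R[i] -> R[i]) (a : nat -> R[i]).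
Hypothesis Phi_ext : exterior_conformal_map D gam Phi a.
Hypothesis oD : open D.
Hypothesis lipD : lipschitz_boundary D.
Local Notation L := (2 * pi : R).
Local Notation b := (bcurve gam Phi).
Local Notation h := (scale_factor gam Phi).
Local Notation Mom1 phi l := (mom1 L b (dens gam Phi phi l)).
Local Notation Mom2 phi l := (mom2 L b (dens gam Phi phi l)).
Implicit Types (phi : 'rV[R]_2 -> 'rV[R]_2).

Definition cdens phi t : R[i] := (h t)%:C * toC (phi (bdpt gam Phi t)).

Lemma cdens_Re phi t : complex.Re (cdens phi t) = dens gam Phi phi i1 t.
Proof. by rewrite ReM /= mul0r subr0 mulrC. Qed.

Lemma cdens_Im phi t : complex.Im (cdens phi t) = dens gam Phi phi i2 t.
Proof. by rewrite ImM /= mul0r addr0 mulrC. Qed.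

Lemma coeffE phi (m : int) : coeff gam Phi phi m =
  (L^-1)%:C * cintegral (fun t => cdens phi t * expi (- (m%:~R * t))).
Proof. by []. Qed.

Section one_density.
Variables (phi : 'rV[R]_2 -> 'rV[R]_2).
Hypothesis L2 : bdL2 gam Phi phi.
Hypothesis mean1 : RI 0 L (dens gam Phi phi i1) = 0.
Hypothesis mean2 : RI 0 L (dens gam Phi phi i2) = 0.

Lemma cdens_cinteg : cinteg (cdens phi).
Proof.
split.
  by rewrite (_ : (fun t => _) = dens gam Phi phi i1); [exact: (dens_integ Phi_ext)|apply/funext => t; exact: cdens_Re].
by rewrite (_ : (fun t => _) = dens gam Phi phi i2); [exact: (dens_integ Phi_ext)|apply/funext => t; exact: cdens_Im].
Qed.

Lemma cdens_conj_cinteg : cinteg (fun t => conjc (cdens phi t)).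
Proof.
have [c1 c2] := cdens_cinteg; split.
  by apply: eq_integrable c1 => // t _ /=; case: (cdens phi t).
by apply: eq_integrable (integZ (-1) c2) => // t _ /=; case: (cdens phi t) => u v /=; rewrite mulN1r.
Qed.

Lemma cdens_mean : cintegral (cdens phi) = 0.
Proof.
have e1 : RI 0 L (fun t => complex.Re (cdens phi t)) = 0 by apply: etrans mean1; apply: RI_eq => t _; exact: cdens_Re.
have e2 : RI 0 L (fun t => complex.Im (cdens phi t)) = 0 by apply: etrans mean2; apply: RI_eq => t _; exact: cdens_Im.
by rewrite cintegralE e1 e2.
Qed.

Lemma cdens_conj_mean : cintegral (fun t => conjc (cdens phi t)) = 0.
Proof.
rewrite cintegral_conj; last exact: cdens_cinteg.
by rewrite cdens_mean; apply/eqP; rewrite eq_complex /= oppr0 !eqxx.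
Qed.

(** [E1] is the integral of [z * phi] over the boundary. *)
Lemma E1_value : cvgn (E1_partial gam a (coeff gam Phi phi)) /\
  E1 gam a (coeff gam Phi phi) = (Mom1 phi i1 - Mom2 phi i2) +i* (Mom2 phi i1 + Mom1 phi i2).
Proof.
have [|cu E] := @pairing_series _ _ _ _ _ Phi_ext oD lipD _ (E1_partial gam a (coeff gam Phi phi)) cdens_cinteg cdens_mean.
  by move=> n; apply: eq_bigr => m _; rewrite coeffE -pmulrn.
split=> //; rewrite /E1.
have -> : coeff gam Phi phi (-1) = (L^-1)%:C * cintegral (fun t => cdens phi t * expi t).
  by rewrite coeffE; congr (_ * _); apply: cintegral_eq => t; rewrite mulrN1z mulN1r opprK.
rewrite E cintegral_mul; [|exact: cdens_cinteg|exact: (cbounded_bcurve Phi_ext)].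
rewrite /mom1 /mom2; congr ((_ - _) +i* (_ + _)); apply: RI_eq => t _; by rewrite ?cdens_Re ?cdens_Im.
Qed.

(** [E2] is the integral of [z * conjc phi] over the boundary. *)
Lemma E2_value : cvgn (E2_partial gam a (coeff gam Phi phi)) /\
  E2 gam a (coeff gam Phi phi) = (Mom1 phi i1 + Mom2 phi i2) +i* (Mom2 phi i1 - Mom1 phi i2).
Proof.
have cc k : conjc (coeff gam Phi phi k) = (L^-1)%:C * cintegral (fun t => conjc (cdens phi t) * expi (k%:~R * t)).
  have bk : cbounded (fun t => expi (- (k%:~R * t)) : R[i]).
    by have := cbounded_expi (- k%:~R : R); congr cbounded; apply/funext => t; rewrite mulNr.
  have conjM (z w : R[i]) : conjc (z * w) = conjc z * conjc w by rewrite rmorphM.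
  rewrite coeffE conjM; congr (_ * _); first by apply/eqP; rewrite eq_complex /= oppr0 !eqxx.
  rewrite -cintegral_conj; last by apply: cinteg_mul => //; exact: cdens_cinteg.
  by apply: cintegral_eq => t; rewrite conjM -expiN opprK.
have [|cu E] := @pairing_series _ _ _ _ _ Phi_ext oD lipD _ (E2_partial gam a (coeff gam Phi phi))
    cdens_conj_cinteg cdens_conj_mean.
  move=> n; apply: eq_bigr => m _; rewrite cc; congr (_ * (_ * _ / _)); apply: cintegral_eq => t.
  by rewrite mulrNz -pmulrn mulNr.
split=> //; rewrite /E2.
have -> : conjc (coeff gam Phi phi 1) = (L^-1)%:C * cintegral (fun t => conjc (cdens phi t) * expi t).
  by rewrite cc; congr (_ * _); apply: cintegral_eq => t; rewrite mul1r.
rewrite E cintegral_mul; [|exact: cdens_conj_cinteg|exact: (cbounded_bcurve Phi_ext)].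
have cR t : complex.Re (conjc (cdens phi t)) = dens gam Phi phi i1 t by rewrite -cdens_Re; case: (cdens phi t).
have cI t : complex.Im (conjc (cdens phi t)) = - dens gam Phi phi i2 t by rewrite -cdens_Im; case: (cdens phi t).
have [K _ HK] := bcurve_bounded Phi_ext; have xU := bcurve_uniform Phi_ext.
have i_2 := dens_integ Phi_ext oD lipD i2 L2.
rewrite /mom1 /mom2; congr (_ +i* _).
  rewrite -[X in _ = _ + X]opprK; congr (_ - _); first by apply: RI_eq => t _; rewrite cR.
  rewrite -mulN1r -RIZ; last exact: integ_Imx HK xU _ i_2.
  by apply: RI_eq => t _; rewrite cI mulN1r mulNr.
congr (_ + _); first by apply: RI_eq => t _; rewrite cR.
rewrite -mulN1r -RIZ; last exact: integ_Rex HK xU _ i_2.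
by apply: RI_eq => t _; rewrite cI mulN1r mulNr.
Qed.

End one_density.

Lemma emtE (g : 'I_2 -> 'I_2 -> 'rV[R]_2 -> 'rV[R]_2) i j l :
  emt gam Phi g i j i1 l = Mom1 (g i j) l /\ emt gam Phi g i j i2 l = Mom2 (g i j) l.
Proof.
split; apply: RI_eq => t _; rewrite /dens bdptE !mxE /=; ring.
Qed.

End moments.

Section background_fields.
Variable R : realType.

Lemma linear_field_affine (i j : 'I_2) : affine_field 0 ((i == i1) && (j == i1))%:R ((i == i2) && (j == i1))%:R
  0 ((i == i1) && (j == i2))%:R ((i == i2) && (j == i2))%:R (@linear_field R i j).
Proof.
move=> x; rewrite /linear_field !mxE /=.
have [->|->] := ord2E i; have [->|->] := ord2E j; rewrite /= ?mulr1 ?mulr0 ?mul1r ?mul0r ?addr0 ?add0r; by split.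
Qed.

Lemma background1_affine (kappa mu : R) (a0 : R[i]) : let c := (kappa - 1) / (2 * mu) in
  affine_field (- (c * complex.Re a0)) c 0 (- (c * complex.Im a0)) 0 c (complex_form (background1 kappa mu a0)).
Proof.
move=> c x; rewrite /complex_form /background1 -/c !mxE /= ReM ImM !(ReD, ImD, ReN, ImN) /=.
by split; ring.
Qed.

Lemma background2_affine (mu : R) (a0 : R[i]) : let d := (2 * mu)^-1 in
  affine_field (d * complex.Re a0) (- d) 0 (- (d * complex.Im a0)) 0 d (complex_form (background2 mu a0)).
Proof.
move=> d x; rewrite /complex_form /background2 -/d !mxE /=; case: a0 => u v /=.
by split; ring.
Qed.

Lemma background3_affine (mu : R) (a0 : R[i]) : mu != 0 -> let d := (2 * mu)^-1 in
  affine_field (- (d * complex.Im a0)) 0 d (- (d * complex.Re a0)) d 0 (complex_form (background3 mu a0)).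
Proof.
move=> mu0 d x; have -> : complex_form (background3 mu a0) x = ofC ((0 +i* d) * conjc (toC x - a0)).
  rewrite /complex_form /background3; congr (ofC (_ * _)).
  by rewrite -fmorphV /= -/d; apply/eqP; rewrite eq_complex; apply/andP; split; apply/eqP; rewrite ?ReM ?ImM /=; ring.
rewrite !mxE /=; case: a0 => u v /=.
by split; ring.
Qed.

End background_fields.

Theorem theorem1p1 (R : realType) (lam mu kappa : R) (D : set 'rV[R]_2)
    (gam : R) (Phi : R[i] -> R[i]) (a : nat -> R[i])
    (g : 'I_2 -> 'I_2 -> 'rV[R]_2 -> 'rV[R]_2)
    (phi1 phi2 phi3 : 'rV[R]_2 -> 'rV[R]_2)
    (mu_gt0 : 0 < mu) (lam_mu_gt0 : 0 < lam + mu)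
    (kappaE : kappa = (lam + 3 * mu) / (lam + mu))
    (D_domain : bounded_simply_connected_lipschitz_domain D)
    (Phi_ext : exterior_conformal_map D gam Phi a)
    (g_density : forall i j : 'I_2,
       is_density lam mu D gam Phi (linear_field i j) (g i j))
    (phi1_density : is_density lam mu D gam Phi
       (complex_form (background1 kappa mu (a 0%N))) phi1)
    (phi2_density : is_density lam mu D gam Phi
       (complex_form (background2 mu (a 0%N))) phi2)
    (phi3_density : is_density lam mu D gam Phi
       (complex_form (background3 mu (a 0%N))) phi3) :
  let m := emt gam Phi g in
  let c1 := coeff gam Phi phi1 in
  let c2 := coeff gam Phi phi2 in
  let c3 := coeff gam Phi phi3 in
  let E11 := E1 gam a c1 in let E21 := E2 gam a c1 in
  let E12 := E1 gam a c2 in let E22 := E2 gam a c2 in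
  let E13 := E1 gam a c3 in let E23 := E2 gam a c3 in
  [/\ E_convergent gam a c1, E_convergent gam a c2 & E_convergent gam a c3] /\
  (m i1 i1 i1 i1)%:C
    = (mu / (2 * (kappa - 1)))%:C * ((complex.Re E11)%:C + E21)
      - (mu / 2)%:C * ((complex.Re E12)%:C + E22) /\
  (m i2 i2 i2 i2)%:C
    = (mu / (2 * (kappa - 1)))%:C * (- (complex.Re E11)%:C + E21)
      + (mu / 2)%:C * (- (complex.Re E12)%:C + E22) /\
  m i1 i1 i2 i2
    = mu / (2 * (kappa - 1)) * complex.Re E21 + mu / 2 * complex.Re E12 /\
  m i1 i2 i1 i2 = mu / 2 * complex.Im E13 /\
  (m i1 i2 i1 i1)%:C = (mu / 2)%:C * ((complex.Re E13)%:C + E23) /\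
  (m i2 i1 i2 i2)%:C = (mu / 2)%:C * (- (complex.Re E13)%:C + E23).
Proof.
have [oD _ _ _ lipD] := D_domain.
move=> m c1 c2 c3 E11 E21 E12 E22 E13 E23.
have mu_neq0 : mu != 0 by rewrite gt_eqF.
have k1 : kappa - 1 != 0.
  have lm0 : lam + mu != 0 by rewrite gt_eqF.
  rewrite kappaE (_ : _ - 1 = 2 * mu / (lam + mu)); last by field.
  by rewrite !mulf_neq0 ?invr_eq0.
have L0 := two_pi_gt0 R; have A0 := kelvin_add_ge0 lam mu_gt0; have B0 := kelvin_sub_gt0 mu_gt0 lam_mu_gt0.
have al0 := kelvin_alpha_gt0 mu_gt0 lam_mu_gt0.
have [K _ xK] := bcurve_bounded Phi_ext; have xU := bcurve_uniform Phi_ext.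
have aff := density_affine Phi_ext oD lipD mu_gt0 lam_mu_gt0.
have dg i j := aff _ _ _ _ _ _ _ _ (g_density i j) (@linear_field_affine R i j).
have [r0 [r1 [r2 d11]]] := dg i1 i1; have [s0 [s1 [s2 d22]]] := dg i2 i2.
have [u0 [u1 [u2 d12]]] := dg i1 i2; have [v0 [v1 [v2 d21]]] := dg i2 i1.
have [x0 [x1 [x2 b1]]] := aff _ _ _ _ _ _ _ _ phi1_density (background1_affine kappa mu (a 0%N)).
have [y0 [y1 [y2 b2]]] := aff _ _ _ _ _ _ _ _ phi2_density (background2_affine mu (a 0%N)).
have [z0 [z1 [z2 b3]]] := aff _ _ _ _ _ _ _ _ phi3_density (background3_affine (a 0%N) mu_neq0).
rewrite /= in d11 d12 d21 d22 b1 b2 b3.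
have rig := affine_density_rigid3 L0 xK xU A0 B0 al0.
have sym := affine_density_sym L0 xK xU d11 d22.
pose c := (kappa - 1) / (2 * mu); pose d := (2 * mu)^-1.
(* Modulo rigid displacements, [u1 = c (x_1 e_1 + x_2 e_2)], [u2 = - d (x_1 e_1 - x_2 e_2)], [u3 = d
   (x_1 e_2 + x_2 e_1)] and [x_1 e_2 = x_2 e_1]. *)
have [p1 p2 p3 p4] := rig (- c) (- c) _ _ _ _ _ _ _ _ _ _ _ _ _ _ _ _ _ _ _ _ _ _ _ _ b1 d11 d22
  ltac:(rewrite /c; ring) ltac:(rewrite /c; ring) ltac:(ring).
have [q1 q2 q3 q4] := rig d (- d) _ _ _ _ _ _ _ _ _ _ _ _ _ _ _ _ _ _ _ _ _ _ _ _ b2 d11 d22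
  ltac:(rewrite /d; ring) ltac:(rewrite /d; ring) ltac:(ring).
have [w1 w2 w3 w4] := rig (- d) (- d) _ _ _ _ _ _ _ _ _ _ _ _ _ _ _ _ _ _ _ _ _ _ _ _ b3 d12 d21
  ltac:(ring) ltac:(ring) ltac:(rewrite /d; ring).
have [t1 t2 t3 t4] := rig (-1) 0 _ _ _ _ _ _ _ _ _ _ _ _ _ _ _ _ _ _ _ _ _ _ _ _ d12 d21 d21
  ltac:(ring) ltac:(ring) ltac:(ring).
have [_ _ m11 m12 h1 _] := b1; have [_ _ m21 m22 h2 _] := b2; have [_ _ m31 m32 h3 _] := b3.
have [_ _ _ _ h11 _] := d11; have [_ _ _ _ h22 _] := d22; have [_ _ _ _ h12 _] := d12.
have [_ [L21 _] _] := phi1_density; have [_ [L22 _] _] := phi2_density; have [_ [L23 _] _] := phi3_density.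
have [cv11 e11] := E1_value Phi_ext oD lipD L21 m11 m12; have [cv21 e21] := E2_value Phi_ext oD lipD L21 m11 m12.
have [cv12 e12] := E1_value Phi_ext oD lipD L22 m21 m22; have [cv22 e22] := E2_value Phi_ext oD lipD L22 m21 m22.
have [cv13 e13] := E1_value Phi_ext oD lipD L23 m31 m32; have [cv23 e23] := E2_value Phi_ext oD lipD L23 m31 m32.
split; first exact: And3 (conj cv11 cv21) (conj cv12 cv22) (conj cv13 cv23).
rewrite /E11 /E12 /E13 /E21 /E22 /E23 /m.
have [g1 _] := emtE gam Phi g i1 i1 i1; have [_ g2] := emtE gam Phi g i2 i2 i2.
have [_ g3] := emtE gam Phi g i1 i1 i2; have [g4 _] := emtE gam Phi g i1 i2 i2.
have [g5 _] := emtE gam Phi g i1 i2 i1; have [_ g6] := emtE gam Phi g i2 i1 i2.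
rewrite g1 g2 g3 g4 g5 g6 e11 e12 e13 e21 e22 e23 h1 h2 h3 !subrr /=.
have P0 : 16 * pi != 0 :> R by rewrite mulf_neq0 // gt_eqF // pi_gt0.
move: sym p1 p2 p3 p4 q1 q2 q3 q4 w1 w2 w3 w4 t1 t2 t3 t4; rewrite h1 h2 h3 h11 h22 h12.
move: (16 * pi : R) P0 => P P0.
move: (mom1 _ _ (dens gam Phi (g i1 i1) i1)) (mom1 _ _ (dens gam Phi (g i1 i1) i2)) (mom2 _ _ (dens gam Phi (g i1 i1) i2))
  (mom1 _ _ (dens gam Phi (g i2 i2) i1)) (mom1 _ _ (dens gam Phi (g i2 i2) i2)) (mom2 _ _ (dens gam Phi (g i2 i2) i2))
  (mom1 _ _ (dens gam Phi (g i1 i2) i1)) (mom1 _ _ (dens gam Phi (g i1 i2) i2)) (mom2 _ _ (dens gam Phi (g i1 i2) i2))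
  (mom1 _ _ (dens gam Phi (g i2 i1) i1)) (mom1 _ _ (dens gam Phi (g i2 i1) i2)) (mom2 _ _ (dens gam Phi (g i2 i1) i1))
  (mom2 _ _ (dens gam Phi (g i2 i1) i2))
  (mom1 _ _ (dens gam Phi phi1 i1)) (mom1 _ _ (dens gam Phi phi1 i2)) (mom2 _ _ (dens gam Phi phi1 i2))
  (mom1 _ _ (dens gam Phi phi2 i1)) (mom1 _ _ (dens gam Phi phi2 i2)) (mom2 _ _ (dens gam Phi phi2 i2))
  (mom1 _ _ (dens gam Phi phi3 i1)) (mom1 _ _ (dens gam Phi phi3 i2)) (mom2 _ _ (dens gam Phi phi3 i2)).
move=> A11 A12 A22 B11 B12 B22 C11 C12 C22 D11 D12 D21 D22 F11 F12 F22 G11 G12 G22 H11 H12 H22.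
move=> sym p1 _ _ p4 q1 _ _ q4 w1 _ w3 w4 t1 _ t3 t4.
(* Reciprocity between [x_1 e_1] and [x_2 e_2]. *)
have {sym} AB : B11 = A22.
  by apply: (mulfI P0); move: sym; rewrite !(mulr1, mulr0, mul0r, addr0, add0r); lra.
have {p1} F1 : F11 = c * (A11 + B11) by lra.
have {p4} F2 : F22 = c * (A22 + B22) by lra.
have {q1} G1 : G11 = - d * (A11 - B11) by lra.
have {q4} G2 : G22 = - d * (A22 - B22) by lra.
have {t1} D1 : D11 = C11 by lra.
have {t3} D2 : D12 = C12 by lra.
have {t4} D3 : D22 = C22 by lra.
have {w1} H1 : H11 = d * (C11 + D11) by lra.
have {w3} H2 : H12 = d * (C12 + D12) by lra.
have {w4} H3 : H22 = d * (C22 + D22) by lra.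
subst B11 D11 D12 D22 F11 F22 G11 G22 H11 H12 H22; rewrite /c /d.
do ![split]; try (apply/eqP; rewrite eq_complex; apply/andP; split; apply/eqP => /=).
all: by field; rewrite ?k1 ?mu_neq0.
Qed.
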